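(* Let $(\mathfrak{L}^{n+1},\mathfrak{g},\Psi)$ be an electrostatic spacetime and $P^n\hookrightarrow\mathfrak{L}^{n+1}$ a non-degenerate equipotential photon surface which is not a photon sphere (i.e. for which there exists $t_*\in\mathcal{T}$ with $\dot u(t_* )\neq0$). Then $P^n$ has at most countably many exceptional time slices $\Sigma^{n-1}(t_i)$, with $|t_i-t_j|>\varepsilon$ for all $i\ne j$ and for a suitable constant $\varepsilon>0$. In other words, if a non-degenerate equipotential photon surface $P^n$ in an electrostatic spacetime has a sequence of exceptional times $(t_i)_{i\in\mathbb{N}}\subseteq\mathcal{T}$ (with $\dot u(t_i)=0$) which accumulates at $t_0\in\mathcal{T}$, $t_i\ne t_0$, then $P^n$ must be a photon sphere (i.e. $\dot u\equiv0$ on $\mathcal{T}$).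
   Context: All manifolds and tensor fields are smooth, manifolds are connected, submanifolds embedded; $n\ge3$. Electrostatic spacetime: $\mathfrak{L}^{n+1}=\mathbb{R}\times M^n$, $\mathfrak{g}=-N^2dt^2+g$ with $(M^n,g)$ Riemannian, $N\colon M^n\to(0,\infty)$, together with a time-independent function $\Psi\colon M^n\to\mathbb{R}$; no field equations are assumed. $M^n(t)$ is the time slice at $t$. Photon surface: a timelike hypersurface $P^n$ such that null geodesics initially tangent to $P^n$ remain tangent as long as they exist; equivalently, $P^n$ is totally umbilic. Equipotential: $N$, $\Psi$ and $|d\Psi|_{\mathfrak{g}}$ are constant on each $\Sigma^{n-1}(t):=P^n\cap M^n(t)$. Photon sphere: a photon surface of the form $\mathbb{R}\times\Sigma^{n-1}$ along which $N,\Psi,|d\Psi|_{\mathfrak{g}}$ are constant. Non-degenerate: $dN\ne0$ at every point of $P^n$. $\mathcal{T}$ is the open interval of times $t$ with $\Sigma^{n-1}(t)\neq\emptyset$; $u(t)=N|_{\Sigma^{n-1}(t)}$, $\dot u=\frac{du}{dt}$. For $P^n$ which is not a photon sphere, $t_0\in\mathcal{T}$ is called exceptional, and $\Sigma^{n-1}(t_0)$ an exceptional time slice, if $\dot u(t_0)=0$. *)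

(* Defs.v *)
From HB Require Import structures.
From mathcomp Require Export all_boot all_order all_algebra.
From mathcomp Require Export all_classical all_reals all_analysis.
Export Order.TTheory GRing.Theory Num.Theory.
Export numFieldNormedType.Exports.

Set Implicit Arguments.
Unset Strict Implicit.
Unset Printing Implicit Defensive.

Local Open Scope classical_set_scope.
Local Open Scope ring_scope.

Section SmoothFunctions.
Context {R : realType} {m : nat}.
Implicit Types (f : 'rV[R]_m -> R) (U : set 'rV[R]_m).

Definition partial (a : 'I_m) f : 'rV[R]_m -> R :=
  fun y => 'D_(delta_mx 0 a) f y.

Definition iter_partial (l : seq 'I_m) f := foldr partial f l.

(* C^infinity on the open set U: the iterated partial derivatives of all
   orders exist and are (Frechet) differentiable on U.  The values of
   f outside U are irrelevant. *)
Definition smooth_on U f :=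
  forall (l : seq 'I_m) y, U y -> differentiable (iter_partial l f) y.

End SmoothFunctions.

(* A local coordinate system: cmap restricted to cdom, with inverse cinv on
   the image cmap @` cdom.  Both are total functions, with irrelevant values
   outside these sets. *)
Record chart (R : realType) (T : Type) (m : nat) := Chart {
  cdom : set T ;
  cmap : T -> 'rV[R]_m ;
  cinv : 'rV[R]_m -> T }.

(* An atlas is a family of charts indexed by I, and a tensor field is given by
   its components in each chart of the family.  Tangent vectors and covectors
   at a point are represented by the row vectors of their components in a
   chart ch i. *)
Section Geometry.
Context {R : realType} {T : topologicalType} {m : nat} {I : Type}.
Variables (ch : I -> chart R T m) (g : I -> T -> 'M[R]_m).

Definition is_chart (c : chart R T m) :=
  [/\ open (cdom c), open (cmap c @` cdom c),
      (forall p, cdom c p -> cinv c (cmap c p) = p),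
      {within cdom c, continuous (cmap c)} &
      {within cmap c @` cdom c, continuous (cinv c)}].

Definition transition (i j : I) (y : 'rV[R]_m) : 'rV[R]_m :=
  cmap (ch j) (cinv (ch i) y).

Definition smooth_atlas :=
  [/\ forall i, is_chart (ch i),
      forall p, exists i, cdom (ch i) p &
      forall i j k,
        smooth_on (cmap (ch i) @` (cdom (ch i) `&` cdom (ch j)))
                  (fun y => transition i j y 0 k)].

Definition connected_smooth_manifold :=
  [/\ hausdorff_space T, @second_countable T, connected [set: T]
    & smooth_atlas].

Definition smooth_fun (U : set T) (f : T -> R) :=
  forall i, smooth_on (cmap (ch i) @` (cdom (ch i) `&` U)) (f \o cinv (ch i)).

(* Components of df at p in the chart ch i. *)
Definition differential (i : I) (f : T -> R) (p : T) : 'rV[R]_m :=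
  \row_a partial a (f \o cinv (ch i)) (cmap (ch i) p).

Definition pairing (w v : 'rV[R]_m) : R := (w *m v^T) 0 0.

Definition inner (i : I) (p : T) (v w : 'rV[R]_m) : R :=
  (v *m g i p *m w^T) 0 0.

(* The norm of a (non-timelike) covector, by means of the inverse metric. *)
Definition conorm (i : I) (p : T) (w : 'rV[R]_m) : R :=
  Num.sqrt ((w *m invmx (g i p) *m w^T) 0 0).

Definition riemannian_metric :=
  [/\ forall i p, cdom (ch i) p -> (g i p)^T = g i p,
      forall i p v, cdom (ch i) p -> v != 0 -> 0 < inner i p v v,
      forall i a b, smooth_on (cmap (ch i) @` cdom (ch i))
                              (fun y => g i (cinv (ch i) y) a b) &
      (* Covariance under changes of charts: the components of a vector v
         in the charts i and j satisfy v_j = v_i *m J. *)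
      forall i j p, cdom (ch i) p -> cdom (ch j) p ->
        let J := 'J (transition i j) (cmap (ch i) p) in
        g i p = J *m g j p *m J^T].

Definition christoffel (i : I) (p : T) (c a b : 'I_m) : R :=
  let dg e a b :=
    partial e (fun y => g i (cinv (ch i) y) a b) (cmap (ch i) p) in
  2^-1 * \sum_e invmx (g i p) c e * (dg a b e + dg b a e - dg e a b).

(* Curves are total functions R -> T considered on an open interval J. *)
Definition coord (i : I) (gamma : R -> T) (a : 'I_m) (s : R) : R :=
  cmap (ch i) (gamma s) 0 a.

Definition velocity (i : I) (gamma : R -> T) (s : R) : 'rV[R]_m :=
  \row_a (coord i gamma a)^`()%classic s.

Definition open_interval (J : set R) := open J /\ is_interval J.

Definition smooth_curve (J : set R) (gamma : R -> T) :=
  {in J, continuous gamma} /\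
  forall i s, J s -> cdom (ch i) (gamma s) ->
    forall a k, derivable (derive1n k (coord i gamma a)) s 1.

Definition geodesic (J : set R) (gamma : R -> T) :=
  smooth_curve J gamma /\
  forall i s, J s -> cdom (ch i) (gamma s) -> forall c,
    derive1n 2 (coord i gamma c) s
    + \sum_a \sum_b christoffel i (gamma s) c a b
        * velocity i gamma s 0 a * velocity i gamma s 0 b = 0.

Definition null_geodesic (J : set R) (gamma : R -> T) :=
  geodesic J gamma /\
  forall i s, J s -> cdom (ch i) (gamma s) ->
    velocity i gamma s != 0 /\
    inner i (gamma s) (velocity i gamma s) (velocity i gamma s) = 0.

(* f is a defining function of P on the open set W: P is there the zero set
   of f, and f is a submersion along it. *)
Definition defining_function (P W : set T) (f : T -> R) :=
  [/\ open W, smooth_fun W f,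
      forall p, W p -> (P p <-> f p = 0) &
      forall i p, W p -> P p -> cdom (ch i) p -> differential i f p != 0].

Definition embedded_hypersurface (P : set T) :=
  forall p, P p -> exists W f, W p /\ defining_function P W f.

(* v is tangent to P at p (components in ch i): T_pP is the kernel of df for
   a defining function f of P near p. *)
Definition tangent (P : set T) (i : I) (p : T) (v : 'rV[R]_m) :=
  exists W f,
    [/\ W p, defining_function P W f & pairing (differential i f p) v = 0].

(* The metric induced on P has signature (-, +, ..., +). *)
Definition timelike (P : set T) :=
  forall i p, P p -> cdom (ch i) p ->
    exists v, [/\ tangent P i p v, inner i p v v < 0 &
      forall w, tangent P i p w -> inner i p v w = 0 -> w != 0 ->
        0 < inner i p w w].

Definition tangent_at (P : set T) (gamma : R -> T) (s : R) :=
  P (gamma s) /\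
  forall i, cdom (ch i) (gamma s) ->
    tangent P i (gamma s) (velocity i gamma s).

(* Null geodesics which are tangent to P at some parameter stay in P, and
   tangent to it, on any open interval on which they exist in the ambient
   manifold; they do not leave P through a missing boundary.  A proper open
   part of a photon surface is thus in general not a photon surface. *)
Definition photon_surface (P : set T) :=
  [/\ connected P, embedded_hypersurface P, timelike P &
      forall J gamma, open_interval J -> null_geodesic J gamma ->
        forall s0, J s0 -> tangent_at P gamma s0 ->
          forall s, J s -> tangent_at P gamma s].

End Geometry.

(* The spacetime R x M with metric - N^2 dt^2 + g, in the product charts
   (t, x) |-> (t, x^1, ..., x^n). *)
Section Electrostatic.
Context {R : realType} {M : topologicalType} {n : nat} {I : Type}.
Variables (ch : I -> chart R M n) (g : I -> M -> 'M[R]_n) (N Psi : M -> R).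

Definition st_chart (i : I) : chart R (R * M)%type (1 + n) :=
  Chart [set p | cdom (ch i) p.2]
        (fun p => row_mx (const_mx p.1) (cmap (ch i) p.2))
        (fun y : 'rV_(1 + n) => (lsubmx y 0 0, cinv (ch i) (rsubmx y))).

Definition st_metric (i : I) (p : R * M) : 'M[R]_(1 + n) :=
  block_mx (const_mx (- N p.2 ^+ 2)) 0 0 (g i p.2).

Definition electrostatic_spacetime :=
  [/\ connected_smooth_manifold ch, riemannian_metric ch g,
      smooth_fun ch setT N, (forall x, 0 < N x) & smooth_fun ch setT Psi].

Definition st_photon_surface (P : set (R * M)) :=
  photon_surface st_chart st_metric P.

(* | d Psi | in the spacetime metric, computed in the product chart i. *)
Definition norm_dPsi (i : I) (p : R * M) : R :=
  conorm st_metric i p (differential st_chart i (Psi \o snd) p).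

(* N, Psi and | d Psi | are constant on A. *)
Definition potentials_constant_on (A : set (R * M)) :=
  forall p q, A p -> A q ->
    [/\ N p.2 = N q.2, Psi p.2 = Psi q.2 &
        forall i j, cdom (st_chart i) p -> cdom (st_chart j) q ->
          norm_dPsi i p = norm_dPsi j q].

Definition time_slice (P : set (R * M)) (t : R) : set (R * M) :=
  P `&` [set p | p.1 = t].

Definition equipotential (P : set (R * M)) :=
  forall t, potentials_constant_on (time_slice P t).

Definition photon_sphere (P : set (R * M)) :=
  [/\ st_photon_surface P,
      exists Sigma : set M, P = [set p | Sigma p.2] &
      potentials_constant_on P].

Definition nondegenerate (P : set (R * M)) :=
  forall p i, P p -> cdom (ch i) p.2 -> differential ch i N p.2 != 0.

Definition times (P : set (R * M)) : set R :=
  [set t | time_slice P t !=set0].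

(* u(t): the value of N on the time slice at t, and 0 if this is empty; it is
   well defined when P is equipotential. *)
Definition slice_lapse (P : set (R * M)) (t : R) : R :=
  xget 0 [set N p.2 | p in time_slice P t].

Definition exceptional (P : set (R * M)) : set R :=
  [set t | times P t /\ (slice_lapse P)^`()%classic t = 0].

End Electrostatic.

(* Main.v *)
(** Null geodesics tangent to P at one parameter stay in P.  Along such a geodesic the
    time t is a local parameter and u(t) = N(x), so u is differentiable on the open set
    of times of P, and locally P is the level set N(x) = u(t), with conormal dN - u' dt.

    Let s(t) = e t + c with e = 1 or e = -1, and let Q be the set of points p of P for
    which s(p) lies in P and e u'(s(t)) = u'(t).  As s is an isometry of the spacetime
    taking the tangent space of P at p to that at s(p), the image under s of a null
    geodesic of P through p lies in P.  Hence Q is open in P and invariant along the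
    null geodesics of P.  A nearest-point argument, based on the fact that the null
    vectors span the tangent spaces of P, shows that such a set is also closed in P; as
    P is connected, Q is empty or equal to P.

    At an exceptional time the reflection s satisfies this condition on the whole time
    slice, so that P and u are symmetric about each exceptional time.  Two exceptional
    times at distance d give u the period 2 d; exceptional times arbitrarily close to
    each other thus force u to be constant.  If u is constant, then small time
    translations satisfy the condition, and P is a product with the time line. *)

(* A priori u is not even known to be continuous, and P may meet a time slice in several components,
   so there is neither an evolution equation for u nor a global product picture of P to start from.
   What can be followed are null geodesics: every point of P has one that starts tangent to P, and
   the photon surface property keeps it in P. The same property places its image under s in P as
   soon as that image is tangent to P at a single parameter; the condition on u' in Q provides this
   tangency.

   A null geodesic through a point of Q covers a whole interval of times, so u(s(t)) = u(t) on that
   interval; the local level set description then carries nearby points of P into P, which makes Q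
   open in P. Closedness is the harder half, because a limit point of Q need not lie on a geodesic
   that meets Q. The nearest-point argument, in the manner of the invariance theorems of Nagumo and
   Bony, overcomes this by local existence of geodesics with prescribed null tangent velocity. *)
From mathcomp Require Import ring lra.
Require Import Defs.

Set Implicit Arguments.
Unset Strict Implicit.
Unset Printing Implicit Defensive.

Local Open Scope classical_set_scope.
Local Open Scope ring_scope.

(** * Differential calculus in coordinates *)

Section Near.
Context {R : realType} {V W : normedModType R}.

Lemma near_eq_differentiable (f g : V -> W) x :
  (\near x, f x = g x) -> differentiable f x -> differentiable g x.
Proof.
move=> fg df; have fgx := nbhs_singleton fg.
have [cd lf] := (diff_locallyP x f).1 df.
have lg : g \o shift x = cst (g x) + 'd f x +o_ 0 id.
  apply/eqaddoP => e e0; move/eqaddoP: lf => /(_ e e0).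
  have : \forall h \near 0, f (h + x) = g (h + x).
    have : (h + x) @[h --> (0 : V)] --> (0 + x : V).
      by apply: cvgD; [exact: cvg_id|exact: cvg_cst].
    by rewrite add0r => /(_ _ fg).
  apply: filterS2 => h /= fgh.
  by rewrite /cst /= -[X in _ -> X]/(is_true (`|g (h + x) - (g x + 'd f x h)| <= _)) -fgx -fgh.
have dg := diff_unique cd lg.
by apply/diff_locallyP; rewrite dg; split.
Qed.

Lemma diff_eps (f : V -> W) x e : differentiable f x -> 0 < e ->
  \forall h \near 0, `|f (h + x) - f x - 'D_h f x| <= e * `|h|.
Proof.
move=> df e0; have [cd lf] := (diff_locallyP x f).1 df.
move/eqaddoP: lf => /(_ e e0); apply: filterS => h /=.
by rewrite deriveE// /cst opprD addrA.
Qed.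

End Near.

Section Chain.
Context {R : realType}.

Lemma differentiable_row (V : normedModType R) m (phi : V -> 'rV[R]_m) x :
  (forall a, differentiable (fun y => phi y 0 a) x) -> differentiable phi x.
Proof.
move=> dphi.
have -> : phi = \sum_(a < m) (fun y => phi y 0 a *: delta_mx 0 a).
  by apply/funext => y; rewrite fct_sumE [LHS]row_sum_delta.
by apply: differentiable_sum => a; apply: differentiableZl.
Qed.

Lemma derive_partial m (F : 'rV[R]_m -> R) y v : differentiable F y ->
  'D_v F y = \sum_a v 0 a * partial a F y.
Proof.
move=> dF; rewrite deriveE// {1}[v]row_sum_delta linear_sum.
by apply: eq_bigr => a _; rewrite linearZ/= /partial deriveE.
Qed.

Lemma is_derive_comp_row (V : normedModType R) m (F : 'rV[R]_m -> R)
    (phi : V -> 'rV[R]_m) x v :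
  differentiable F (phi x) -> (forall a, differentiable (fun y => phi y 0 a) x) ->
  is_derive x v (F \o phi)
    (\sum_a 'D_v (fun y => phi y 0 a) x * partial a F (phi x)).
Proof.
move=> dF dphi; have dp := differentiable_row dphi.
have dFp : differentiable (F \o phi) x by exact: differentiable_comp.
apply: DeriveDef; first exact: diff_derivable.
rewrite deriveE// diff_comp//= -!deriveE// derive_partial//.
apply: eq_bigr => a _; congr (_ * _).
by rewrite derive_mx ?mxE//; exact: diff_derivable.
Qed.

Lemma is_derive_curve m (F : 'rV[R]_m -> R) (c : R -> 'rV[R]_m) s :
  differentiable F (c s) -> (forall a, derivable (fun r => c r 0 a) s 1) ->
  is_derive s 1 (F \o c)
    (\sum_a 'D_1 (fun r => c r 0 a) s * partial a F (c s)).
Proof.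
by move=> dF dc; apply: is_derive_comp_row => // a; apply/derivable1_diffP.
Qed.

Lemma differentiable_comp_row (V : normedModType R) m (F : 'rV[R]_m -> R)
    (phi : V -> 'rV[R]_m) x :
  differentiable F (phi x) -> (forall a, differentiable (fun y => phi y 0 a) x) ->
  differentiable (F \o phi) x.
Proof. by move=> dF /differentiable_row; move/differentiable_comp; apply. Qed.

Lemma partial_comp k m (F : 'rV[R]_m -> R) (phi : 'rV[R]_k -> 'rV[R]_m) y b :
  differentiable F (phi y) -> (forall a, differentiable (fun z => phi z 0 a) y) ->
  partial b (F \o phi) y =
  \sum_a partial b (fun z => phi z 0 a) y * partial a F (phi y).
Proof. by move=> dF dphi; rewrite /partial (derive_val (is_derive := is_derive_comp_row _ dF
    dphi)). Qed.

End Chain.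

Section SmoothClosure.
Context {R : realType}.

(** Regularity of finite order. The derivative of a product, an inverse or a composite again
    contains the undifferentiated functions, so the closure properties need an induction on the
    order, which [smooth_on] does not offer. *)
Fixpoint ck_on (k : nat) m (U : set 'rV[R]_m) (f : 'rV[R]_m -> R) : Prop :=
  (forall y, U y -> differentiable f y) /\
  if k is k'.+1 then forall a, ck_on k' U (partial a f) else True.

Lemma iter_partial_rcons m (l : seq 'I_m) a (f : 'rV[R]_m -> R) :
  iter_partial (rcons l a) f = iter_partial l (partial a f).
Proof. by rewrite /iter_partial -cats1 foldr_cat. Qed.

Lemma smooth_onP m (U : set 'rV[R]_m) f : smooth_on U f <-> forall k, ck_on k U f.
Proof.
split=> [sf k|Cf l].
  elim: k f sf => [|k IH] f sf /=; split=> //.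
  - exact: sf [::].
  - exact: sf [::].
  - by move=> a; apply: IH => l y Uy; rewrite -iter_partial_rcons; exact: sf.
elim/last_ind: l f Cf => [|l a IH] f Cf; first by case: (Cf 0).
by rewrite iter_partial_rcons; apply: IH => k; case: (Cf k.+1) => _; exact.
Qed.

Lemma ck_on_diff k m (U : set 'rV[R]_m) f y : ck_on k U f -> U y -> differentiable f y.
Proof. by case: k => [|k] [df _]; exact: df. Qed.

Lemma ck_on_pred k m (U : set 'rV[R]_m) f : ck_on k.+1 U f -> ck_on k U f.
Proof.
elim: k f => [|k IH] f [df pf]; split => //.
by move=> a; apply: IH; apply: pf.
Qed.

Lemma smooth_diff m (U : set 'rV[R]_m) f y :
  smooth_on U f -> U y -> differentiable f y.
Proof. by move=> sf; exact: sf [::] y. Qed.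

Lemma smooth_partial m (U : set 'rV[R]_m) f a :
  smooth_on U f -> smooth_on U (partial a f).
Proof. by move=> sf l y Uy; rewrite -iter_partial_rcons; exact: sf. Qed.

Lemma smooth_sub m (U V : set 'rV[R]_m) f :
  U `<=` V -> smooth_on V f -> smooth_on U f.
Proof. by move=> UV sf l y Uy; exact/sf/UV. Qed.

Lemma partial_ext m (U : set 'rV[R]_m) f g a y :
  open U -> (forall y, U y -> f y = g y) -> U y -> partial a f y = partial a g y.
Proof.
move=> oU fg Uy; apply: near_eq_derive.
by apply: filterS (open_nbhs_nbhs (conj oU Uy)) => z; exact: fg.
Qed.

Lemma ck_on_ext k m (U : set 'rV[R]_m) f g :
  open U -> (forall y, U y -> f y = g y) -> ck_on k U f -> ck_on k U g.
Proof.
move=> oU; elim: k f g => [|k IH] f g fg [df pf].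
  split=> // y Uy; apply: near_eq_differentiable (df _ Uy).
  by apply: filterS (open_nbhs_nbhs (conj oU Uy)) => z; exact: fg.
split=> [y Uy|a].
  apply: near_eq_differentiable (df _ Uy).
  by apply: filterS (open_nbhs_nbhs (conj oU Uy)) => z; exact: fg.
by apply: IH (pf a) => y Uy; exact: partial_ext Uy.
Qed.

Lemma smooth_ext m (U : set 'rV[R]_m) f g :
  open U -> (forall y, U y -> f y = g y) -> smooth_on U f -> smooth_on U g.
Proof.
by move=> oU fg /smooth_onP sf; apply/smooth_onP => k; exact: ck_on_ext (sf k).
Qed.

Lemma partial_cst m (c : R) a : partial a (fun _ : 'rV[R]_m => c) = fun=> 0.
Proof. by apply/funext => y; rewrite /partial derive_cst. Qed.

Lemma ck_on_cst k m (U : set 'rV[R]_m) c : ck_on k U (fun=> c).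
Proof.
by elim: k c => [|k IH] c; split=> // a; rewrite partial_cst.
Qed.

Lemma partial_coord m a b : partial a (fun y : 'rV[R]_m => y 0 b) = fun=> (a == b)%:R.
Proof.
apply/funext => y; rewrite /partial.
have dl : differentiable (id : 'rV[R]_m -> 'rV[R]_m) y by [].
have /derive_mx := @diff_derivable _ _ _ _ y (delta_mx 0 a : 'rV[R]_m) dl.
by rewrite derive_id => /rowP/(_ b); rewrite !mxE eqxx/= eq_sym.
Qed.

Lemma ck_on_coord k m (U : set 'rV[R]_m) b : ck_on k U (fun y => y 0 b).
Proof.
have d y : U y -> differentiable (fun y : 'rV[R]_m => y 0 b) y.
  by move=> _; exact: differentiable_coord.
case: k => [|k]; split=> // a.
by rewrite partial_coord; exact: ck_on_cst.
Qed.

Lemma ck_on_add k m (U : set 'rV[R]_m) f g : open U ->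
  ck_on k U f -> ck_on k U g -> ck_on k U (fun y => f y + g y).
Proof.
move=> oU; elim: k f g => [|k IH] f g [df pf] [dg pg]; split=> //.
- by move=> y Uy; apply: differentiableD; [exact: df|exact: dg].
- by move=> y Uy; apply: differentiableD; [exact: df|exact: dg].
- move=> a; apply: ck_on_ext (IH _ _ (pf a) (pg a)) => // y Uy.
  rewrite /partial -[RHS]/('D_(delta_mx 0 a) (f + g) y) deriveD//.
  + exact/diff_derivable/df.
  + exact/diff_derivable/dg.
Qed.

Lemma ck_on_mul k m (U : set 'rV[R]_m) f g : open U ->
  ck_on k U f -> ck_on k U g -> ck_on k U (fun y => f y * g y).
Proof.
move=> oU; elim: k f g => [|k IH] f g Cf Cg; have [df pf] := Cf; have [dg pg] := Cg; split=> //.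
- by move=> y Uy; apply: differentiableM; [exact: df|exact: dg].
- by move=> y Uy; apply: differentiableM; [exact: df|exact: dg].
- move=> a; apply: ck_on_ext (ck_on_add oU (IH _ _ (ck_on_pred Cf) (pg a)) (IH _ _ (ck_on_pred
    Cg) (pf a))) => // y Uy.
  rewrite /partial -[RHS]/('D_(delta_mx 0 a) (f * g) y) deriveM//.
  + exact/diff_derivable/df.
  + exact/diff_derivable/dg.
Qed.

Lemma ck_on_inv k m (U : set 'rV[R]_m) f : open U -> (forall y, U y -> f y != 0) ->
  ck_on k U f -> ck_on k U (fun y => (f y)^-1).
Proof.
move=> oU f0; elim: k => [|k IH] Cf; have [df pf] := Cf; split=> //.
- by move=> y Uy; apply: differentiableV; [exact: df|exact: f0].
- by move=> y Uy; apply: differentiableV; [exact: df|exact: f0].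
- move=> a; have Ci := IH (ck_on_pred Cf).
  (* The derivative of the inverse is [- partial a f] times the square of the inverse, whose
     regularity of order [k] is the induction hypothesis. *)
  have Cm := ck_on_mul oU (ck_on_cst k U (-1)) (ck_on_mul oU (pf a) (ck_on_mul oU Ci Ci)).
  apply: ck_on_ext Cm => // y Uy.
  rewrite /partial deriveV ?f0//; last exact/diff_derivable/df.
  rewrite /GRing.scale/= -exprVn expr2 mulN1r mulNr; congr (- _).
  by rewrite mulrC.
Qed.

Lemma ck_on_sum k m (U : set 'rV[R]_m) (T : Type) (l : seq T) (f : T -> 'rV[R]_m -> R) : open U ->
  (forall i, ck_on k U (f i)) -> ck_on k U (fun y => \sum_(i <- l) f i y).
Proof.
move=> oU Cf; elim: l => [|i l IH].
  by rewrite (_ : (fun _ => _) = fun=> 0); [exact: ck_on_cst|apply/funext => y; rewrite big_nil].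
rewrite (_ : (fun _ => _) = fun y => f i y + \sum_(j <- l) f j y); first exact: ck_on_add.
by apply/funext => y; rewrite big_cons.
Qed.

Lemma ck_on_prod k m (U : set 'rV[R]_m) (T : Type) (l : seq T) (f : T -> 'rV[R]_m -> R) : open U ->
  (forall i, ck_on k U (f i)) -> ck_on k U (fun y => \prod_(i <- l) f i y).
Proof.
move=> oU Cf; elim: l => [|i l IH].
  by rewrite (_ : (fun _ => _) = fun=> 1); [exact: ck_on_cst|apply/funext => y; rewrite big_nil].
rewrite (_ : (fun _ => _) = fun y => f i y * \prod_(j <- l) f j y); first exact: ck_on_mul.
by apply/funext => y; rewrite big_cons.
Qed.

Lemma ck_on_comp k l m (U : set 'rV[R]_l) (V : set 'rV[R]_m)
    (F : 'rV[R]_m -> R) (phi : 'rV[R]_l -> 'rV[R]_m) :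
  open U -> (forall y, U y -> V (phi y)) ->
  (forall a, ck_on k U (fun y => phi y 0 a)) -> ck_on k V F -> ck_on k U (F \o phi).
Proof.
move=> oU UV; elim: k F => [|k IH] F Cp [dF pF]; split=> //.
- by move=> y Uy; apply: differentiable_comp_row => [|a]; [exact/dF/UV|exact: ck_on_diff (Cp a) Uy].
- by move=> y Uy; apply: differentiable_comp_row => [|a]; [exact/dF/UV|exact: ck_on_diff (Cp a) Uy].
- move=> b; have Cs : ck_on k U (fun y => \sum_a partial b (fun z => phi z 0 a) y * (partial a F
    \o phi) y).
    apply: ck_on_sum => // a; apply: ck_on_mul => //; first exact: (Cp a).2.
    by apply: IH (pF a) => c; exact: ck_on_pred.
  apply: ck_on_ext Cs => // y Uy; rewrite partial_comp//; first exact/dF/UV.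
  by move=> a; exact: ck_on_diff (Cp a) Uy.
Qed.

Section Smooth.
Variables (m : nat) (U : set 'rV[R]_m) (oU : open U).
Implicit Types f g : 'rV[R]_m -> R.

Lemma smooth_cst c : smooth_on U (fun=> c).
Proof. by apply/smooth_onP => k; exact: ck_on_cst. Qed.

Lemma smooth_coord b : smooth_on U (fun y => y 0 b).
Proof. by apply/smooth_onP => k; exact: ck_on_coord. Qed.

Lemma smooth_add f g : smooth_on U f -> smooth_on U g -> smooth_on U (fun y => f y + g y).
Proof. by move=> /smooth_onP sf /smooth_onP sg; apply/smooth_onP => k; exact: ck_on_add. Qed.

Lemma smooth_mul f g : smooth_on U f -> smooth_on U g -> smooth_on U (fun y => f y * g y).
Proof. by move=> /smooth_onP sf /smooth_onP sg; apply/smooth_onP => k; exact: ck_on_mul. Qed.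

Lemma smooth_opp f : smooth_on U f -> smooth_on U (fun y => - f y).
Proof.
by move=> sf; apply: smooth_ext (smooth_mul (smooth_cst (-1)) sf) => // y _; rewrite mulN1r.
Qed.

Lemma smooth_inv f : (forall y, U y -> f y != 0) -> smooth_on U f -> smooth_on U (fun y => (f
    y)^-1).
Proof. by move=> f0 /smooth_onP sf; apply/smooth_onP => k; exact: ck_on_inv. Qed.

Lemma smooth_sum (T : Type) (l : seq T) (f : T -> 'rV[R]_m -> R) :
  (forall i, smooth_on U (f i)) -> smooth_on U (fun y => \sum_(i <- l) f i y).
Proof. by move=> sf; apply/smooth_onP => k; apply: ck_on_sum => // i; apply/smooth_onP: k. Qed.

Lemma smooth_prod (T : Type) (l : seq T) (f : T -> 'rV[R]_m -> R) :
  (forall i, smooth_on U (f i)) -> smooth_on U (fun y => \prod_(i <- l) f i y).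
Proof. by move=> sf; apply/smooth_onP => k; apply: ck_on_prod => // i; apply/smooth_onP: k. Qed.

Lemma smooth_comp l (V : set 'rV[R]_l) (F : 'rV[R]_l -> R) (phi : 'rV[R]_m -> 'rV[R]_l) :
  (forall y, U y -> V (phi y)) ->
  (forall a, smooth_on U (fun y => phi y 0 a)) -> smooth_on V F -> smooth_on U (F \o phi).
Proof.
move=> UV sp /smooth_onP sF; apply/smooth_onP => k; apply: ck_on_comp (sF k) => // a.
by move: k; exact/smooth_onP.
Qed.

Lemma smooth_det n (A : 'rV[R]_m -> 'M[R]_n) :
  (forall i j, smooth_on U (fun y => A y i j)) -> smooth_on U (fun y => \det (A y)).
Proof.
move=> sA; apply: smooth_sum => s; apply: smooth_mul; first exact: smooth_cst.
by apply: smooth_prod => i; exact: sA.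
Qed.

(** Cramer's rule: the entries of the inverse are cofactors divided by the determinant. *)
Lemma smooth_invmx n (A : 'rV[R]_m -> 'M[R]_n) :
  (forall i j, smooth_on U (fun y => A y i j)) -> (forall y, U y -> A y \in unitmx) ->
  forall i j, smooth_on U (fun y => invmx (A y) i j).
Proof.
move=> sA Au i j.
have s : smooth_on U (fun y => (\det (A y))^-1 * ((-1) ^+ (j + i) * \det (row' j (col' i (A y))))).
  apply: smooth_mul.
    by apply: smooth_inv; [move=> y /Au; rewrite unitmxE unitfE|exact: smooth_det].
  apply: smooth_mul; first exact: smooth_cst.
  apply: smooth_det => a b; apply: smooth_ext (sA (lift j a) (lift i b)) => // y _.
  by rewrite !mxE.
apply: smooth_ext s => // y Uy.
by rewrite /invmx Au// !mxE /cofactor.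
Qed.

End Smooth.
End SmoothClosure.

(** * Mean value inequalities and antiderivatives *)

Section RowNorm.
Context {R : realType}.

Lemma row_norm_le m (v : 'rV[R]_m) r : 0 <= r ->
  (forall a, `|v 0 a| <= r) -> `|v| <= r.
Proof.
move=> r0 vr; rewrite /Num.norm/= mx_normrE; apply: bigmax_le => // -[i a] _ /=.
by rewrite ord1.
Qed.

Lemma coord_norm_le m (v : 'rV[R]_m) a : `|v 0 a| <= `|v|.
Proof.
by rewrite [leRHS]/Num.norm/= mx_normrE; apply: (le_bigmax _ _ (0, a)).
Qed.

Lemma row_sum_norm_le m (v w : 'rV[R]_m) B : (forall a, `|w 0 a| <= B) ->
  `|\sum_a v 0 a * w 0 a| <= m%:R * B * `|v|.
Proof.
move=> wB; apply: le_trans (ler_norm_sum _ _ _) _.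
rewrite -mulrA -[X in X%:R](card_ord m) mulr_natl -sumr_const; apply: ler_sum => a _.
rewrite normrM mulrC; apply: ler_pM => //; exact: coord_norm_le.
Qed.

End RowNorm.

Section MeanValue.
Context {R : realType}.

Lemma is_derive1_continuous (f : R -> R) (s d : R) : is_derive s 1 f d -> {for s, continuous f}.
Proof. by move=> [df _]; apply/differentiable_continuous/derivable1_diffP. Qed.

Lemma within_derive_continuous (f df : R -> R) (a b : R) :
  (forall x : R, a <= x <= b -> is_derive x 1 f (df x)) -> {within `[a, b], continuous f}.
Proof.
move=> fd; apply: continuous_in_subspaceT => x; rewrite inE/= in_itv/= => xab.
exact: is_derive1_continuous (fd _ xab).
Qed.

Lemma mean_value (f df : R -> R) (a b : R) : a < b ->
  (forall x : R, a <= x <= b -> is_derive x 1 f (df x)) ->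
  exists2 c, a < c < b & f b - f a = df c * (b - a).
Proof.
move=> ab fd; have [|x|c cab ->] := @MVT R f df a b ab.
- by move=> x; rewrite in_itv/= => /andP[/ltW ax /ltW xb]; apply: fd; rewrite ax.
- by move: x; exact: within_derive_continuous fd.
- by exists c => //; move: cab; rewrite in_itv.
Qed.

Lemma mean_value_ineq (f df : R -> R) (d e s : R) : 0 <= e ->
  (forall x : R, `|x| < d -> is_derive x 1 f (df x)) ->
  (forall x, `|x| < d -> `|df x| <= e) -> `|s| < d ->
  `|f s - f 0| <= e * `|s|.
Proof.
move=> e0 fd fe sd; have [s0|s0|->] := ltgtP s 0; last by rewrite subrr !normr0 mulr0.
- have [x|c /andP[sc c0] E] := @mean_value f df _ _ s0.
    move=> /andP[sx x0]; apply: fd; apply: le_lt_trans sd.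
    by rewrite !ler0_norm// ?lerN2//; exact: ltW.
  rewrite distrC E sub0r normrM normrN ler_wpM2r// fe//; apply: lt_trans sd.
  by rewrite !ltr0_norm ?ltrN2.
- have [x|c /andP[sc c0] E] := @mean_value f df _ _ s0.
    move=> /andP[sx x0]; apply: fd; apply: le_lt_trans sd.
    by rewrite !ger0_norm//; exact: ltW.
  rewrite E subr0 normrM ler_wpM2r// fe//; apply: lt_trans sd.
  by rewrite !gtr0_norm.
Qed.

Lemma is_derive_affine (a b t : R) : is_derive t 1 (fun r => a + r * b) b.
Proof.
have h := is_deriveD (is_derive_cst a t 1) (is_deriveM (is_derive_id t 1) (is_derive_cst b t 1)).
by apply: (@is_derive_eq _ _ _ _ _ _ _ _ h); rewrite /cst /GRing.scale/= mulr0 !add0r mulr1.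
Qed.

Lemma is_derive_line m (F : 'rV[R]_m -> R) (z v : 'rV[R]_m) (t : R) :
  differentiable F (z + t *: v) ->
  is_derive t 1 (fun t => F (z + t *: v)) (\sum_a v 0 a * partial a F (z + t *: v)).
Proof.
move=> dF.
have d a : is_derive t 1 (fun r => (z + r *: v) 0 a) (v 0 a).
  rewrite (_ : (fun _ => _) = (fun r => z 0 a + r * v 0 a)); last first.
    by apply/funext => r; rewrite !mxE.
  exact: is_derive_affine.
have /= := @is_derive_curve R m F (fun r => z + r *: v) t dF (fun a => @ex_derive _ _ _ _ _ _ _
    (d a)).
rewrite (eq_bigr (fun a => v 0 a * partial a F (z + t *: v)))// => a _.
by rewrite (@derive_val _ _ _ _ _ _ _ (d a)).
Qed.

Lemma mean_value_row m (F : 'rV[R]_m -> R) (y z : 'rV[R]_m) :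
  (forall t, 0 <= t <= 1 -> differentiable F (z + t *: (y - z))) ->
  exists2 t, 0 < t < 1 &
    F y - F z = \sum_a (y - z) 0 a * partial a F (z + t *: (y - z)).
Proof.
move=> dF; have [|x x01|t t01 E] := @mean_value (fun t => F (z + t *: (y - z)))
   (fun t => \sum_a (y - z) 0 a * partial a F (z + t *: (y - z))) 0 1.
- exact: ltr01.
- exact/is_derive_line/dF.
- exists t => //; move: E; rewrite scale1r scale0r addr0 subr0 mulr1 => <-.
  by rewrite subrKC.
Qed.

End MeanValue.

Section Antiderivative.
Context {R : realType}.

(* Integrating from -1 makes 0 an interior point of the interval of integration. *)
Definition antider (f : R -> R) (x : R) : R :=
  (\int[lebesgue_measure]_(t in `[(-1)%R, x]) (f t))%R -
  (\int[lebesgue_measure]_(t in `[(-1)%R, 0%R]) (f t))%R.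

Lemma antider0 f : antider f 0 = 0. Proof. exact: subrr. Qed.

Lemma antiderP f (x : R) : continuous f -> `|x| < 1 -> is_derive x 1 (antider f) (f x).
Proof.
move=> cf; rewrite ltr_norml => /andP[x1 x1'].
have [||| dF EF] := @continuous_FTC1 R f (BLeft (-1)) x 1 x1'.
- by apply: continuous_compact_integrable; [exact: segment_compact|exact: continuous_subspaceT].
- by rewrite /= lte_fin.
- exact: cf.
have dF' := derivableP dF.
rewrite /antider; apply: is_derive_eq.
by rewrite subr0 -derive1E.
Qed.

End Antiderivative.

Section GeometricSequences.
Context {R : realType}.

(** With [D n] = 2 C / 2^n the intervals from [u n - D n] to [u n + D n] are nested, since
    [D n - D n.+1] is exactly the permitted increment. The supremum of the lower ends lies in all of
    them. *)
Lemma geometric_limit (u : nat -> R) C : 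
  (forall n, `|u n.+1 - u n| <= C * 2^-1 ^+ n) ->
  exists l, forall n, `|l - u n| <= 2 * C * 2^-1 ^+ n.
Proof.
move=> uC; set D := fun n => 2 * C * 2^-1 ^+ n.
have D0 n : 0 <= D n.
  by rewrite /D -mulrA mulr_ge0//; exact: le_trans (uC n).
have DS n : D n = D n.+1 + C * 2^-1 ^+ n by rewrite /D exprS; field.
have DS' n : D n.+1 = C * 2^-1 ^+ n by rewrite /D exprS; field.
have lo m k : u m - D m <= u (m + k)%N - D (m + k)%N.
  elim: k => [|k IH]; first by rewrite addn0.
  apply: le_trans IH _; rewrite addnS.
  move: (uC (m + k)%N) (DS (m + k)%N) (DS' (m + k)%N); rewrite ler_norml => /andP[].
  lra.
have hi m k : u (m + k)%N + D (m + k)%N <= u m + D m.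
  elim: k => [|k IH]; first by rewrite addn0.
  apply: le_trans IH; rewrite addnS.
  move: (uC (m + k)%N) (DS (m + k)%N) (DS' (m + k)%N); rewrite ler_norml => /andP[].
  lra.
have lohi m n : u m - D m <= u n + D n.
  have := D0 (m + n)%N; have := lo m n; have := hi n m; rewrite (addnC n m); lra.
set A := range (fun n => u n - D n).
have A0 : A !=set0 by exists (u 0%N - D 0%N), 0%N.
exists (sup A) => n; rewrite ler_norml; apply/andP; split.
  have : u n - D n <= sup A.
    by apply: ub_le_sup; [exists (u 0%N + D 0%N) => _ [m _ <-]|exists n].
  rewrite -/(D n); lra.
have : sup A <= u n + D n by apply: ge_sup => // _ [m _ <-].
rewrite -/(D n); lra.
Qed.

Lemma le_geometric_eq0 (x C : R) : (forall n, `|x| <= C * 2^-1 ^+ n) -> x = 0.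
Proof.
move=> xC; apply/eqP; rewrite -normr_le0.
have h : (C * 2^-1 ^+ n) @[n --> \oo] --> 0.
  rewrite -[X in _ --> X](mulr0 C); apply: cvgMr.
  by apply: cvg_expr; rewrite gtr0_norm; lra.
exact: cvgr_to_ge h (nearW _ xC).
Qed.

End GeometricSequences.

(** * Local solutions of ordinary differential equations *)

Section Clamp.
Context {R : realType}.

Definition clamp (d x : R) : R := Num.max (- d) (Num.min d x).

Lemma clamp_id d x : `|x| <= d -> clamp d x = x.
Proof.
by rewrite ler_norml /clamp => /andP[dx xd]; rewrite (min_idPr xd) (max_idPr dx).
Qed.

Lemma clamp_le d x : 0 <= d -> `|clamp d x| <= d.
Proof.
move=> d0; rewrite /clamp ler_norml le_max lexx/= ge_max ge_min lexx/= andbT.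
lra.
Qed.

Lemma maxr_lipschitz (a x y : R) : `|Num.max a x - Num.max a y| <= `|x - y|.
Proof.
have h1 := ler_norm (x - y); have := ler_norm (y - x); rewrite distrC => h2.
by case: (leP a x) => ax; case: (leP a y) => ay; rewrite ?subrr ?normr0//;
  rewrite ler_norml; apply/andP; split; lra.
Qed.

Lemma minr_lipschitz (a x y : R) : `|Num.min a x - Num.min a y| <= `|x - y|.
Proof.
have h1 := ler_norm (x - y); have := ler_norm (y - x); rewrite distrC => h2.
by case: (leP a x) => ax; case: (leP a y) => ay; rewrite ?subrr ?normr0//;
  rewrite ler_norml; apply/andP; split; lra.
Qed.

Lemma clamp_lipschitz d x y : `|clamp d x - clamp d y| <= `|x - y|.
Proof. exact: le_trans (maxr_lipschitz _ _ _) (minr_lipschitz _ _ _). Qed.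

Lemma lipschitz_continuous (V : normedModType R) (f : V -> R) (C : R) :
  (forall x y, `|f x - f y| <= C * `|x - y|) -> continuous f.
Proof.
move=> fC x; apply/cvgrPdist_lt => e e0.
have C1 : 0 < `|C| + 1 by rewrite ltr_pwDr.
near=> y; apply: le_lt_trans (fC _ _) _.
apply: (@le_lt_trans _ _ ((`|C| + 1) * `|x - y|)).
  by apply: ler_wpM2r => //; rewrite (le_trans (ler_norm C))// lerDl.
rewrite -ltr_pdivlMl//; near: y.
by apply: (@cvgr_dist_lt _ _ _ _ _ id x) => //; rewrite mulr_gt0// invr_gt0.
Unshelve. all: by end_near. Qed.

Lemma clamp_continuous d : continuous (clamp d).
Proof.
by apply: (@lipschitz_continuous _ _ 1) => x y; rewrite mul1r clamp_lipschitz.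
Qed.

End Clamp.

Section Picard.
Context {R : realType}.

Lemma row_continuous (T : topologicalType) k (Y : T -> 'rV[R]_k) x :
  (forall a, {for x, continuous (fun s => Y s 0 a)}) -> {for x, continuous Y}.
Proof.
move=> cY; apply/cvgrPdist_lt => e e0.
have e2 : 0 < e / 2 by rewrite divr_gt0.
have : \forall s \near x, forall a, `|Y x 0 a - Y s 0 a| < e / 2.
  by apply: filter_forall => a; apply: (@cvgr_dist_lt _ _ _ _ _ _ _ (cY a)).
apply: filterS => s h; apply: (@le_lt_trans _ _ (e / 2)); last lra.
by apply: row_norm_le => [|a]; [exact: ltW|rewrite !mxE; exact/ltW].
Qed.

Lemma continuous_entry (T : topologicalType) k (Y : T -> 'rV[R]_k) x a :
  {for x, continuous Y} -> {for x, continuous (fun s => Y s 0 a)}.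
Proof.
move=> cY; apply: (@continuous_comp _ _ _ Y (fun v : 'rV[R]_k => v 0 a)) => //.
exact: (@coord_continuous R 1 k 0 a).
Qed.

Section Lipschitz.
Variables (k : nat) (Psi : 'rV[R]_k -> 'rV[R]_k) (L : R) (y0 : 'rV[R]_k).
Hypothesis L0 : 0 < L.
Hypothesis PsiL : forall y z a, `|Psi y 0 a - Psi z 0 a| <= L * `|y - z|.

(** The bound 1/2 keeps times inside the interval where [antider] is known to be an antiderivative;
    the bound 1 / (2 L) makes the Picard map a contraction with factor 1/2. *)
Let d := Num.min (2^-1) ((2 * L)^-1).

Let d0 : 0 < d.
Proof. by rewrite /d lt_min !invr_gt0 mulr_gt0// andbT. Qed.

Let d1 : d < 1.
Proof. by rewrite /d gt_min; apply/orP; left; lra. Qed.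

Let dL : d * L <= 2^-1.
Proof.
have : d <= (2 * L)^-1 by rewrite /d ge_min lexx orbT.
by rewrite -(ler_pM2r L0) invfM -mulrA mulVf ?mulr1// gt_eqF.
Qed.

(* Time is clamped to [-d, d], so that the iterates are controlled globally by the
   Lipschitz constant. *)
Let step (Y : R -> 'rV[R]_k) (s : R) : 'rV[R]_k :=
  \row_a (y0 0 a + antider (fun r => Psi (Y (clamp d r)) 0 a) s).

Let good (Y : R -> 'rV[R]_k) := continuous (fun r => Y (clamp d r)).

Let Psi_cont Y a : good Y -> continuous (fun r => Psi (Y (clamp d r)) 0 a).
Proof.
move=> gY x; apply: (@continuous_comp _ _ _ (fun r => Y (clamp d r)) (fun v => Psi v 0 a)) => //.
  exact: gY.
by apply: lipschitz_continuous => y z; exact: PsiL.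
Qed.

Let stepP Y a (s : R) : good Y -> `|s| < 1 ->
  is_derive s 1 (fun r => step Y r 0 a) (Psi (Y (clamp d s)) 0 a).
Proof.
move=> gY s1.
rewrite (_ : (fun _ => _) = cst (y0 0 a) + antider (fun r => Psi (Y (clamp d r)) 0 a)); last first.
  by apply/funext => r; rewrite mxE.
rewrite -[X in is_derive _ _ _ X]add0r.
by apply: is_deriveD; apply: antiderP => //; exact: Psi_cont.
Qed.

Let clamp1 s : `|clamp d s| < 1.
Proof. by apply: le_lt_trans d1; exact/clamp_le/ltW. Qed.

Let good_step Y : good Y -> good (step Y).
Proof.
move=> gY s; apply: (@continuous_comp _ _ _ (clamp d) (step Y)).
  exact: clamp_continuous.
apply: row_continuous => a.
by apply: is_derive1_continuous; apply: stepP.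
Qed.

Let step0 Y : step Y 0 = y0.
Proof. by apply/rowP => a; rewrite mxE antider0 addr0. Qed.

Let step_contr Y Z e : good Y -> good Z -> 0 <= e ->
  (forall s, `|Y (clamp d s) - Z (clamp d s)| <= e) ->
  forall s, `|step Y (clamp d s) - step Z (clamp d s)| <= 2^-1 * e.
Proof.
move=> gY gZ e0 YZ s; apply: row_norm_le => [|a]; first by rewrite mulr_ge0.
have Le0 : 0 <= L * e by rewrite mulr_ge0// ltW.
have h : `|(step Y (clamp d s) 0 a - step Z (clamp d s) 0 a) - (step Y 0 0 a - step Z 0 0 a)|
    <= (L * e) * `|clamp d s|.
  apply: (@mean_value_ineq _ (fun r => step Y r 0 a - step Z r 0 a) _ 1) => //.
  - by move=> x x1; apply: is_deriveB; apply: stepP.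
  - move=> x x1 /=; apply: le_trans (PsiL _ _ _) _.
    by rewrite ler_wpM2l// ltW.
move: h; rewrite !step0 subrr subr0 !mxE => /le_trans; apply.
apply: (@le_trans _ _ ((L * e) * d)); first by rewrite ler_wpM2l// clamp_le// ltW.
by rewrite mulrAC ler_wpM2r// mulrC.
Qed.

Let pic n := iter n step (fun=> y0).

Let good_pic n : good (pic n).
Proof.
by elim: n => [|n IH]; [exact: cst_continuous|exact: good_step].
Qed.

(** Bounds the first Picard increment, which moves away from [y0] with constant velocity [Psi y0]
    for a time of at most [d], and [d] is below 1. *)
Let C := `|step (fun=> y0) 0 - y0| + (\sum_a `|Psi y0 0 a|).

(** Picard iteration: consecutive iterates differ by at most C / 2^n on the clamped interval, so
    each coordinate has a limit by [geometric_limit], with an error bound that is uniform in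
    time. *)
Lemma picard_lipschitz : exists2 e, 0 < e & exists Y : R -> 'rV[R]_k,
  Y 0 = y0 /\ forall s : R, `|s| < e -> forall a,
    is_derive s 1 (fun r => Y r 0 a) (Psi (Y s) 0 a).
Proof.
have C0 : 0 <= C by rewrite addr_ge0// sumr_ge0.
have pC n s : `|pic n.+1 (clamp d s) - pic n (clamp d s)| <= C * 2^-1 ^+ n.
  elim: n s => [|n IH] s.
    rewrite expr0 mulr1 /C step0 subrr normr0 add0r; apply: row_norm_le => [|a].
      exact: sumr_ge0.
    have h : `|step (fun=> y0) (clamp d s) 0 a - step (fun=> y0) 0 0 a| <= `|Psi y0 0 a| *
        `|clamp d s|.
      apply: (@mean_value_ineq _ (fun r => step (fun=> y0) r 0 a) (fun=> Psi y0 0 a) 1) => //.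
      by move=> x x1; apply: stepP => //; exact: cst_continuous.
    move: h; rewrite step0 => h; rewrite mxE [X in _ + X]mxE.
    apply: le_trans h _; apply: (@le_trans _ _ `|Psi y0 0 a|).
      by rewrite ler_piMr// ltW.
    by rewrite (bigD1 a)//= lerDl sumr_ge0.
  rewrite exprS mulrCA.
  have Cn0 : 0 <= C * 2^-1 ^+ n by rewrite mulr_ge0// exprn_ge0.
  exact: (step_contr (@good_pic n.+1) (@good_pic n) Cn0 IH s).
have lim s a : exists l, forall n, `|l - pic n (clamp d s) 0 a| <= 2 * C * 2^-1 ^+ n.
  apply: geometric_limit => n; apply: le_trans (pC n s).
  by have := coord_norm_le (pic n.+1 (clamp d s) - pic n (clamp d s)) a; rewrite !mxE.
pose l s := projT1 (choice (lim s)).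
have lP s a n : `|l s a - pic n (clamp d s) 0 a| <= 2 * C * 2^-1 ^+ n := projT2 (choice (lim s))
    a n.
pose Z s := \row_a l s a.
have D0 n : 0 <= 2 * C * 2^-1 ^+ n by rewrite mulr_ge0// ?mulr_ge0// exprn_ge0.
have ZP n s : `|Z s - pic n (clamp d s)| <= 2 * C * 2^-1 ^+ n.
  by apply: row_norm_le => // a; rewrite !mxE; exact: lP.
have clampK s : clamp d (clamp d s) = clamp d s by rewrite clamp_id// clamp_le// ltW.
have ZcP n s : `|Z (clamp d s) - pic n (clamp d s)| <= 2 * C * 2^-1 ^+ n.
  by rewrite -{2}(clampK s).
(* A uniform limit of continuous functions: three errors of size e / 3. *)
have gZ : good Z.
  move=> x; apply/cvgrPdist_lt => e e0.
  have e3 : 0 < e / 3 by rewrite divr_gt0.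
  have [n nP] : exists n, 2 * C * 2^-1 ^+ n < e / 3.
    have h : (2 * C * 2^-1 ^+ n) @[n --> \oo] --> 0.
      rewrite -[X in _ --> X](mulr0 (2 * C)); apply: cvgMr.
      by apply: cvg_expr; rewrite gtr0_norm; lra.
    move: h => /cvgrPdist_lt/(_ _ e3)[n _ /(_ n (leqnn n))] /=.
    by rewrite sub0r normrN ger0_norm//; exists n.
  move/cvgrPdist_lt: (@good_pic n x) => /(_ _ e3); apply: filterS => y xy.
  have h1 := ZcP n x; have h2 := ZcP n y; rewrite distrC in h2.
  have h3 := ler_distD (pic n (clamp d x)) (Z (clamp d x)) (Z (clamp d y)).
  have h4 := ler_distD (pic n (clamp d y)) (pic n (clamp d x)) (Z (clamp d y)).
  lra.
(* [Z] is a fixed point: by contraction [step Z] is within half of the n-th error bound of iterate n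
   + 1, which is within the next bound of [Z]; both halves add up to 2 C / 2^n. *)
have YZ s : step Z (clamp d s) = Z (clamp d s).
  apply/rowP => a; apply/eqP; rewrite -subr_eq0; apply/eqP.
  apply: (@le_geometric_eq0 _ _ (2 * C)) => n.
  have h1 := step_contr gZ (@good_pic n) (D0 n) (ZcP n) s.
  have h2 := ZcP n.+1 s; rewrite distrC in h2.
  have h3 := ler_distD (pic n.+1 (clamp d s)) (step Z (clamp d s)) (Z (clamp d s)).
  have := coord_norm_le (step Z (clamp d s) - Z (clamp d s)) a.
  rewrite mxE [X in _ + X]mxE => /le_trans; apply; apply: le_trans h3 _.
  rewrite exprS in h2; rewrite -[pic n.+1 _]/(step (pic n) (clamp d s)) in h2 *.
  lra.
(* The solution is given as [step Z], because [stepP] differentiates an image of [step]; it agrees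
   with [Z] on the interval. *)
exists d => //; exists (step Z); split => // s sd a.
have ck : clamp d s = s by rewrite clamp_id// ltW.
have := YZ s; rewrite ck => ->; rewrite -[in Z s]ck; apply: stepP => //.
exact: lt_trans sd d1.
Qed.

End Lipschitz.
End Picard.

Section SmoothCurves.
Context {R : realType}.

(** The counterpart of [ck_on] for functions of one real variable, again to allow induction on the
    order. *)
Fixpoint ck (k : nat) (J : set R) (f : R -> R) : Prop :=
  (forall s, J s -> derivable f s 1) /\
  if k is k'.+1 then ck k' J (derive1 f) else True.

Definition cinf (J : set R) (f : R -> R) :=
  forall s k, J s -> derivable (derive1n k f) s 1.

Lemma cinfP J f : cinf J f <-> forall k, ck k J f.
Proof.
split=> [cf k|Cf s k Js].
  elim: k f cf => [|k IH] f cf /=; split=> //.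
  - by move=> s; exact: (cf s 0%N).
  - by move=> s; exact: (cf s 0%N).
  - by apply: IH => s l Js; rewrite -derive1Sn; exact: cf.
elim: k f Cf => [|k IH] f Cf; first by case: (Cf 0%N) => + _; exact.
by rewrite derive1Sn; apply: IH => l; case: (Cf l.+1).
Qed.

Lemma ck_pred k J f : ck k.+1 J f -> ck k J f.
Proof. by elim: k f => [|k IH] f [df pf]; split => //; apply: IH. Qed.

Lemma near_open (T : topologicalType) (U : set T) (Q : T -> Prop) x :
  open U -> U x -> (forall y, U y -> Q y) -> \forall y \near x, Q y.
Proof. by move=> oU Ux UQ; apply: filterS (open_nbhs_nbhs (conj oU Ux)). Qed.

Lemma ck_ext k J f g : open J -> (forall s, J s -> f s = g s) -> ck k J f -> ck k J g.
Proof.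
move=> oJ; elim: k f g => [|k IH] f g fg [df pf].
  split; last exact: Logic.I.
  by move=> s Js; apply: near_eq_derivable (df _ Js); exact: near_open fg.
split=> [s Js|]; first by apply: near_eq_derivable (df _ Js); exact: near_open fg.
by apply: IH pf => s Js; rewrite !derive1E; apply: near_eq_derive; exact: near_open fg.
Qed.

Lemma ck_cst k J c : ck k J (fun=> c).
Proof.
elim: k c => [|k IH] c; split=> //.
rewrite (_ : derive1 _ = fun=> 0)//.
by apply/funext => y; rewrite derive1E derive_cst.
Qed.

Lemma ck_add k J f g : open J -> ck k J f -> ck k J g -> ck k J (fun s => f s + g s).
Proof.
move=> oJ; elim: k f g => [|k IH] f g [df pf] [dg pg];
  (split; first by move=> s Js; exact: derivableD (df s Js) (dg s Js)).
  exact: Logic.I.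
apply: (ck_ext oJ _ (IH _ _ pf pg)) => s Js.
by rewrite !derive1E -[RHS]/('D_1 (f + g) s) (deriveD (df s Js) (dg s Js)).
Qed.

Lemma ck_mul k J f g : open J -> ck k J f -> ck k J g -> ck k J (fun s => f s * g s).
Proof.
move=> oJ; elim: k f g => [|k IH] f g Cf Cg; have [df pf] := Cf; have [dg pg] := Cg;
  (split; first by move=> s Js; exact: derivableM (df s Js) (dg s Js)).
  exact: Logic.I.
apply: (ck_ext oJ _ (ck_add oJ (IH _ _ (ck_pred Cf) pg) (IH _ _ (ck_pred Cg) pf))) => s Js.
by rewrite !derive1E -[RHS]/('D_1 (f * g) s) (deriveM (df s Js) (dg s Js)).
Qed.

Lemma ck_sum k J (T : Type) (l : seq T) (f : T -> R -> R) : open J ->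
  (forall i, ck k J (f i)) -> ck k J (fun y => \sum_(i <- l) f i y).
Proof.
move=> oJ Cf; elim: l => [|i l IH].
  by rewrite (_ : (fun _ => _) = fun=> 0); [exact: ck_cst|apply/funext => y; rewrite big_nil].
rewrite (_ : (fun _ => _) = fun y => f i y + \sum_(j <- l) f j y); first exact: ck_add.
by apply/funext => y; rewrite big_cons.
Qed.

Lemma ck_comp k m (J : set R) (V : set 'rV[R]_m) (F : 'rV[R]_m -> R) (c : R -> 'rV[R]_m) :
  open J -> (forall s, J s -> V (c s)) ->
  (forall a, ck k J (fun s => c s 0 a)) -> ck_on k V F -> ck k J (F \o c).
Proof.
move=> oJ JV; have h F' s : (forall a, derivable (fun r => c r 0 a) s 1) -> J s ->
    (forall y, V y -> differentiable F' y) -> is_derive s 1 (F' \o c) (\sum_a 'D_1 (fun r => c r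
        0 a) s * partial a F' (c s)).
  by move=> dc Js dF; apply: is_derive_curve => //; exact/dF/JV.
elim: k F => [|k IH] F Cp [dF pF]; split=> //.
- by move=> s Js; apply: ex_derive; apply: h => // a; exact: (Cp a).1.
- by move=> s Js; apply: ex_derive; apply: h => // a; exact: (Cp a).1.
- have Cs : ck k J (fun s => \sum_a derive1 (fun r => c r 0 a) s * (partial a F \o c) s).
    apply: ck_sum => // a; apply: ck_mul => //; first exact: (Cp a).2.
    by apply: IH (pF a) => b; exact: ck_pred.
  apply: ck_ext Cs => // s Js; rewrite derive1E.
  have dc a : derivable (fun r => c r 0 a) s 1 by exact: (Cp a).1.
  rewrite (@derive_val _ _ _ _ _ _ _ (h F s dc Js dF)).
  by apply: eq_bigr => a _; rewrite derive1E.
Qed.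

Lemma cinf_comp m (J : set R) (V : set 'rV[R]_m) (F : 'rV[R]_m -> R) (c : R -> 'rV[R]_m) :
  open J -> (forall s, J s -> V (c s)) ->
  (forall a, cinf J (fun s => c s 0 a)) -> smooth_on V F -> cinf J (F \o c).
Proof.
move=> oJ JV cc /smooth_onP sF; apply/cinfP => k; apply: ck_comp (sF k) => // a.
by move: k; exact/cinfP.
Qed.

Lemma cinf_ext J f g : open J -> (forall s, J s -> f s = g s) -> cinf J f -> cinf J g.
Proof. by move=> oJ fg /cinfP cf; apply/cinfP => k; exact: ck_ext (cf k). Qed.

(** Bootstrap: if the solution is of class C^k, so is its derivative, a smooth function of it, and
    hence the solution is of class C^(k+1). *)
Lemma cinf_solution m (J : set R) (V : set 'rV[R]_m) (Phi : 'rV[R]_m -> 'rV[R]_m)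
    (y : R -> 'rV[R]_m) : open J -> (forall a, smooth_on V (fun z => Phi z 0 a)) ->
  (forall s, J s -> V (y s)) ->
  (forall (s : R) a, J s -> is_derive s 1 (fun r => y r 0 a) (Phi (y s) 0 a)) ->
  forall a, cinf J (fun s => y s 0 a).
Proof.
move=> oJ sPhi JV dy; suff h k : forall a, ck k J (fun s => y s 0 a).
  by move=> a; apply/cinfP => k; exact: h.
elim: k => [|k IH] a.
  by split=> // s Js; exact: (@ex_derive _ _ _ _ _ _ _ (dy _ _ Js)).
split; first by move=> s Js; exact: (@ex_derive _ _ _ _ _ _ _ (dy _ _ Js)).
have C : ck k J ((fun z => Phi z 0 a) \o y).
  by apply: (ck_comp oJ JV IH); move: k {IH}; exact/smooth_onP.
apply: ck_ext C => // s Js.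
by rewrite derive1E (@derive_val _ _ _ _ _ _ _ (dy _ _ Js)).
Qed.

End SmoothCurves.

Section LocalPicard.
Context {R : realType}.

Lemma ball_open_sub m (U : set 'rV[R]_m) y : open U -> U y ->
  exists2 r, 0 < r & forall z, `|z - y| <= r -> U z.
Proof.
move=> oU Uy; have := open_nbhs_nbhs (conj oU Uy).
move/nbhs_ballP => [r /= r0 rU]; exists (r / 2); first by rewrite divr_gt0.
move=> z zy; apply: rU; rewrite -ball_normE/= distrC; apply: le_lt_trans zy _; lra.
Qed.

Lemma smooth_continuous m (U : set 'rV[R]_m) f y : smooth_on U f -> U y -> {for y, continuous f}.
Proof. by move=> sf Uy; exact/differentiable_continuous/(smooth_diff sf). Qed.

Lemma nbhs_le m (y : 'rV[R]_m) (Q : 'rV[R]_m -> Prop) : (\forall z \near y, Q z) ->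
  exists2 r, 0 < r & forall z, `|z - y| <= r -> Q z.
Proof.
move/nbhs_ballP => [r /= r0 rU]; exists (r / 2); first by rewrite divr_gt0.
move=> z zy; apply: rU; rewrite -ball_normE/= distrC; apply: le_lt_trans zy _; lra.
Qed.

Lemma segment_ball m (y0 y z : 'rV[R]_m) r t : `|y - y0| <= r -> `|z - y0| <= r ->
  0 <= t <= 1 -> `|z + t *: (y - z) - y0| <= r.
Proof.
move=> yr zr /andP[t0 t1].
have -> : z + t *: (y - z) - y0 = t *: (y - y0) + (1 - t) *: (z - y0).
  by apply/rowP => a; rewrite !mxE; ring.
apply: le_trans (ler_normD _ _) _; rewrite !normrZ (ger0_norm t0) ger0_norm ?subr_ge0//.
have h1 := ler_wpM2l t0 yr; have t1' : 0 <= 1 - t by lra.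
have := ler_wpM2l t1' zr; lra.
Qed.

Lemma smooth_lipschitz m (U : set 'rV[R]_m) (F : 'rV[R]_m -> R) y0 :
  open U -> U y0 -> smooth_on U F ->
  exists B r, [/\ 0 < B, 0 < r & forall y z, `|y - y0| <= r -> `|z - y0| <= r ->
     `|F y - F z| <= B * `|y - z|].
Proof.
move=> oU Uy0 sF; set B := (\sum_a `|partial a F y0|) + 1.
have : \forall z \near y0, U z /\ forall a, `|partial a F z| <= B.
  suff h : \forall z \near y0, forall a, `|partial a F z| <= B.
    by apply: filterI h; exact: open_nbhs_nbhs.
  have hf := @filter_forall _ _ (fun (a : 'I_m) (z : 'rV[R]_m) => `|partial a F z| <= B) (nbhs
      y0) _.
  apply: hf => a; have := smooth_continuous (smooth_partial a sF) Uy0.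
  move/cvgrPdist_lt => /(_ _ ltr01); apply: filterS => z h.
  have h2 := ler_distD (partial a F y0) (partial a F z) 0.
  rewrite !subr0 distrC in h2; apply: le_trans h2 _; rewrite addrC lerD//; last exact: ltW.
  by rewrite (bigD1 a)//= lerDl sumr_ge0.
move=> /nbhs_le[r r0 rP].
have B0 : 0 < B by rewrite ltr_wpDl// sumr_ge0.
exists (m%:R * B + 1), r; split => //; first by rewrite ltr_wpDl// mulr_ge0// ltW.
move=> y z yr zr.
have [t /andP[t0 t1] ->] : exists2 t, 0 < t < 1 & F y - F z = \sum_a (y - z) 0 a * partial a F
    (z + t *: (y - z)).
  apply: mean_value_row => t t01; apply: smooth_diff sF _.
  by apply: (rP _ _).1; exact: segment_ball.
have [_ pB] : U (z + t *: (y - z)) /\ forall a, `|partial a F (z + t *: (y - z))| <= B.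
  by apply: rP; apply: segment_ball => //; rewrite !ltW.
have := @row_sum_norm_le _ _ (y - z) (\row_a partial a F (z + t *: (y - z))) B.
rewrite (eq_bigr (fun a => (y - z) 0 a * partial a F (z + t *: (y - z)))); last by move=> a _;
    rewrite [X in _ * X]mxE.
move=> /(_ _)/le_trans; apply; first by move=> a; rewrite mxE.
by rewrite ler_wpM2r// lerDl.
Qed.

(** The field is smooth only on [U] and only locally Lipschitz. It is replaced by its composite with
    a retraction onto a small cube around [y0], which is globally Lipschitz; for small times the
    solution stays in the cube by continuity and so solves the original equation. *)
Lemma picard m (U : set 'rV[R]_m) (Phi : 'rV[R]_m -> 'rV[R]_m) (y0 : 'rV[R]_m) :
  open U -> U y0 -> (forall a, smooth_on U (fun y => Phi y 0 a)) ->
  exists2 d, 0 < d & exists Y : R -> 'rV[R]_m,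
  Y 0 = y0 /\ forall s : R, `|s| < d -> U (Y s) /\ forall a,
    is_derive s 1 (fun r => Y r 0 a) (Phi (Y s) 0 a).
Proof.
move=> oU Uy0 sPhi.
have /choice[B BP] : forall a, exists B, 0 < B /\ exists2 r, 0 < r & forall y z, `|y - y0| <= r
    -> `|z - y0| <= r ->
     `|Phi y 0 a - Phi z 0 a| <= B * `|y - z|.
  by move=> a; have [B [r [B0 r0 h]]] := smooth_lipschitz oU Uy0 (sPhi a); exists B; split =>
      //; exists r.
have : \forall r \near 0^'+, (forall z, `|z - y0| <= r -> U z) /\ forall a, forall y z, `|y -
    y0| <= r -> `|z - y0| <= r ->
     `|Phi y 0 a - Phi z 0 a| <= B a * `|y - z|.
  apply: filterI.
    have [r0 r00 r0U] := ball_open_sub oU Uy0.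
    near=> r => z zr; apply: r0U; apply: le_trans zr _; near: r.
    exact: nbhs_right_le.
  have hf := @filter_forall _ _ (fun (a : 'I_m) (r : R) => forall y z, `|y - y0| <= r -> `|z -
      y0| <= r ->
     `|Phi y 0 a - Phi z 0 a| <= B a * `|y - z|) (0^'+) _.
  apply: hf => a; have [_ [r0 r00 r0P]] := BP a.
  near=> r => y z yr zr; have rr0 : r <= r0 by near: r; exact: nbhs_right_le.
  by apply: r0P; [exact: le_trans yr _|exact: le_trans zr _].
move=> rnear.
have [r [r0 [rU rP]]] : exists r, 0 < r /\ (forall z, `|z - y0| <= r -> U z) /\ forall a, forall
    y z, `|y - y0| <= r -> `|z - y0| <= r ->
     `|Phi y 0 a - Phi z 0 a| <= B a * `|y - z|.
  apply: (@filter_ex _ (0^'+)); near=> r; split; first by near: r; exact: nbhs_right_gt.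
  by near: r.
pose L := (\sum_a B a) + 1.
have B0 a : 0 <= B a by exact/ltW/(BP a).1.
have L0 : 0 < L by rewrite ltr_wpDl// sumr_ge0.
(* The retraction onto the cube of radius [r]; clamping each coordinate is 1-Lipschitz for the sup
   norm. *)
pose cl (y : 'rV[R]_m) := y0 + \row_a clamp r ((y - y0) 0 a).
have clr y : `|cl y - y0| <= r.
  by rewrite addrAC subrr add0r; apply: row_norm_le => [|a]; rewrite ?mxE ?clamp_le// ltW.
have clL y z : `|cl y - cl z| <= `|y - z|.
  apply: row_norm_le => // a.
  have -> : (cl y - cl z) 0 a = clamp r ((y - y0) 0 a) - clamp r ((z - y0) 0 a) by rewrite !mxE;
      ring.
  apply: le_trans (clamp_lipschitz _ _ _) _.
  have -> : (y - y0) 0 a - (z - y0) 0 a = (y - z) 0 a by rewrite !mxE; ring.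
  exact: coord_norm_le.
have clK y : `|y - y0| <= r -> cl y = y.
  move=> yr; apply/rowP => a; rewrite mxE [X in _ + X]mxE clamp_id; first by rewrite !mxE subrKC.
  by apply: le_trans yr; exact: coord_norm_le.
have [y z a|d d0 [Y [Y0 Yd]]] := @picard_lipschitz R m (Phi \o cl) L y0 L0.
  apply: le_trans (rP a _ _ (clr y) (clr z)) _; apply: ler_pM => //.
  by rewrite /L (bigD1 a)//= -addrA lerDl addr_ge0// sumr_ge0.
have cY : {for 0, continuous Y}.
  apply: row_continuous => a; apply: is_derive1_continuous; apply: Yd.
  by rewrite normr0.
have : \forall s \near (0 : R), `|Y s - y0| <= r.
  move/cvgrPdist_lt: cY => /(_ _ r0); apply: filterS => s; rewrite Y0 distrC; exact: ltW.
move=> /nbhs_norm0P[d' /= d'0 d'P].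
exists (Num.min d d'); first by rewrite lt_min d0.
exists Y; split => // s; rewrite lt_min => /andP[sd sd'].
have Ysr : `|Y s - y0| <= r by exact: d'P.
split; first exact: rU.
by move=> a; have := Yd s sd a; rewrite /= clK.
Unshelve. all: by end_near. Qed.

End LocalPicard.

(** * Covariance of the geodesic equation *)

Section Schwarz.
Context {R : realType}.

(** The second difference is the increment in direction [a] of the difference of [F] along two
    parallel segments that are [r] apart in direction [b]. The mean value theorem turns it into [r]
    times a difference of values of [partial a F], which are expanded to first order at [y]. *)
Lemma second_difference m (U : set 'rV[R]_m) (F : 'rV[R]_m -> R) (y : 'rV[R]_m) a b e :
  open U -> U y -> smooth_on U F -> 0 < e ->
  exists2 r0, 0 < r0 & forall r, 0 < r < r0 ->
   `|(F (y + r *: delta_mx 0 a + r *: delta_mx 0 b) - F (y + r *: delta_mx 0 a)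
      - F (y + r *: delta_mx 0 b) + F y) - r ^+ 2 * partial b (partial a F) y| <= e * r ^+ 2.
Proof.
move=> oU Uy sF e0; set ea : 'rV[R]_m := delta_mx 0 a; set eb : 'rV[R]_m := delta_mx 0 b.
(* The two expansion points are displaced by [t *: ea + r *: eb] and [t *: ea] with t < r; the sum
   of their norms is at most C r, so an expansion error of e / C per unit length suffices. *)
pose C := 2 * `|ea| + `|eb| + 1.
have C0 : 0 < C by rewrite ltr_wpDl// addr_ge0// mulr_ge0.
have e'0 : 0 < e / C by rewrite divr_gt0.
have dG : differentiable (partial a F) y := smooth_diff (smooth_partial a sF) Uy.
have := diff_eps dG e'0; have [r1 r10 r1U] := ball_open_sub oU Uy.
move=> /nbhs_norm0P[r2 /= r20 r2P].
pose rm := Num.min r1 r2; have rm0 : 0 < rm by rewrite /rm lt_min r10.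
exists (rm / C); first by rewrite divr_gt0.
move=> r /andP[r0]; rewrite ltr_pdivlMr// => rr.
have small t u : 0 <= t <= r -> 0 <= u <= r -> `|t *: ea + u *: eb| < rm.
  move=> /andP[t0 tr] /andP[u0 ur]; apply: le_lt_trans (ler_normD _ _) _.
  rewrite !normrZ !ger0_norm//; apply: le_lt_trans rr.
  have h1 := ler_wpM2r (normr_ge0 ea) tr; have h2 := ler_wpM2r (normr_ge0 eb) ur.
  have : 0 <= r * `|ea| by rewrite mulr_ge0// ltW.
  rewrite /C; lra.
have inU t u : 0 <= t <= r -> 0 <= u <= r -> U (y + (t *: ea + u *: eb)).
  move=> tr ur; apply: r1U; rewrite [y + _]addrC addrK; apply/ltW.
  by apply: lt_le_trans (small _ _ tr ur) _; rewrite /rm ge_min lexx.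
have r00 : 0 <= r <= r by rewrite lexx ltW.
have z00 : 0 <= (0 : R) <= r by rewrite lexx ltW.
have line u t : 0 <= u <= r -> 0 <= t <= r ->
    is_derive t 1 (fun t => F (y + u *: eb + t *: ea)) (partial a F (y + (t *: ea + u *: eb))).
  move=> ur tr; have -> : y + (t *: ea + u *: eb) = y + u *: eb + t *: ea by rewrite -addrA [u
      *: _ + _]addrC.
  have dF : differentiable F (y + u *: eb + t *: ea).
    by rewrite -addrA [u *: _ + _]addrC; apply: (smooth_diff sF); exact: inU.
  have := is_derive_line dF; rewrite (bigD1 a)//= mxE !eqxx mul1r big1 ?addr0//.
  by move=> c ca; rewrite mxE (negPf ca) andbF mul0r.
have [t tr|t /andP[t0 tr]] := @mean_value _ (fun t => F (y + r *: eb + t *: ea) - F (y + 0 *: eb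
    + t *: ea))
   (fun t => partial a F (y + (t *: ea + r *: eb)) - partial a F (y + (t *: ea + 0 *: eb))) 0 r r0.
  by apply: is_deriveB; apply: line.
rewrite !scale0r !addr0 subr0 => E.
have -> : F (y + r *: ea + r *: eb) - F (y + r *: ea) - F (y + r *: eb) + F y =
   F (y + r *: eb + r *: ea) - F (y + r *: ea) - (F (y + r *: eb) - F y).
  by rewrite (addrAC y) opprB [RHS]addrA [RHS]addrAC.
rewrite {}E.
have tr' : 0 <= t <= r by rewrite !ltW.
have h1 := r2P (t *: ea + r *: eb) (lt_le_trans (small _ _ tr' r00) _).
have h2 := r2P (t *: ea + 0 *: eb) (lt_le_trans (small _ _ tr' z00) _).
have rm2 : rm <= r2 by rewrite /rm ge_min lexx orbT.
move: h1 h2 => /(_ rm2) h1 /(_ rm2); rewrite scale0r addr0 => h2.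
have E1 : 'D_(t *: ea + r *: eb) (partial a F) y = t * partial a (partial a F) y + r * partial b
    (partial a F) y.
  by rewrite deriveE// linearD !linearZ/= /partial !deriveE.
have E2 : 'D_(t *: ea) (partial a F) y = t * partial a (partial a F) y.
  by rewrite deriveE// linearZ/= /partial !deriveE.
rewrite E1 [_ + y]addrC in h1; rewrite E2 [_ + y]addrC in h2.
set A := partial a F (y + (t *: ea + r *: eb)) in h1 *.
set B := partial a F (y + t *: ea) in h2 *.
set pab := partial b (partial a F) y in h1 *.
have -> : (A - B) * r - r ^+ 2 * pab = ((A - partial a F y - (t * partial a (partial a F) y + r
    * pab)) - (B - partial a F y - t * partial a (partial a F) y)) * r by ring.
rewrite normrM (gtr0_norm r0) expr2 mulrA; apply: ler_wpM2r; first exact: ltW.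
apply: le_trans (ler_normB _ _) _; apply: le_trans (lerD h1 h2) _.
rewrite -mulrDr -mulrA ler_pM2l// ler_pdivrMl// ; apply: (@le_trans _ _ (r * (2 * `|ea| + `|eb|))).
  have h3 : `|t *: ea + r *: eb| <= r * `|ea| + r * `|eb|.
    apply: le_trans (ler_normD _ _) _; rewrite !normrZ !gtr0_norm// lerD2r.
    by rewrite ler_wpM2r// ltW.
  have h4 : `|t *: ea| <= r * `|ea| by rewrite normrZ gtr0_norm// ler_wpM2r// ltW.
  by rewrite (_ : r * _ = (r * `|ea| + r * `|eb|) + r * `|ea|) ?lerD//; ring.
by rewrite mulrC ler_wpM2r ?(ltW r0)// /C lerDl.
Qed.

(** The second difference is symmetric in [a] and [b], so it approximates both mixed derivatives,
    each up to e r^2 / 2. *)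
Lemma schwarz m (U : set 'rV[R]_m) (F : 'rV[R]_m -> R) (y : 'rV[R]_m) a b :
  open U -> U y -> smooth_on U F ->
  partial a (partial b F) y = partial b (partial a F) y.
Proof.
move=> oU Uy sF; apply/eqP; rewrite -subr_eq0 -normr_le0; apply/ler_addgt0Pl => e e0; rewrite addr0.
have e2 : 0 < e / 2 by rewrite divr_gt0.
have [r1 r10 h1] := second_difference a b oU Uy sF e2.
have [r2 r20 h2] := second_difference b a oU Uy sF e2.
pose r := Num.min r1 r2 / 2.
have r0 : 0 < r by rewrite divr_gt0// lt_min r10.
have rr : r < Num.min r1 r2 by rewrite /r gtr_pMr ?lt_min ?r10//; lra.
have {}h1 := h1 r; have {}h2 := h2 r.
rewrite r0/= (lt_le_trans rr) ?ge_min ?lexx// in h1.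
rewrite r0/= (lt_le_trans rr) ?ge_min ?lexx ?orbT// in h2.
move: (h1 isT) (h2 isT) => {}h1 {}h2.
rewrite [y + _ + _]addrAC in h2.
have rr2 : 0 < r ^+ 2 by rewrite exprn_gt0.
rewrite -(ler_pM2r rr2) -[X in _ * X <= _](gtr0_norm rr2) -normrM.
set D1 := (X in `|X| <= _) in h1; set D2 := (X in `|X| <= _) in h2.
have -> : (partial a (partial b F) y - partial b (partial a F) y) * r ^+ 2 = D1 - D2.
  have key (P A B C X Y t : R) : (X - Y) * t = (P - A - B + C - t * Y) - (P - B - A + C - t * X)
      by ring.
  exact: key.
apply: le_trans (ler_normB _ _) _; apply: le_trans (lerD h1 h2) _.
by rewrite -mulrDl -splitr.
Qed.

End Schwarz.

Section Covariance.
Context {R : realType}.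

Lemma is_derive_bigsum (V : normedModType R) (x v : V) (n : nat) (h : 'I_n -> V -> R) (dh : 'I_n
    -> R) :
  (forall i, is_derive x v (h i) (dh i)) ->
  is_derive x v (fun y => \sum_i h i y) (\sum_i dh i).
Proof.
move=> hd; rewrite (_ : (fun _ => _) = \sum_i h i); first exact: is_derive_sum.
by apply/funext => y; rewrite fct_sumE.
Qed.

Lemma is_derive_mul (V : normedModType R) (x v : V) (f g : V -> R) (df dg : R) :
  is_derive x v f df -> is_derive x v g dg ->
  is_derive x v (fun y => f y * g y) (df * g x + f x * dg).
Proof.
move=> hf hg; apply: (@is_derive_eq _ _ _ _ _ _ _ _ (is_deriveM hf hg)).
by rewrite addrC /GRing.scale/= [g x * _]mulrC.
Qed.

Definition partial_mx k m n (e : 'I_k) (A : 'rV[R]_k -> 'M[R]_(m, n)) y :=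
  \matrix_(i, j) partial e (fun z => A z i j) y.

Definition dir_mx k m n (v : 'rV[R]_k) (A : 'rV[R]_k -> 'M[R]_(m, n)) y :=
  \sum_e v 0 e *: partial_mx e A y.

Definition differentiable_mx k m n (A : 'rV[R]_k -> 'M[R]_(m, n)) y :=
  forall i j, differentiable (fun z => A z i j) y.

Lemma is_derive_partial k e (f : 'rV[R]_k -> R) y : differentiable f y ->
  is_derive y (delta_mx 0 e : 'rV[R]_k) f (partial e f y).
Proof. by move=> /diff_derivable d; exact/derivableP. Qed.

Lemma differentiable_bigsum (V : normedModType R) (x : V) (n : nat) (h : 'I_n -> V -> R) :
  (forall i, differentiable (h i) x) -> differentiable (fun y => \sum_i h i y) x.
Proof.
move=> hd; rewrite (_ : (fun _ => _) = \sum_i h i); first exact: differentiable_sum.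
by apply/funext => y; rewrite fct_sumE.
Qed.

Lemma differentiable_mxM k m n p (A : 'rV[R]_k -> 'M[R]_(m, n)) (B : 'rV[R]_k -> 'M[R]_(n, p)) y :
  differentiable_mx A y -> differentiable_mx B y -> differentiable_mx (fun z => A z *m B z) y.
Proof.
move=> dA dB i j; rewrite (_ : (fun _ => _) = fun z => \sum_l A z i l * B z l j).
  by apply: differentiable_bigsum => l; apply: differentiableM.
by apply/funext => z; rewrite mxE.
Qed.

Lemma partial_mxM k m n p e (A : 'rV[R]_k -> 'M[R]_(m, n)) (B : 'rV[R]_k -> 'M[R]_(n, p)) y :
  differentiable_mx A y -> differentiable_mx B y ->
  partial_mx e (fun z => A z *m B z) y = partial_mx e A y *m B y + A y *m partial_mx e B y.
Proof.
move=> dA dB; apply/matrixP => i j; rewrite !mxE -big_split/=.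
rewrite (_ : (fun _ => _) = fun z => \sum_l A z i l * B z l j); last by apply/funext => z;
    rewrite mxE.
rewrite /partial (@derive_val _ _ _ _ _ _ _ (is_derive_bigsum (fun l => is_derive_mul
    (is_derive_partial e (dA i l)) (is_derive_partial e (dB l j))))).
by apply: eq_bigr => l _; rewrite !mxE.
Qed.

Lemma partial_mx_tr k m n e (A : 'rV[R]_k -> 'M[R]_(m, n)) y :
  partial_mx e (fun z => (A z)^T) y = (partial_mx e A y)^T.
Proof.
apply/matrixP => i j; rewrite !mxE; congr partial.
by apply/funext => z; rewrite mxE.
Qed.

Lemma partial_mx_comp k l m n e (A : 'rV[R]_l -> 'M[R]_(m, n)) (phi : 'rV[R]_k -> 'rV[R]_l) y :
  differentiable_mx A (phi y) -> (forall b, differentiable (fun z => phi z 0 b) y) ->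
  partial_mx e (fun z => A (phi z)) y = \sum_f partial e (fun z => phi z 0 f) y *: partial_mx f
      A (phi y).
Proof.
move=> dA dphi; apply/matrixP => i j; rewrite mxE summxE.
transitivity (partial e ((fun z => A z i j) \o phi) y) => //; rewrite partial_comp//.
by apply: eq_bigr => a _; rewrite !mxE.
Qed.

(* The left-hand side of the geodesic equation with its index lowered by G.  In this
   form it transforms as a covector, and no derivative of the inverse metric occurs
   in the change of charts. *)
Definition lowered_geodesic m (G : 'rV[R]_m -> 'M[R]_m) y (v w : 'rV[R]_m) : 'rV[R]_m :=
  w *m G y + v *m dir_mx v G y - 2^-1 *: \row_d (v *m partial_mx d G y *m v^T) 0 0.

Definition christoffel_at m (G : 'rV[R]_m -> 'M[R]_m) y (c a b : 'I_m) :=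
  let dg e a b := partial e (fun z => G z a b) y in
  2^-1 * \sum_e invmx (G y) c e * (dg a b e + dg b a e - dg e a b).

Definition geodesic_at m (G : 'rV[R]_m -> 'M[R]_m) y (v w : 'rV[R]_m) :=
  forall c, w 0 c + \sum_a \sum_b christoffel_at G y c a b * v 0 a * v 0 b = 0.

(** Summed against the symmetric product of [v] with itself, the two positive terms of the
    Christoffel symbol coincide and cancel the factor 1/2. The two equations then differ by
    multiplication with the invertible matrix [G y]. *)
Lemma geodesic_lowered_geodesic m (G : 'rV[R]_m -> 'M[R]_m) y (v w : 'rV[R]_m) :
  G y \in unitmx -> (G y)^T = G y -> geodesic_at G y v w <-> lowered_geodesic G y v w = 0.
Proof.
move=> Gu Gs; set S := v *m dir_mx v G y - 2^-1 *: \row_d (v *m partial_mx d G y *m v^T) 0 0.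
have E : forall c, \sum_a \sum_b christoffel_at G y c a b * v 0 a * v 0 b = (invmx (G y) *m S^T)
    c 0.
  move=> c; rewrite mxE.
  have SE e : S^T e 0 = \sum_a \sum_b 2^-1 * (partial_mx a G y b e + partial_mx b G y a e -
      partial_mx e G y a b) * v 0 a * v 0 b.
    rewrite !mxE.
    have -> : \sum_j v 0 j * dir_mx v G y j e = \sum_a \sum_b partial_mx a G y b e * v 0 a * v 0 b.
      rewrite [RHS]exchange_big/=; apply: eq_bigr => b _.
      rewrite /dir_mx summxE big_distrr/=; apply: eq_bigr => a _.
      by rewrite mxE mulrC -mulrA [v 0 a * _]mulrC mulrA.
    have -> : \sum_j (v *m partial_mx e G y) 0 j * v^T j 0 = \sum_a \sum_b partial_mx e G y a b
        * v 0 a * v 0 b.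
      rewrite [RHS]exchange_big/=; apply: eq_bigr => b _.
      rewrite !mxE big_distrl/=; apply: eq_bigr => a _.
      by rewrite [v 0 a * _]mulrC.
    rewrite [X in X - _](_ : _ = 2^-1 * (\sum_a \sum_b partial_mx a G y b e * v 0 a * v 0 b +
        \sum_a \sum_b partial_mx b G y a e * v 0 a * v 0 b)); last first.
      rewrite [X in _ * (_ + X)]exchange_big/= [X in _ * (_ + X)](_ : _ = \sum_a \sum_b
          partial_mx a G y b e * v 0 a * v 0 b); last first.
        by apply: eq_bigr => a _; apply: eq_bigr => b _; rewrite mulrAC.
      by rewrite mulrDr -mulrDl -[_ + _]splitr mul1r || (set X := \sum_(_ < _) _; field).
    rewrite -mulrBr -big_split/= -sumrB big_distrr/=; apply: eq_bigr => a _.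
    rewrite -big_split/= -sumrB big_distrr/=; apply: eq_bigr => b _.
    by rewrite -!mulrDl -!mulrBl !mulrA.
  under [RHS]eq_bigr => e _.
    rewrite SE big_distrr/=; under eq_bigr do rewrite big_distrr/=; over.
  rewrite [RHS]exchange_big/=; apply: eq_bigr => a _.
  rewrite [RHS]exchange_big/=; apply: eq_bigr => b _.
  rewrite /christoffel_at big_distrr/= !big_distrl/=; apply: eq_bigr => e _.
  rewrite !mxE; set p := (_ + _ - _); move: (invmx _ _ _) (p) => x q.
  by rewrite !mulrA [x * _]mulrC.
have -> : lowered_geodesic G y v w = w *m G y + S by rewrite /lowered_geodesic -addrA.
split=> [h|h c].
  have : w^T + invmx (G y) *m S^T = 0.
    by apply/colP => c; rewrite !mxE -[RHS](h c) E !mxE.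
  move=> /(congr1 (mulmx (G y))); rewrite mulmxDr mulmxA mulmxV// mul1mx mulmx0.
  by move=> /(congr1 trmx); rewrite linearD/= trmx_mul !trmxK Gs trmx0.
rewrite E; have : w^T + invmx (G y) *m S^T = 0.
  move/(congr1 trmx): h; rewrite linearD/= trmx_mul Gs trmx0 => /(congr1 (mulmx (invmx (G y)))).
  by rewrite mulmxDr mulmxA mulVmx// mul1mx mulmx0.
by move=> /colP/(_ c); rewrite !mxE.
Qed.

Definition jac k m (phi : 'rV[R]_k -> 'rV[R]_m) y : 'M[R]_(k, m) :=
  \matrix_(a, b) partial a (fun u => phi u 0 b) y.

Lemma scalemxE m n (a : R) (A : 'M[R]_(m, n)) i j : (a *: A) i j = a * A i j.
Proof. by rewrite mxE. Qed.

Lemma tr11 (A : 'M[R]_1) : A 0 0 = A^T 0 0.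
Proof. by rewrite mxE. Qed.

(** Differentiating [G = J G' J^T] produces terms with second derivatives of [phi], collected in
    [K]. They cancel against the term [v *m K] by which the acceleration fails to be a vector. *)
Lemma lowered_geodesic_covariant m (U : set 'rV[R]_m) (G G' : 'rV[R]_m -> 'M[R]_m)
    (phi : 'rV[R]_m -> 'rV[R]_m) y (v w : 'rV[R]_m) :
  open U -> U y -> (forall b, smooth_on U (fun z => phi z 0 b)) ->
  (forall z, U z -> G z = jac phi z *m G' (phi z) *m (jac phi z)^T) ->
  differentiable_mx G' (phi y) -> (G' (phi y))^T = G' (phi y) ->
  lowered_geodesic G y v w =
  lowered_geodesic G' (phi y) (v *m jac phi y) (w *m jac phi y + v *m dir_mx v (jac phi) y) *m
      (jac phi y)^T.
Proof.
move=> oU Uy sphi GE dG' Gs; set J := jac phi y; set K := dir_mx v (jac phi) y; set v' := v *m J.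
have dJ : differentiable_mx (jac phi) y.
  move=> a b; rewrite (_ : (fun _ => _) = partial a (fun u => phi u 0 b)).
    exact: smooth_diff (smooth_partial a (sphi b)) Uy.
  by apply/funext => z; rewrite mxE.
have dphi b : differentiable (fun z => phi z 0 b) y := smooth_diff (sphi b) Uy.
have dGp : differentiable_mx (fun z => G' (phi z)) y.
  by move=> i j; apply: (@differentiable_comp_row R _ _ (fun z => G' z i j) phi).
have dJt : differentiable_mx (fun z => (jac phi z)^T) y.
  move=> i j; rewrite (_ : (fun _ => _) = fun z => jac phi z j i); first exact: dJ.
  by apply/funext => z; rewrite mxE.
have pG d : partial_mx d G y = partial_mx d (jac phi) y *m G' (phi y) *m J^T +
    J *m (\sum_f J d f *: partial_mx f G' (phi y)) *m J^T + J *m G' (phi y) *m (partial_mx d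
        (jac phi) y)^T.
  rewrite (_ : partial_mx d G y = partial_mx d (fun z => jac phi z *m G' (phi z) *m (jac phi
      z)^T) y); last first.
    apply/matrixP => a b; rewrite !mxE; apply: near_eq_derive.
    by apply: (near_open oU Uy) => z Uz; rewrite GE.
  rewrite partial_mxM//; last exact: differentiable_mxM.
  rewrite partial_mxM// partial_mx_comp// mulmxDl partial_mx_tr; congr (_ + _ *m _ *m _ + _).
  by apply: eq_bigr => f _; rewrite !mxE.
have dGE : dir_mx v G y = K *m G' (phi y) *m J^T + J *m dir_mx v' G' (phi y) *m J^T + J *m G'
    (phi y) *m K^T.
  rewrite {1}/dir_mx; under eq_bigr do rewrite pG !scalerDr.
  rewrite !big_split/=; congr (_ + _ + _).
  - rewrite /K /dir_mx !mulmx_suml; apply: eq_bigr => e _.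
    by rewrite -!scalemxAl.
  - under eq_bigr => e _ do rewrite scalemxAl scalemxAr.
    rewrite -mulmx_suml -mulmx_sumr; congr (_ *m _ *m _).
    under eq_bigr do rewrite scaler_sumr.
    rewrite exchange_big/= /dir_mx; apply: eq_bigr => f _.
    by rewrite /v' mxE scaler_suml; apply: eq_bigr => e _; rewrite scalerA.
  - rewrite /K /dir_mx linear_sum mulmx_sumr; apply: eq_bigr => e _.
    by rewrite linearZ/= -scalemxAr.
(* Symmetry of second derivatives lets the derivative of [J] in direction [d], contracted with [v],
   be read as row [d] of [K]. *)
have sym d e b : partial_mx e (jac phi) y d b = partial_mx d (jac phi) y e b.
  rewrite [LHS]mxE [RHS]mxE.
  rewrite (_ : (fun z => jac phi z d b) = partial d (fun u => phi u 0 b)); last by apply/funext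
      => z; rewrite mxE.
  rewrite (_ : (fun z => jac phi z e b) = partial e (fun u => phi u 0 b)); last by apply/funext
      => z; rewrite mxE.
  exact: schwarz oU Uy (sphi b).
have v'E : v'^T = J^T *m v^T by rewrite /v' trmx_mul.
(* The two terms with a derivative of [J] are transposes of each other, whence the factor 2, which
   the 1/2 in [lowered_geodesic] cancels. *)
have rowE : \row_d (v *m partial_mx d G y *m v^T) 0 0 =
    2 *: (v' *m G' (phi y) *m K^T) + (\row_f (v' *m partial_mx f G' (phi y) *m v'^T) 0 0) *m J^T.
  apply/rowP => d; rewrite [LHS]mxE pG !mulmxDr !mulmxDl mxE [X in X + _]mxE [RHS]mxE.
  have E1 : (v *m (J *m G' (phi y) *m (partial_mx d (jac phi) y)^T) *m v^T) 0 0 = (v' *m G' (phi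
      y) *m K^T) 0 d.
    rewrite !mulmxA -/v' -mulmxA -trmx_mul mxE [RHS]mxE; apply: eq_bigr => b _; congr (_ * _).
    rewrite mxE [RHS]mxE mxE /K summxE; apply: eq_bigr => e _.
    rewrite (sym e) scalemxE.
    exact: erefl.
  have E2 : (v *m (partial_mx d (jac phi) y *m G' (phi y) *m J^T) *m v^T) 0 0 = (v' *m G' (phi
      y) *m K^T) 0 d.
    by rewrite -E1 [LHS]tr11 !trmx_mul !trmxK Gs !mulmxA.
  rewrite [X in _ = X + _]scalemxE.
  have key (a b b' x r : R) : a = x -> b' = x -> b = r -> a + b + b' = 2 * x + r.
    by move=> -> -> ->; ring.
  apply: (key _ _ _ _ _ E2 E1).
  rewrite !mulmxA -/v' -mulmxA -v'E mulmx_sumr mulmx_suml summxE mxE; apply: eq_bigr => f _.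
  by rewrite -scalemxAr -scalemxAl !mxE mulrC.
rewrite /lowered_geodesic rowE dGE GE// -/J -/v' !mulmxDl mulNmx mulmxDr mulmxDr !mulmxA -/v'.
rewrite scalerDr scalerA mulVf ?pnatr_eq0// scale1r -scalemxAl.
set A := w *m _ *m _ *m _; set B := v *m K *m _ *m _; set C := v' *m dir_mx _ _ _ *m _.
set D := v' *m _ *m K^T; set E := 2^-1 *: _.
by apply/rowP => i; rewrite !mxE; ring.
Qed.

End Covariance.

Section CurveTransfer.
Context {R : realType}.

Definition vel m (x : R -> 'rV[R]_m) s : 'rV[R]_m := \row_a (fun r => x r 0 a)^`()%classic s.
Definition acc m (x : R -> 'rV[R]_m) s : 'rV[R]_m := \row_a derive1n 2 (fun r => x r 0 a) s.

Definition cinf_curve m (J : set R) (x : R -> 'rV[R]_m) := forall a, cinf J (fun s => x s 0 a).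

Lemma cinf_curve_vel m J (x : R -> 'rV[R]_m) a (s : R) : cinf_curve J x -> J s ->
  is_derive s 1 (fun r => x r 0 a) (vel x s 0 a).
Proof. by move=> cx Js; rewrite mxE derive1E; apply/derivableP; exact: (cx a s 0%N). Qed.

Lemma cinf_curve_acc m J (x : R -> 'rV[R]_m) a (s : R) : cinf_curve J x -> J s ->
  is_derive s 1 (fun r => vel x r 0 a) (acc x s 0 a).
Proof.
move=> cx Js; rewrite mxE derive1nS derive1n1 derive1E.
rewrite (_ : (fun r => vel x r 0 a) = (fun r => x r 0 a)^`()%classic); last by apply/funext =>
    r; rewrite mxE.
by apply/derivableP; exact: (cx a s 1%N).
Qed.

Lemma cinf_curve_continuous m J (x : R -> 'rV[R]_m) s : cinf_curve J x -> J s -> {for s,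
    continuous x}.
Proof.
by move=> cx Js; apply: row_continuous => a; exact: is_derive1_continuous (cinf_curve_vel a cx Js).
Qed.

Lemma is_derive_curve_vel m J (F : 'rV[R]_m -> R) (x : R -> 'rV[R]_m) (s : R) :
  cinf_curve J x -> J s -> differentiable F (x s) ->
  is_derive s 1 (fun r => F (x r)) (\sum_a vel x s 0 a * partial a F (x s)).
Proof.
move=> cx Js dF; have h a : derivable (fun r => x r 0 a) s 1 by exact: (cx a s 0%N).
have := is_derive_curve dF h.
by under eq_bigr => a _ do rewrite (@derive_val _ _ _ _ _ _ _ (cinf_curve_vel a cx Js)).
Qed.

Lemma cinf_curve_comp m k J (U : set 'rV[R]_m) (phi : 'rV[R]_m -> 'rV[R]_k) (x : R -> 'rV[R]_m) :
  open J -> (forall b, smooth_on U (fun y => phi y 0 b)) -> cinf_curve J x ->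
  (forall s, J s -> U (x s)) -> cinf_curve J (phi \o x).
Proof. by move=> oJ sphi cx JU b; exact: (cinf_comp oJ JU cx (sphi b)). Qed.

Lemma vel_comp m k J (U : set 'rV[R]_m) (phi : 'rV[R]_m -> 'rV[R]_k) (x : R -> 'rV[R]_m) s :
  (forall b, smooth_on U (fun y => phi y 0 b)) -> cinf_curve J x ->
  J s -> U (x s) -> vel (phi \o x) s = vel x s *m jac phi (x s).
Proof.
move=> sphi cx Js Us; apply/rowP => b; rewrite mxE [RHS]mxE derive1E.
rewrite (@derive_val _ _ _ _ _ _ _ (is_derive_curve_vel cx Js (smooth_diff (sphi b) Us))).
by apply: eq_bigr => a _; rewrite [in RHS]mxE [X in _ = _ * X]mxE [in LHS]mxE.
Qed.

Lemma acc_comp m k J (U : set 'rV[R]_m) (phi : 'rV[R]_m -> 'rV[R]_k) (x : R -> 'rV[R]_m) s :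
  open J -> (forall b, smooth_on U (fun y => phi y 0 b)) -> cinf_curve J x ->
  (forall r, J r -> U (x r)) -> J s ->
  acc (phi \o x) s = acc x s *m jac phi (x s) + vel x s *m dir_mx (vel x s) (jac phi) (x s).
Proof.
move=> oJ sphi cx JU Js; apply/rowP => b.
have h : is_derive s 1 (fun r => vel (phi \o x) r 0 b) (acc (phi \o x) s 0 b).
  exact: cinf_curve_acc (cinf_curve_comp oJ sphi cx JU) Js.
rewrite -(@derive_val _ _ _ _ _ _ _ h).
have -> : 'D_1 (fun r => vel (phi \o x) r 0 b) s =
    'D_1 (fun r => \sum_a vel x r 0 a * partial a (fun y => phi y 0 b) (x r)) s.
  apply: near_eq_derive; apply: (near_open oJ Js) => r Jr.
  rewrite (vel_comp sphi cx Jr (JU _ Jr)) mxE; apply: eq_bigr => a _.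
  by congr (_ * _); rewrite mxE.
have hd a : is_derive s 1 (fun r => vel x r 0 a * partial a (fun y => phi y 0 b) (x r))
   (acc x s 0 a * partial a (fun y => phi y 0 b) (x s) + vel x s 0 a *
     \sum_e vel x s 0 e * partial e (partial a (fun y => phi y 0 b)) (x s)).
  apply: is_derive_mul; first exact: cinf_curve_acc cx Js.
  by apply: (is_derive_curve_vel cx Js); exact: smooth_diff (smooth_partial a (sphi b)) (JU _ Js).
rewrite (@derive_val _ _ _ _ _ _ _ (is_derive_bigsum hd)) big_split/= mxE; congr (_ + _).
  by rewrite [RHS]mxE; apply: eq_bigr => a _; congr (_ * _); rewrite mxE.
rewrite [RHS]mxE; apply: eq_bigr => a _; congr (_ * _).
rewrite /dir_mx summxE; apply: eq_bigr => e _; rewrite scalemxE; congr (_ * _).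
rewrite [RHS]mxE; congr (partial e _ _).
by apply/funext => y; rewrite mxE.
Qed.

Definition pseudo_metric_on m (U : set 'rV[R]_m) (G : 'rV[R]_m -> 'M[R]_m) :=
  [/\ forall y, U y -> G y \in unitmx, forall y, U y -> (G y)^T = G y &
      forall a b, smooth_on U (fun y => G y a b)].

(** By covariance the transformed left-hand side times the transposed Jacobian is zero; the Jacobian
    is invertible because [G] is. *)
Lemma geodesic_transfer m J (U U' : set 'rV[R]_m) (G G' : 'rV[R]_m -> 'M[R]_m)
    (phi : 'rV[R]_m -> 'rV[R]_m) (x : R -> 'rV[R]_m) s :
  open J -> open U -> pseudo_metric_on U G -> pseudo_metric_on U' G' ->
  (forall b, smooth_on U (fun y => phi y 0 b)) ->
  (forall y, U y -> U' (phi y)) ->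
  (forall y, U y -> G y = jac phi y *m G' (phi y) *m (jac phi y)^T) ->
  cinf_curve J x -> (forall r, J r -> U (x r)) -> J s ->
  geodesic_at G (x s) (vel x s) (acc x s) ->
  geodesic_at G' (phi (x s)) (vel (phi \o x) s) (acc (phi \o x) s).
Proof.
move=> oJ oU [Gu Gs sG] [G'u G's sG'] sphi UU' GE cx JU Js.
have Us := JU _ Js; have U's := UU' _ Us.
move/(geodesic_lowered_geodesic _ _ (Gu _ Us) (Gs _ Us)) => h.
apply/(geodesic_lowered_geodesic _ _ (G'u _ U's) (G's _ U's)).
have dG' : differentiable_mx G' (phi (x s)) by move=> a b; exact: smooth_diff (sG' a b) U's.
move: h; rewrite (lowered_geodesic_covariant _ _ oU Us sphi GE dG' (G's _ U's)).
rewrite -(vel_comp sphi cx Js Us) -(acc_comp oJ sphi cx JU Js) => h.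
have Ju : (jac phi (x s))^T \in unitmx.
  by have := Gu _ Us; rewrite GE// !unitmx_mul => /andP[].
by move/(congr1 (mulmxr (invmx (jac phi (x s))^T))): h; rewrite /= mulmxK// mul0mx.
Qed.

Definition quad m (A : 'M[R]_m) (v : 'rV[R]_m) := (v *m A *m v^T) 0 0.

Lemma quadE m (A : 'M[R]_m) v : quad A v = \sum_a \sum_b v 0 a * A a b * v 0 b.
Proof.
rewrite /quad mxE exchange_big/=; apply: eq_bigr => b _.
by rewrite mxE [X in _ * X]mxE big_distrl.
Qed.

Lemma quad_jac m (A A' J : 'M[R]_m) v : A = J *m A' *m J^T -> quad A v = quad A' (v *m J).
Proof. by move=> ->; rewrite /quad trmx_mul !mulmxA. Qed.

(** The derivative of the squared length of the velocity is twice the pairing of [lowered_geodesic]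
    with the velocity. *)
Lemma quad_derive m J (U : set 'rV[R]_m) (G : 'rV[R]_m -> 'M[R]_m) (x : R -> 'rV[R]_m) (s : R) :
  pseudo_metric_on U G -> cinf_curve J x -> U (x s) -> J s ->
  geodesic_at G (x s) (vel x s) (acc x s) ->
  is_derive s 1 (fun r => quad (G (x r)) (vel x r)) 0.
Proof.
move=> [Gu Gs sG] cx Us Js; set v := vel x s; set w := acc x s; set y := x s.
move/(geodesic_lowered_geodesic _ _ (Gu _ Us) (Gs _ Us)) => h.
have hd a b : is_derive s 1 (fun r => vel x r 0 a * G (x r) a b * vel x r 0 b)
   ((w 0 a * G y a b + v 0 a * \sum_e v 0 e * partial e (fun z => G z a b) y) * v 0 b
     + v 0 a * G y a b * w 0 b).
  apply: is_derive_mul; last exact: cinf_curve_acc cx Js.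
  apply: is_derive_mul; first exact: cinf_curve_acc cx Js.
  apply: (is_derive_curve_vel cx Js (F := fun z => G z a b)).
  exact: smooth_diff (sG a b) Us.
have := is_derive_bigsum (fun a => is_derive_bigsum (hd a)).
rewrite (_ : (fun y0 => _) = (fun r => quad (G (x r)) (vel x r))); last first.
  by apply/funext => r; rewrite quadE.
move=> /(@is_derive_eq _ _ _ _ _ _ _ _); apply.
have -> : \sum_i \sum_i0 ((w 0 i * G y i i0 + v 0 i * \sum_e v 0 e * partial e (fun z => G z i
    i0) y) *
     v 0 i0 + v 0 i * G y i i0 * w 0 i0) = (w *m G y *m v^T) 0 0 + (v *m dir_mx v G y *m v^T) 0
         0 + (v *m G y *m w^T) 0 0.
  rewrite ![in RHS]mxE -!big_split/= exchange_big/=; apply: eq_bigr => b _.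
  rewrite [X in X * _ + _ + _]mxE [X in _ + X * _ + _]mxE [X in _ + X * _]mxE.
  rewrite ![v^T _ _]mxE ![w^T _ _]mxE !big_distrl/= -!big_split/=; apply: eq_bigr => a _.
  rewrite mulrDl; congr (_ + _ * _ + _); congr (_ * _).
  by rewrite /dir_mx summxE; apply: eq_bigr => e _; rewrite scalemxE; congr (_ * _); rewrite mxE.
have := congr1 (fun r : 'rV[R]_m => (r *m v^T) 0 0) h.
rewrite /lowered_geodesic /= mulmxBl mulmxDl mul0mx -scalemxAl.
have -> : \row_d (v *m partial_mx d G y *m v^T) 0 0 *m v^T = v *m dir_mx v G y *m v^T.
  rewrite /dir_mx mulmx_sumr mulmx_suml; apply/matrixP => i j; rewrite !ord1 summxE mxE.
  by apply: eq_bigr => d _; rewrite -scalemxAr -scalemxAl scalemxE mulrC; congr (_ * _); rewrite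
      mxE.
have -> : (v *m G y *m w^T) 0 0 = (w *m G y *m v^T) 0 0.
  by rewrite tr11 !trmx_mul !trmxK (Gs _ Us) mulmxA.
set A := w *m G y *m v^T; set B := v *m dir_mx v G y *m v^T.
rewrite mxE [X in X + _]mxE [X in _ + X]mxE scalemxE [RHS]mxE.
lra.
Qed.

End CurveTransfer.

(** * Null geodesics *)

Section GeodesicFlow.
Context {R : realType} {m : nat}.
Variables (U : set 'rV[R]_m) (G : 'rV[R]_m -> 'M[R]_m).
Hypotheses (oU : open U) (pG : pseudo_metric_on U G).

Lemma smooth_christoffel_at c a b : smooth_on U (fun y => christoffel_at G y c a b).
Proof.
have [Gu Gs sG] := pG.
apply: smooth_mul => //; first exact: smooth_cst.
apply: smooth_sum => // e; apply: smooth_mul => //; first exact: smooth_invmx.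
apply: smooth_add => //; last first.
  by apply: smooth_opp => //; exact: smooth_partial.
by apply: smooth_add => //; exact: smooth_partial.
Qed.

(** The geodesic equation as a first-order system for position and velocity, stored in the left and
    right halves of a row of length m + m. *)
Lemma geodesic_local (x0 V : 'rV[R]_m) : U x0 ->
  exists2 d, 0 < d & exists x : R -> 'rV[R]_m, [/\ x 0 = x0, vel x 0 = V,
    cinf_curve [set s : R | `|s| < d] x &
    forall s, `|s| < d -> U (x s) /\ geodesic_at G (x s) (vel x s) (acc x s)].
Proof.
move=> Ux0.
pose U' : set 'rV[R]_(m + m) := lsubmx @^-1` U.
have oU' : open U' by apply: open_comp => // y _; exact: continuous_lsubmx.
pose A (y : 'rV[R]_(m + m)) : 'rV[R]_m := \row_c (- \sum_a \sum_b
  christoffel_at G (lsubmx y) c a b * y 0 (rshift m a) * y 0 (rshift m b)).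
pose Phi (y : 'rV[R]_(m + m)) : 'rV[R]_(m + m) := row_mx (rsubmx y) (A y).
have sPhi k : smooth_on U' (fun y => Phi y 0 k).
  case: (split_ordP k) => c ->.
    apply: smooth_ext (smooth_coord (U := U') (rshift m c)) => // y _.
    by rewrite /Phi row_mxEl mxE.
  have s : smooth_on U' (fun y => - \sum_a \sum_b
      christoffel_at G (lsubmx y) c a b * y 0 (rshift m a) * y 0 (rshift m b)).
    apply: smooth_opp => //; apply: smooth_sum => // a; apply: smooth_sum => // b.
    apply: smooth_mul => //; last exact: smooth_coord.
    apply: smooth_mul => //; last exact: smooth_coord.
    apply: (smooth_comp oU' (V := U) (F := fun z => christoffel_at G z c a b) (phi := lsubmx))
        => //.
      move=> e; apply: smooth_ext (smooth_coord (U := U') (lshift m e)) => // y _.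
      by rewrite mxE.
    exact: smooth_christoffel_at.
  by apply: smooth_ext s => // y _; rewrite /Phi row_mxEr mxE.
have U'0 : U' (row_mx x0 V) by rewrite /U' /= row_mxKl.
have [d d0 [Y [Y0 dY]]] := picard oU' U'0 sPhi.
pose J := [set s : R | `|s| < d].
have oJ : open J.
  rewrite (_ : J = ball (0 : R) d); first exact: ball_open.
  by apply/seteqP; split=> s; rewrite /J -ball_normE /= sub0r normrN.
have cY := cinf_solution oJ sPhi (fun s Js => (dY s Js).1) (fun s a Js => (dY s Js).2 a).
pose x s := lsubmx (Y s).
have J0 : J 0 by rewrite /J /= normr0.
have cx : cinf_curve J x.
  move=> a; apply: cinf_ext (cY (lshift m a)) => // s _.
  by rewrite mxE.
have velx s : J s -> vel x s = rsubmx (Y s).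
  move=> Js; apply/rowP => a; have h := (dY s Js).2 (lshift m a).
  rewrite mxE derive1E (_ : (fun r => x r 0 a) = (fun r => Y r 0 (lshift m a))); last first.
    by apply/funext => r; rewrite mxE.
  by rewrite (@derive_val _ _ _ _ _ _ _ h) /Phi row_mxEl.
exists d => //; exists x; split => //.
- by rewrite /x Y0 row_mxKl.
- by rewrite velx// Y0 row_mxKr.
move=> s Js; split; first exact: (dY s Js).1.
move=> c; have h := (dY s Js).2 (rshift m c).
have -> : acc x s 0 c = A (Y s) 0 c.
  rewrite -(@derive_val _ _ _ _ _ _ _ (cinf_curve_acc c cx Js)).
  rewrite -[RHS](row_mxEr (rsubmx (Y s))) -[RHS](@derive_val _ _ _ _ _ _ _ h).
  apply: near_eq_derive; apply: (near_open oJ Js) => r Jr.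
  by rewrite velx// mxE.
rewrite mxE velx//; apply/eqP; rewrite addrC subr_eq0; apply/eqP.
apply: eq_bigr => a _; apply: eq_bigr => b _.
by rewrite ![rsubmx _ _ _]mxE.
Qed.

(** Nullity persists because the squared length is conserved; the velocity stays nonzero after
    shrinking the interval, as a nonzero entry of [V] remains nonzero by continuity. *)
Lemma null_local (x0 V : 'rV[R]_m) : U x0 -> V != 0 -> quad (G x0) V = 0 ->
  exists2 d, 0 < d & exists x : R -> 'rV[R]_m, [/\ x 0 = x0, vel x 0 = V,
    cinf_curve [set s : R | `|s| < d] x &
    forall s, `|s| < d -> [/\ U (x s), geodesic_at G (x s) (vel x s) (acc x s),
      vel x s != 0 & quad (G (x s)) (vel x s) = 0]].
Proof.
move=> Ux0 V0 qV; have [d d0 [x [x00 v0 cx geo]]] := geodesic_local V Ux0.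
have q0 s : `|s| < d -> quad (G (x s)) (vel x s) = 0.
  move=> sd; have := @mean_value_ineq _ (fun r => quad (G (x r)) (vel x r)) (fun=> 0) d 0 s
      (lexx 0).
  rewrite normr0 mul0r x00 v0 qV subr0 normr_le0 => h.
  apply/eqP/h => // r rd; have [Ur gr] := geo r rd.
  by apply: quad_derive pG cx Ur _ gr.
have [a Va] : exists a, V 0 a != 0.
  by apply/existsP; apply: contraNT V0 => /existsPn h; apply/eqP/rowP => a; rewrite mxE;
      apply/eqP; move: (h a); rewrite negbK.
have : \forall s \near (0 : R), vel x s 0 a != 0.
  have J0 : [set s : R | `|s| < d] 0 by rewrite /= normr0.
  have := is_derive1_continuous (cinf_curve_acc a cx J0).
  rewrite -v0 in Va; move/cvgrPdist_lt => /(_ `|vel x 0 0 a|); rewrite normr_gt0 => /(_ Va).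
  apply: filterS => s; apply: contraTneq => ->; by rewrite subr0 ltxx.
move=> /nbhs_norm0P[d' /= d'0 d'P].
exists (Num.min d d'); first by rewrite lt_min d0.
exists x; split => //.
  by move=> b s k; rewrite /= lt_min => /andP[sd _]; exact: cx.
move=> s; rewrite lt_min => /andP[sd sd']; have [Us gs] := geo s sd.
split => //; last exact: q0.
by apply: contraTneq (d'P s sd') => ->; rewrite mxE eqxx.
Qed.

End GeodesicFlow.

Section Manifold.
Context {R : realType} {T : topologicalType} {m : nat} {I : Type}.

Lemma chart_cmapK (c : chart R T m) y : is_chart c -> (cmap c @` cdom c) y ->
  cdom c (cinv c y) /\ cmap c (cinv c y) = y.
Proof. by move=> [_ _ K _ _] [p dp <-]; rewrite K. Qed.

Lemma chart_cinv_continuous (c : chart R T m) y : is_chart c -> (cmap c @` cdom c) y ->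
  {for y, continuous (cinv c)}.
Proof.
move=> [_ oO _ _ + Oy]; rewrite continuous_open_subspace// => /(_ y).
by rewrite inE; exact.
Qed.

Lemma chart_cmap_continuous (c : chart R T m) p : is_chart c -> cdom c p -> {for p, continuous
    (cmap c)}.
Proof.
move=> [oD _ _ + _ Dp]; rewrite continuous_open_subspace// => /(_ p).
by rewrite inE; exact.
Qed.

Lemma chart_image_open (c : chart R T m) (D : set T) : is_chart c -> open D ->
  open (cmap c @` (cdom c `&` D)).
Proof.
move=> cc oD; have [_ oO K _ ci] := cc.
rewrite (_ : _ @` _ = (cmap c @` cdom c) `&` cinv c @^-1` D).
  move: ci; rewrite continuous_open_subspace// => ci.
  exact/(continuous_inP _ oO).1.
apply/seteqP; split=> [y [p [dp Dp] <-]|y [[p dp <-] /=]].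
  by split; [exists p|rewrite /= K].
by rewrite K// => Dp; exists p.
Qed.

Variables (ch : I -> chart R T m) (g : I -> T -> 'M[R]_m).

Definition coord_metric i (y : 'rV[R]_m) := g i (cinv (ch i) y).

(** Nondegeneracy replaces positivity here, since the metric to which this applies is the Lorentzian
    one of the spacetime. *)
Definition pseudo_riemannian :=
  [/\ smooth_atlas ch,
      forall i p, cdom (ch i) p -> g i p \in unitmx,
      forall i p, cdom (ch i) p -> (g i p)^T = g i p,
      forall i a b, smooth_on (cmap (ch i) @` cdom (ch i)) (fun y => coord_metric i y a b) &
      forall i j p, cdom (ch i) p -> cdom (ch j) p ->
        let J := jac (transition ch i j) (cmap (ch i) p) in
        g i p = J *m g j p *m J^T].

Hypothesis pr : pseudo_riemannian.

Lemma pr_chart i : is_chart (ch i).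
Proof. by have [[]] := pr. Qed.

Lemma coord_metricE i p : cdom (ch i) p -> coord_metric i (cmap (ch i) p) = g i p.
Proof. by move=> dp; have [_ _ K _ _] := pr_chart i; rewrite /coord_metric K. Qed.

Lemma coord_metric_pseudo i : pseudo_metric_on (cmap (ch i) @` cdom (ch i)) (coord_metric i).
Proof.
have [_ gu gs sg _] := pr; split => [y|y|]; last exact: sg.
- by move=> [p dp <-]; rewrite coord_metricE//; exact: gu.
- by move=> [p dp <-]; rewrite coord_metricE//; exact: gs.
Qed.

Lemma geodesic_atE i (gamma : R -> T) s : cdom (ch i) (gamma s) ->
  (forall c, derive1n 2 (coord ch i gamma c) s
    + \sum_a \sum_b christoffel ch g i (gamma s) c a b
        * velocity ch i gamma s 0 a * velocity ch i gamma s 0 b = 0) <->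
  geodesic_at (coord_metric i) (cmap (ch i) (gamma s)) (vel (cmap (ch i) \o gamma) s)
     (acc (cmap (ch i) \o gamma) s).
Proof.
move=> ds; rewrite /geodesic_at.
have E c : \sum_a \sum_b christoffel ch g i (gamma s) c a b
        * velocity ch i gamma s 0 a * velocity ch i gamma s 0 b =
   \sum_a \sum_b christoffel_at (coord_metric i) (cmap (ch i) (gamma s)) c a b
     * vel (cmap (ch i) \o gamma) s 0 a * vel (cmap (ch i) \o gamma) s 0 b.
  apply: eq_bigr => a _; apply: eq_bigr => b _; congr (_ * _ * _).
  by rewrite /christoffel /christoffel_at coord_metricE.
by split=> h c; move: (h c); rewrite [acc _ _ _ _]mxE E.
Qed.

Lemma curve_open (J : set R) (gamma : R -> T) (D : set T) : open J -> open D ->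
  {in J, continuous gamma} -> open (J `&` gamma @^-1` D).
Proof. by move=> oJ oD cg; exact: (continuous_inP _ oJ).1. Qed.

Lemma null_geodesic_exists i p (V : 'rV[R]_m) : cdom (ch i) p -> V != 0 ->
  quad (g i p) V = 0 ->
  exists2 d, 0 < d & exists gamma : R -> T,
    [/\ null_geodesic ch g [set s : R | `|s| < d] gamma, gamma 0 = p,
        velocity ch i gamma 0 = V & forall s, `|s| < d -> cdom (ch i) (gamma s)].
Proof.
move=> dp V0 qV; have [_ oO K _ _] := pr_chart i.
have Op : (cmap (ch i) @` cdom (ch i)) (cmap (ch i) p) by exists p.
have q0 : quad (coord_metric i (cmap (ch i) p)) V = 0 by rewrite coord_metricE.
have [d d0 [x [x0 v0 cx geo]]] := null_local oO (coord_metric_pseudo i) Op V0 q0.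
pose J := [set s : R | `|s| < d].
have oJ : open J.
  rewrite (_ : J = ball (0 : R) d); first exact: ball_open.
  by apply/seteqP; split=> s; rewrite /J -ball_normE /= sub0r normrN.
pose gamma s := cinv (ch i) (x s).
have gd s : J s -> cdom (ch i) (gamma s).
  by move=> Js; have [Us _ _ _] := geo s Js; have [] := chart_cmapK (pr_chart i) Us.
have gx s : J s -> cmap (ch i) (gamma s) = x s.
  by move=> Js; have [Us _ _ _] := geo s Js; have [] := chart_cmapK (pr_chart i) Us.
have cg : {in J, continuous gamma}.
  move=> s; rewrite inE => Js; apply: continuous_comp; first exact: cinf_curve_continuous cx Js.
  by apply: chart_cinv_continuous (pr_chart i) _; have [] := geo s Js.
(* The curve is built in chart [i], but [geodesic] demands the equation in every chart that contains
   the point. Near [s] the other coordinates are the transition map applied to [x], so covariance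
   applies. *)
have other j s : J s -> cdom (ch j) (gamma s) ->
    [/\ forall a k, derivable (derive1n k (coord ch j gamma a)) s 1,
      geodesic_at (coord_metric j) (cmap (ch j) (gamma s)) (vel (cmap (ch j) \o gamma) s)
        (acc (cmap (ch j) \o gamma) s),
      vel (cmap (ch j) \o gamma) s != 0 & quad (g j (gamma s)) (vel (cmap (ch j) \o gamma) s) = 0].
  move=> Js djs; have [[_ _ sT] gu gs sg gcov] := pr.
  have [odj _ _ _ _] := pr_chart j.
  pose J' := J `&` gamma @^-1` cdom (ch j).
  have oJ' : open J' by exact: curve_open.
  pose U := cmap (ch i) @` (cdom (ch i) `&` cdom (ch j)).
  have oU : open U by apply: chart_image_open => //; exact: pr_chart.
  have J'U r : J' r -> U (x r).
    by move=> [Jr djr]; exists (gamma r); [split=> //; exact: gd|exact: gx].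
  have cx' : cinf_curve J' x by move=> a r k [Jr _]; exact: cx.
  have E : cmap (ch j) \o gamma = transition ch i j \o x by [].
  have Js' : J' s by [].
  have cz := cinf_curve_comp oJ' (sT i j) cx' J'U.
  have [Us geos vs0 qs0] := geo s Js.
  have gcov' y : U y -> coord_metric i y = jac (transition ch i j) y *m
     coord_metric j (transition ch i j y) *m (jac (transition ch i j) y)^T.
    move=> [q [diq djq] <-]; have := gcov i j q diq djq => /= h.
    by rewrite /coord_metric /transition !K//; have [_ _ Kj _ _] := pr_chart j; rewrite Kj.
  have vE : vel (cmap (ch j) \o gamma) s = vel x s *m jac (transition ch i j) (x s).
    by rewrite E (vel_comp (sT i j) cx' Js' (J'U _ Js')).
  have gi : g i (gamma s) = coord_metric i (x s) by [].
  have GE : g i (gamma s) = jac (transition ch i j) (x s) *m g j (gamma s) *m (jac (transition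
      ch i j) (x s))^T.
    by rewrite -gx//; apply: gcov => //; exact: gd.
  split.
  - by move=> a k; exact: cz.
  - have [oO' oOj _ _ _] := pr_chart j.
    rewrite E.
    have -> : cmap (ch j) (gamma s) = transition ch i j (x s) by [].
    apply: (geodesic_transfer oJ' oU _ (coord_metric_pseudo j) (sT i j) _ gcov' cx' J'U Js' geos).
      have [h1 h2 h3] := coord_metric_pseudo i.
      split; [move=> y [q [dq _] <-]; apply: h1; by exists q|move=> y [q [dq _] <-]; apply: h2;
          by exists q|].
      move=> a b; apply: smooth_sub (h3 a b) => y [q [dq _] <-]; by exists q.
    move=> y [q [diq djq] <-]; exists q => //.
    by rewrite /transition K.
  - apply: contraNneq vs0; rewrite vE => /(congr1 (mulmxr (invmx (jac (transition ch i j) (x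
      s))))) /=.
    have Ju : jac (transition ch i j) (x s) \in unitmx.
      have : g i (gamma s) \in unitmx by apply: gu; exact: gd.
      by rewrite GE !unitmx_mul => /andP[/andP[]].
    by rewrite mulmxK// mul0mx => ->.
  - by rewrite vE -(quad_jac _ GE) gi.
exists d => //; exists gamma; split => //.
- split; first split.
  + split=> // j s Js djs a k.
    by have [] := other j s Js djs.
  + move=> j s Js djs; apply/geodesic_atE => //.
    by have [] := other j s Js djs.
  + move=> j s Js djs; have [_ _ h1 h2] := other j s Js djs.
    by split.
- by rewrite /gamma x0 K.
- have J0 : J 0 by rewrite /J /= normr0.
  rewrite -v0; apply/rowP => a; rewrite mxE [RHS]mxE !derive1E; apply: near_eq_derive.
  by apply: (near_open oJ J0) => r Jr; rewrite /coord gx.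
Qed.

End Manifold.

(** * The static spacetime metric *)

Section Jacobian.
Context {R : realType}.

Lemma jacobianE k m (phi : 'rV[R]_k -> 'rV[R]_m) y :
  (forall b, differentiable (fun z => phi z 0 b) y) -> 'J phi y = jac phi y.
Proof.
move=> dphi; have dp := differentiable_row dphi.
apply/matrixP => a b; rewrite [RHS]mxE /partial.
have := deriveEjacobian (delta_mx 0 a) dp; rewrite -rowE derive_mx; last exact: diff_derivable.
by move=> /rowP/(_ b); rewrite mxE [RHS]mxE => <-.
Qed.

Lemma smooth_rsubmx k m (O : set 'rV[R]_m) (F : 'rV[R]_m -> R) : open O -> smooth_on O F ->
  smooth_on (rsubmx @^-1` O : set 'rV[R]_(k + m)) (fun y => F (rsubmx y)).
Proof.
move=> oO sF; have oU : open (rsubmx @^-1` O : set 'rV[R]_(k + m)).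
  by apply: open_comp => // y _; exact: continuous_rsubmx.
apply: (smooth_comp oU (V := O) (F := F) (phi := rsubmx)) => // b.
apply: smooth_ext (smooth_coord (U := rsubmx @^-1` O) (rshift k b)) => // y _.
by rewrite mxE.
Qed.

Lemma partial_rsubmx k m (F : 'rV[R]_m -> R) (y : 'rV[R]_(k + m)) b :
  differentiable F (rsubmx y) ->
  partial (rshift k b) (fun y => F (rsubmx y)) y = partial b F (rsubmx y).
Proof.
move=> dF; transitivity (partial (rshift k b) (F \o rsubmx) y) => //.
have E a : (fun z : 'rV[R]_(k + m) => rsubmx z 0 a) = fun z => z 0 (rshift k a).
  by apply/funext => z; rewrite mxE.
have dr a : differentiable (fun z : 'rV[R]_(k + m) => rsubmx z 0 a) y.
  by rewrite E; exact: differentiable_coord.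
rewrite partial_comp// (bigD1 b)//= big1 => [|a ab].
  by rewrite E partial_coord eqxx mul1r addr0.
by rewrite E partial_coord eq_rshift eq_sym (negPf ab) mul0r.
Qed.

Lemma partial_lsubmx k m (F : 'rV[R]_m -> R) (y : 'rV[R]_(k + m)) a :
  differentiable F (rsubmx y) -> partial (lshift m a) (fun y => F (rsubmx y)) y = 0.
Proof.
move=> dF; transitivity (partial (lshift m a) (F \o rsubmx) y) => //.
have E b : (fun z : 'rV[R]_(k + m) => rsubmx z 0 b) = fun z => z 0 (rshift k b).
  by apply/funext => z; rewrite mxE.
have dr b : differentiable (fun z : 'rV[R]_(k + m) => rsubmx z 0 b) y.
  by rewrite E; exact: differentiable_coord.
rewrite partial_comp// big1 // => b _.
by rewrite E partial_coord eq_lrshift mul0r.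
Qed.

End Jacobian.

Section Spacetime.
Context {R : realType} {M : topologicalType} {n : nat} {I : Type}.
Variables (ch : I -> chart R M n) (g : I -> M -> 'M[R]_n) (N Psi : M -> R).
Hypothesis es : electrostatic_spacetime ch g N Psi.
Local Notation st := (st_chart ch).
Local Notation stg := (st_metric g N).

Lemma es_chart i : is_chart (ch i).
Proof. by have [[_ _ _ []]] := es. Qed.

Lemma es_cinvK i x : cdom (ch i) x -> cinv (ch i) (cmap (ch i) x) = x.
Proof. by have [_ _ K _ _] := es_chart i; exact: K. Qed.

Lemma es_N0 x : 0 < N x.
Proof. by have [] := es. Qed.

Lemma es_cover x : exists i, cdom (ch i) x.
Proof. by have [[_ _ _ [_ c _]] _ _ _ _] := es; exact: c. Qed.

Lemma st_image i (D : set M) :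
  cmap (st i) @` (cdom (st i) `&` [set p | D p.2]) = rsubmx @^-1` (cmap (ch i) @` (cdom (ch i)
      `&` D)).
Proof.
apply/seteqP; split=> [y [[t x] /= [dx Dx] <-]|y [x [dx Dx] /= xy]].
  by exists x => //=; rewrite row_mxKr.
exists (lsubmx y 0 0, x) => //=; rewrite xy.
rewrite (_ : const_mx _ = lsubmx y) ?hsubmxK//.
by apply/rowP => a; rewrite mxE !ord1.
Qed.

Lemma st_imageT i : cmap (st i) @` cdom (st i) = rsubmx @^-1` (cmap (ch i) @` cdom (ch i)).
Proof.
have := st_image i [set: M]; rewrite setIT => <-.
by congr (_ @` _); apply/seteqP; split=> p //=; case.
Qed.

Lemma st_cmapK i p : cdom (ch i) p.2 -> cinv (st i) (cmap (st i) p) = p.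
Proof.
by case: p => t x /= dx; rewrite row_mxKl row_mxKr mxE es_cinvK.
Qed.

Lemma st_is_chart i : is_chart (st i).
Proof.
have cc := es_chart i; have [oD oO K cm ci] := cc.
have oO' : open (cmap (st i) @` cdom (st i)).
  by rewrite st_imageT; apply: open_comp => // y _; exact: continuous_rsubmx.
have oD' : open (cdom (st i)).
  by apply: (@open_comp _ _ snd (cdom (ch i))) => // p _; exact: cvg_snd.
split=> //.
- by move=> p dp; exact: st_cmapK.
- rewrite continuous_open_subspace// => p; rewrite inE => dp.
  apply: row_continuous => k; case: (split_ordP k) => a ->.
    rewrite (_ : (fun _ => _) = fst); first exact: cvg_fst.
    by apply/funext => q; rewrite row_mxEl mxE.
  rewrite (_ : (fun _ => _) = (fun x => cmap (ch i) x 0 a) \o snd); last first.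
    by apply/funext => q; rewrite row_mxEr.
  apply: continuous_comp; first exact: cvg_snd.
  by apply: continuous_entry; exact: chart_cmap_continuous.
- rewrite continuous_open_subspace// => y; rewrite inE st_imageT /= => Oy.
  have h1 : {for y, continuous (fun y : 'rV[R]_(1 + n) => lsubmx y 0 0)}.
    rewrite (_ : (fun _ => _) = (fun y : 'rV[R]_(1 + n) => y 0 (lshift n 0))).
      exact: (@coord_continuous R 1 (1 + n) 0 (lshift n 0)).
    by apply/funext => z; rewrite mxE.
  have h2 : {for y, continuous (fun y : 'rV[R]_(1 + n) => cinv (ch i) (rsubmx y))}.
    apply: (@continuous_comp _ _ _ rsubmx (cinv (ch i))); first exact: continuous_rsubmx.
    exact: chart_cinv_continuous.
  exact: cvg_pair h1 h2.
Qed.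

Lemma es_transition_smooth i j k :
  smooth_on (cmap (ch i) @` (cdom (ch i) `&` cdom (ch j))) (fun y => transition ch i j y 0 k).
Proof. by have [[_ _ _ [_ _ sT]] _ _ _ _] := es; exact: sT. Qed.

Lemma st_transitionl i j y : transition st i j y 0 (lshift n 0) = y 0 (lshift n 0).
Proof. by rewrite /transition /= row_mxEl !mxE. Qed.

Lemma st_transitionr i j y k :
  transition st i j y 0 (rshift 1 k) = transition ch i j (rsubmx y) 0 k.
Proof. by rewrite /transition /= row_mxEr. Qed.

Lemma overlap_open i j : open (cmap (ch i) @` (cdom (ch i) `&` cdom (ch j))).
Proof. by apply: chart_image_open; [exact: es_chart|have [] := es_chart j]. Qed.

Lemma st_smooth_atlas : smooth_atlas st.
Proof.
split; first exact: st_is_chart.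
  by move=> p; have [i] := es_cover p.2; exists i.
move=> i j k; have -> : cdom (st i) `&` cdom (st j) = cdom (st i) `&` [set p | cdom (ch j) p.2]
    by [].
rewrite st_image; have oV : open (rsubmx @^-1` (cmap (ch i) @` (cdom (ch i) `&` cdom (ch j))) :
    set 'rV[R]_(1 + n)).
  by apply: open_comp; [move=> y _; exact: continuous_rsubmx|exact: overlap_open].
case: (split_ordP k) => a ->.
  apply: smooth_ext (smooth_coord (lshift n 0)) => // y _.
  by rewrite (ord1 a) st_transitionl.
have h := smooth_rsubmx (k := 1) (@overlap_open i j) (@es_transition_smooth i j a).
apply: smooth_ext h => // y _.
by rewrite st_transitionr.
Qed.

Lemma g_unit i p : cdom (ch i) p -> g i p \in unitmx.
Proof.
move=> dp; have [_ [_ pos _ _] _ _ _] := es.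
rewrite unitmxE unitfE; apply/det0P => -[v v0 vg].
by have := pos i p v dp v0; rewrite /inner vg mul0mx mxE ltxx.
Qed.

Lemma g_jac i j p : cdom (ch i) p -> cdom (ch j) p ->
  g i p = jac (transition ch i j) (cmap (ch i) p) *m g j p *m (jac (transition ch i j) (cmap (ch
      i) p))^T.
Proof.
move=> di dj; have [_ [_ _ _ cov] _ _ _] := es; have := cov i j p di dj.
rewrite /= jacobianE// => b.
by apply: smooth_diff (@es_transition_smooth i j b) _; exists p.
Qed.

Lemma N_smooth i : smooth_on (cmap (ch i) @` cdom (ch i)) (N \o cinv (ch i)).
Proof. by have [_ _ sN _ _] := es; have := sN i; rewrite setIT. Qed.

Lemma st_jac i j p : cdom (ch i) p.2 -> cdom (ch j) p.2 ->
  jac (transition st i j) (cmap (st i) p) =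
  block_mx 1%:M 0 0 (jac (transition ch i j) (cmap (ch i) p.2)).
Proof.
move=> di dj; have dT b : differentiable (fun y => transition ch i j y 0 b) (rsubmx (cmap (st i)
    p)).
  by rewrite /= row_mxKr; apply: smooth_diff (@es_transition_smooth i j b) _; exists p.2.
have El : (fun u => transition st i j u 0 (lshift n 0)) = fun u => u 0 (lshift n 0).
  by apply/funext => u; rewrite st_transitionl.
have Er b : (fun u => transition st i j u 0 (rshift 1 b)) = fun u => transition ch i j (rsubmx
    u) 0 b.
  by apply/funext => u; rewrite st_transitionr.
apply/matrixP => a b; rewrite mxE; case: (split_ordP b) => b' ->.
  rewrite (ord1 b') El partial_coord; case: (split_ordP a) => a' ->.
    by rewrite block_mxEul (ord1 a') eqxx mxE.
  by rewrite block_mxEdl mxE eq_sym eq_lrshift.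
rewrite Er; case: (split_ordP a) => a' ->.
  by rewrite block_mxEur mxE (partial_lsubmx _ (dT b')).
by rewrite block_mxEdr mxE (partial_rsubmx _ (dT b')) /= row_mxKr.
Qed.

Lemma st_pseudo_riemannian : pseudo_riemannian st stg.
Proof.
split; first exact: st_smooth_atlas.
- move=> i p dp; rewrite unitmxE /st_metric det_ublock unitrM -!unitmxE g_unit// andbT.
  rewrite unitmxE det_mx11 mxE unitfE oppr_eq0 sqrf_eq0 gt_eqF//; exact: es_N0.
- move=> i p dp; rewrite /st_metric tr_block_mx !trmx0 trmx_const.
  by have [_ [sym _ _ _] _ _ _] := es; rewrite sym.
- move=> i a b; rewrite st_imageT; have [_ oO _ _ _] := es_chart i.
  have oV : open (rsubmx @^-1` (cmap (ch i) @` cdom (ch i)) : set 'rV[R]_(1 + n)).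
    by apply: open_comp => // y _; exact: continuous_rsubmx.
  have sN := smooth_rsubmx (k := 1) oO (@N_smooth i).
  case: (split_ordP a) => a' ->; case: (split_ordP b) => b' ->.
  + apply: smooth_ext (smooth_opp oV (smooth_mul oV sN sN)) => // y _.
    by rewrite /coord_metric /st_metric block_mxEul mxE expr2.
  + apply: smooth_ext (smooth_cst 0) => // y _.
    by rewrite /coord_metric /st_metric block_mxEur mxE.
  + apply: smooth_ext (smooth_cst 0) => // y _.
    by rewrite /coord_metric /st_metric block_mxEdl mxE.
  + have [_ [_ _ sg _] _ _ _] := es.
    apply: smooth_ext (smooth_rsubmx (k := 1) oO (sg i a' b')) => // y _.
    by rewrite /coord_metric /st_metric block_mxEdr.
- move=> i j p di dj /=; rewrite st_jac// /st_metric tr_block_mx !trmx0 trmx1.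
  rewrite !mulmx_block !(mul0mx, mulmx0, mul1mx, mulmx1, addr0, add0r).
  by rewrite -g_jac.
Qed.

End Spacetime.

(** * Zero sets and their tangent directions *)

Section OneVariable.
Context {R : realType}.

Lemma is_derive1_eps (f : R -> R) (x d : R) :
  (forall e, 0 < e -> \forall h \near 0, `|f (h + x) - f x - d * h| <= e * `|h|) ->
  is_derive x 1 f d.
Proof.
move=> fe.
have h : h^-1 *: ((f \o shift x) (h *: (1 : R)) - f x) @[h --> (0 : R)^'] --> d.
  apply/cvgrPdist_le => e e0; have := fe _ e0.
  rewrite -nbhs_nearE => /nbhs_norm0P[r /= r0 rP].
  near=> h; have h0 : h != 0 by near: h; exact: nbhs_dnbhs_neq.
  have hr : `|h| < r by near: h; exact: dnbhs0_lt.
  have := rP h hr; rewrite /GRing.scale/= mulr1 => hh.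
  have -> : d - h^-1 * (f (h + x) - f x) = - h^-1 * (f (h + x) - f x - d * h).
    by field.
  by rewrite normrM normrN normfV ler_pdivrMl ?normr_gt0// [_ * e]mulrC.
apply: DeriveDef; first exact: cvgP h.
exact: cvg_lim h.
Unshelve. all: by end_near. Qed.

Lemma is_derive1_near (f : R -> R) (x d e : R) : is_derive x 1 f d -> 0 < e ->
  exists2 r, 0 < r & forall s, `|s - x| < r -> `|f s - f x - d * (s - x)| <= e * `|s - x|.
Proof.
move=> fd e0; have [dd vd] := fd; have df : differentiable f x by apply/derivable1_diffP.
have := diff_eps df e0; move=> /nbhs_norm0P[r /= r0 rP].
exists r => // s sr; have := rP _ sr; rewrite subrK.
have -> : 'D_(s - x) f x = d * (s - x) => //.
rewrite deriveE// -[X in 'd _ _ X]mulr1 -[_ * 1]/(_ *: _) linearZ/= -deriveE// vd.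
by rewrite mulrC.
Qed.

(** A quantitative local surjectivity that uses the derivative at the single point [s0]: to first
    order [alpha] changes sign relative to [t] across a short interval, and the intermediate value
    theorem finds the preimage. *)
Lemma inverse_control (alpha : R -> R) (a s0 d : R) : 0 < d -> a != 0 ->
  (forall s, `|s - s0| < d -> {for s, continuous alpha}) -> is_derive s0 1 alpha a ->
  exists2 r, 0 < r & forall t, `|t - alpha s0| < r ->
    exists s, [/\ `|s - s0| < d, alpha s = t & `|s - s0| <= 2 / `|a| * `|t - alpha s0|].
Proof.
move=> d0 a0 ca da; have na : 0 < `|a| by rewrite normr_gt0.
have [d1 d10 d1P] := is_derive1_near da (divr_gt0 na (ltr0Sn _ 1)).
pose dm := Num.min d d1; have dm0 : 0 < dm by rewrite lt_min d0.
exists (`|a| / 2 * dm); first by rewrite mulr_gt0// divr_gt0.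
(* [rho] is twice the first-order estimate |h| / |a|: at distance [rho] the linear part is 2 |h| and
   the error at most |h|, so the two ends lie on opposite sides of [t]. *)
move=> t tr; pose h := t - alpha s0; pose rho := 2 / `|a| * `|h|.
have rho0 : 0 <= rho by rewrite mulr_ge0// divr_ge0// ltW.
have rhoE : `|a| * rho = 2 * `|h| by rewrite /rho; field; rewrite gt_eqF.
have rhom : rho < dm.
  have : `|a| * rho < `|a| * dm by rewrite rhoE; rewrite -/h in tr; lra.
  by rewrite ltr_pM2l.
have rhod : rho < d by apply: lt_le_trans rhom _; rewrite ge_min lexx.
have rhod1 : rho < d1 by apply: lt_le_trans rhom _; rewrite ge_min lexx orbT.
have [s] : exists2 s, s \in `[s0 - rho, s0 + rho] & alpha s = t.
  apply: IVT.
  - lra.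
  - apply: continuous_in_subspaceT => s; rewrite inE/= in_itv/= => /andP[s1 s2].
    by apply: ca; apply: le_lt_trans rhod; rewrite ler_norml; apply/andP; split; lra.
  - have h1 := d1P (s0 + rho); have h2 := d1P (s0 - rho).
    have E1 : s0 + rho - s0 = rho by ring.
    have E2 : s0 - rho - s0 = - rho by ring.
    rewrite E1 ger0_norm// in h1; rewrite E2 normrN ger0_norm// in h2.
    move: (h1 rhod1) (h2 rhod1); rewrite !ler_norml.
    have hn := ler_norm h; have hn' : - h <= `|h| by rewrite -normrN ler_norm.
    have -> : t = alpha s0 + h by rewrite /h subrKC.
    move=> /andP[A1 A2] /andP[B1 B2]; rewrite ge_min le_max.
    have [ap|an] := ltP 0 a.
      rewrite gtr0_norm// in rhoE A1 A2 B1 B2; apply/andP; split; apply/orP; [left|right]; lra.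
    rewrite ler0_norm// in rhoE A1 A2 B1 B2; apply/andP; split; apply/orP; [right|left]; lra.
rewrite in_itv/= => /andP[s1 s2] st.
have sr : `|s - s0| <= rho by rewrite ler_norml; apply/andP; split; lra.
by exists s; split => //; exact: le_lt_trans rhod.
Qed.

(** Nothing is known about [u] beyond its values along [alpha]. Each small increment of the argument
    is realised as an increment of [alpha] by a parameter change of comparable size, and the
    difference quotient of [u] is then that of [b] over that of [alpha]. *)
Lemma derive_of_comp (u alpha b : R -> R) (a b' s0 d : R) : 0 < d -> a != 0 ->
  (forall s, `|s - s0| < d -> {for s, continuous alpha}) ->
  (forall s, `|s - s0| < d -> u (alpha s) = b s) ->
  is_derive s0 1 alpha a -> is_derive s0 1 b b' -> is_derive (alpha s0) 1 u (b' / a).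
Proof.
move=> d0 a0 ca ub da db; have na : 0 < `|a| by rewrite normr_gt0.
apply: is_derive1_eps => e e0.
(* The expansions of [b] and [alpha] contribute the factor 1 + |b' / a|, and the parameter change is
   at most 2 / |a| times |h|; a tolerance of e / C thus yields e |h|. *)
pose C := (1 + `|b' / a|) * (2 / `|a|).
have C0 : 0 < C by rewrite mulr_gt0 ?divr_gt0// ltr_wpDr.
have e10 : 0 < e / C by rewrite divr_gt0.
have [r1 r10 r1P] := is_derive1_near da e10.
have [r2 r20 r2P] := is_derive1_near db e10.
pose dm := Num.min d (Num.min r1 r2); have dm0 : 0 < dm by rewrite !lt_min d0 r10.
have dmd : dm <= d by rewrite ge_min lexx.
have ca' s : `|s - s0| < dm -> {for s, continuous alpha} by move=> sd; apply: ca; exact: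
    lt_le_trans dmd.
have [r r0 rP] := inverse_control dm0 a0 ca' da.
apply/nbhs_norm0P; exists r => // h /= hr.
have := rP (h + alpha s0); rewrite addrK => /(_ hr)[s [sd sh sb]].
move: sd; rewrite !lt_min => /andP[sd /andP[sr1 sr2]].
have h1 := r1P s sr1; have h2 := r2P s sr2.
have u0 : u (alpha s0) = b s0 by rewrite ub// subrr normr0.
rewrite -sh ub// u0; have hE : h = alpha s - alpha s0 by rewrite sh addrK.
have -> : b s - b s0 - b' / a * h = (b s - b s0 - b' * (s - s0)) - b' / a * (alpha s - alpha s0
    - a * (s - s0)).
  by rewrite hE; field.
apply: le_trans (ler_normB _ _) _; rewrite normrM.
have h3 := ler_wpM2l (normr_ge0 (b' / a)) h1.
apply: (@le_trans _ _ ((e / C) * (1 + `|b' / a|) * `|s - s0|)).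
  by apply: le_trans (lerD h2 h3) _; rewrite le_eqVlt; apply/orP; left; apply/eqP; ring.
have h4 : 0 <= (e / C) * (1 + `|b' / a|) by rewrite mulr_ge0 ?(ltW e10)// addr_ge0.
apply: le_trans (ler_wpM2l h4 sb) _.
have -> : e / C * (1 + `|b' / a|) * (2 / `|a| * `|h|) = e * `|h| * (C / C) by rewrite /C; ring.
by rewrite divff ?mulr1// gt_eqF.
Qed.

End OneVariable.

Section Pairing.
Context {R : realType} {m : nat}.
Implicit Types v w l : 'rV[R]_m.

Lemma pairingE w v : pairing w v = \sum_a w 0 a * v 0 a.
Proof. by rewrite /pairing mxE; apply: eq_bigr => a _; rewrite [X in _ * X]mxE. Qed.

Lemma pairingC w v : pairing w v = pairing v w.
Proof. by rewrite !pairingE; apply: eq_bigr => a _; rewrite mulrC. Qed.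

Lemma pairingDr w v1 v2 : pairing w (v1 + v2) = pairing w v1 + pairing w v2.
Proof. by rewrite /pairing linearD/= mulmxDr mxE. Qed.

Lemma pairingZr w k v : pairing w (k *: v) = k * pairing w v.
Proof. by rewrite /pairing linearZ/= -scalemxAr mxE. Qed.

Lemma pairingZl w k v : pairing (k *: w) v = k * pairing w v.
Proof. by rewrite pairingC pairingZr pairingC. Qed.

Lemma pairing_gt0 v : v != 0 -> 0 < pairing v v.
Proof.
move=> v0; rewrite pairingE.
have [a va] : exists a, v 0 a != 0.
  by apply/existsP; apply: contraNT v0 => /existsPn h; apply/eqP/rowP => a; rewrite mxE;
      apply/eqP; move: (h a); rewrite negbK.
rewrite (bigD1 a)//= ltr_pwDl//; first by rewrite -expr2 exprn_even_gt0.
by apply: sumr_ge0 => b _; rewrite -expr2 sqr_ge0.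
Qed.

(** For [c] the orthogonal projection coefficient, [l - c *: f] is in the kernel of [f], hence of
    [l], and so is orthogonal to itself. *)
Lemma pairing_colinear f l : f != 0 -> (forall v, pairing f v = 0 -> pairing l v = 0) ->
  exists c, l = c *: f.
Proof.
move=> f0 h; exists (pairing l f / pairing f f).
have ff := pairing_gt0 f0; set c := _ / _.
have h1 : pairing f (l - c *: f) = 0.
  by rewrite pairingDr -scaleNr pairingZr (pairingC f l) mulNr divfK ?subrr// gt_eqF.
have h2 := h _ h1; apply/eqP; rewrite -subr_eq0; apply: contraT => /pairing_gt0.
have -> : pairing (l - c *: f) (l - c *: f) = pairing l (l - c *: f) - c * pairing f (l - c *: f).
  by rewrite pairingDr -scaleNr pairingZr ![pairing (l + _) _]pairingC mulNr.
by rewrite h1 h2 mulr0 subrr ltxx.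
Qed.

Definition grad (F : 'rV[R]_m -> R) y : 'rV[R]_m := \row_a partial a F y.

Lemma derive_grad F y v : differentiable F y -> 'D_v F y = pairing (grad F y) v.
Proof.
move=> dF; rewrite derive_partial// pairingE; apply: eq_bigr => a _.
by rewrite mulrC; congr (_ * _); rewrite mxE.
Qed.

Lemma mean_value_grad (F : 'rV[R]_m -> R) (y z : 'rV[R]_m) :
  (forall t, 0 <= t <= 1 -> differentiable F (z + t *: (y - z))) ->
  exists2 t, 0 < t < 1 & F y - F z = pairing (grad F (z + t *: (y - z))) (y - z).
Proof.
move=> /mean_value_row[t t01 ->]; exists t => //.
by rewrite pairingE; apply: eq_bigr => a _; rewrite mulrC; congr (_ * _); rewrite mxE.
Qed.

Lemma near_ray (Q : 'rV[R]_m -> Prop) (C : R) : (\forall h \near (0 : 'rV[R]_m), Q h) -> 0 <= C ->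
  exists2 r, 0 < r & forall k v, `|v| <= C -> 0 < k <= r -> Q (k *: v).
Proof.
move=> /nbhs_norm0P[r /= r0 rQ] C0; have C1 : 0 < C + 1 by rewrite ltr_wpDl.
exists (r / (C + 1)); first by rewrite divr_gt0.
move=> k v vC /andP[k0]; rewrite ler_pdivlMr// => kr; apply: rQ => /=.
rewrite normrZ gtr0_norm//; apply: lt_le_trans kr; rewrite ltr_pM2l//.
by apply: le_lt_trans vC _; rewrite ltrDl.
Qed.

(* The zero set of F near y is approached, in any direction v tangent to it, by
   points y + k (v + t e) with e transversal and t small. *)
Lemma tangent_transfer (O : set 'rV[R]_m) (F H : 'rV[R]_m -> R) y v :
  open O -> O y -> (forall z, O z -> differentiable F z) -> F y = 0 ->
  grad F y != 0 -> differentiable H y -> (forall z, O z -> F z = 0 -> H z = 0) ->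
  pairing (grad F y) v = 0 -> pairing (grad H y) v = 0.
Proof.
move=> oO Oy dF Fy gF dH FH Fv; set e := grad F y.
pose k := pairing e e; have k0 : 0 < k by exact: pairing_gt0.
apply/eqP; apply: contraT => a0.
pose a := pairing (grad H y) v; have na : 0 < `|a| by rewrite normr_gt0.
pose b := pairing (grad H y) e.
(* So small that the correction [t *: e] with |t| at most [eta] changes the derivative of [H] by at
   most |a| / 4. *)
pose eta := `|a| / (4 * (`|b| + 1)).
have b1 : 0 < `|b| + 1 by rewrite ltr_wpDl.
have eta0 : 0 < eta by rewrite divr_gt0// mulr_gt0.
pose C := `|v| + eta * `|e|.
have C0 : 0 <= C by rewrite addr_ge0// mulr_ge0// ltW.
have C1 : 0 < C + 1 by rewrite ltr_wpDl.
have vC t : `|t| <= eta -> `|v + t *: e| <= C.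
  move=> te; apply: le_trans (ler_normD _ _) _; rewrite lerD2l normrZ.
  exact: ler_wpM2r.
(* These tolerances keep the expansion error of [F] below half of [r * (eta * k)], so that [F]
   changes sign for t between -eta and eta, and that of [H] below [r * |a| / 4]. *)
have e10 : 0 < eta * k / (2 * (C + 1)) by rewrite !divr_gt0// mulr_gt0.
have e20 : 0 < `|a| / (4 * (C + 1)) by rewrite !divr_gt0// mulr_gt0.
have n1 := diff_eps (dF _ Oy) e10; have n2 := diff_eps dH e20.
have n3 : \forall h \near (0 : 'rV[R]_m), O (h + y).
  have [r r0 rO] := ball_open_sub oO Oy.
  by apply/nbhs_norm0P; exists r => // h /= hr; apply: rO; rewrite addrK ltW.
have [r1 r10 h1] := near_ray n1 C0; have [r2 r20 h2] := near_ray n2 C0.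
have [r3 r30 h3] := near_ray n3 C0.
pose r := Num.min r1 (Num.min r2 r3).
have r0 : 0 < r by rewrite !lt_min r10 r20.
have rr1 : 0 < r <= r1 by rewrite r0 ge_min lexx.
have rr2 : 0 < r <= r2 by rewrite r0 !ge_min lexx orbT.
have rr3 : 0 < r <= r3 by rewrite r0 !ge_min lexx !orbT.
pose p t := r *: (v + t *: e) + y.
have Op t : `|t| <= eta -> O (p t) by move=> te; exact: h3 (vC t te) rr3.
have nr w : `|w| <= C -> `|r *: w| <= r * C.
  by move=> wC; rewrite normrZ gtr0_norm// ler_pM2l.
have small c w : 0 < c -> `|w| <= C -> c / (2 * (C + 1)) * `|r *: w| < r * c / 2.
  move=> c0 wC; apply: (@le_lt_trans _ _ (c / (2 * (C + 1)) * (r * C))).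
    by rewrite ler_wpM2l ?nr// ltW// divr_gt0// mulr_gt0.
  have -> : c / (2 * (C + 1)) * (r * C) = r * c / 2 * (C / (C + 1)).
    by field; rewrite gt_eqF.
  rewrite gtr_pMr; last by rewrite !divr_gt0// mulr_gt0.
  by rewrite ltr_pdivrMr// mul1r ltrDl.
have Fp t : `|t| <= eta -> `|F (p t) - r * t * k| < r * (eta * k) / 2.
  move=> te; apply: le_lt_trans (small _ _ (mulr_gt0 eta0 k0) (vC t te)).
  have := h1 r _ (vC t te) rr1; rewrite -/(p t) Fy subr0 derive_grad; last exact: dF.
  by rewrite pairingZr pairingDr Fv add0r pairingZr -/e -/k mulrA.
have ek0 : 0 < r * (eta * k) by rewrite !mulr_gt0.
have [t] : exists2 t, t \in `[- eta, eta] & F (p t) = 0.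
  apply: IVT.
  - by move: eta0; clear -m; lra.
  - apply: continuous_in_subspaceT => t; rewrite inE/= in_itv/= -ler_norml => te.
    have dl : differentiable F ((r *: v + y) + t *: (r *: e)).
      have -> : (r *: v + y) + t *: (r *: e) = p t.
        by rewrite /p scalerDr !scalerA [r * t]mulrC addrAC.
      exact/dF/Op.
    have -> : (fun t => F (p t)) = (fun t => F ((r *: v + y) + t *: (r *: e))).
      by apply/funext => s; rewrite /p scalerDr !scalerA [r * s]mulrC addrAC.
    exact: is_derive1_continuous (is_derive_line dl).
  - have he := Fp eta; have hm := Fp (- eta); rewrite normrN gtr0_norm// in he hm.
    move: (he (lexx _)) (hm (lexx _)); rewrite !ltr_norml => /andP[A1 A2] /andP[B1 B2].
    rewrite ge_min le_max; apply/andP; split; apply/orP; [left|right].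
      have E : r * - eta * k = - (r * (eta * k)) by ring.
      by rewrite E in B2; move: B2 ek0; clear -m; lra.
    have E : r * eta * k = (r * (eta * k)) by ring.
    by rewrite E in A1; move: A1 ek0; clear -m; lra.
rewrite in_itv/= -ler_norml => te Ft.
have Hp := FH _ (Op t te) Ft; have Hy := FH _ Oy Fy.
have := h2 r _ (vC t te) rr2; rewrite -/(p t) Hp Hy subrr sub0r normrN derive_grad//.
rewrite pairingZr pairingDr pairingZr -/a -/b normrM gtr0_norm// => h4.
have h5 : `|a| / (4 * (C + 1)) * `|r *: (v + t *: e)| < r * (`|a| / 2) / 2.
  have := small (`|a| / 2) _ _ (vC t te); rewrite divr_gt0// => /(_ isT).
  have -> // : `|a| / 2 / (2 * (C + 1)) = `|a| / (4 * (C + 1)) by field; rewrite gt_eqF.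
have h6 : `|a + t * b| < `|a| / 4.
  rewrite -(ltr_pM2l r0); apply: le_lt_trans h4 _; move: h5; clear -m; lra.
have h7 : `|t * b| <= `|a| / 4.
  rewrite normrM; apply: (@le_trans _ _ (eta * (`|b| + 1))).
    by apply: ler_pM => //; rewrite lerDl.
  by rewrite /eta le_eqVlt; apply/orP; left; apply/eqP; field; rewrite gt_eqF.
have := ler_normB (a + t * b) (t * b); rewrite addrK; move: na h6 h7; clear -m; lra.
Qed.

Lemma grad_pairing_continuous (O : set 'rV[R]_m) (H : 'rV[R]_m -> R) y w : open O -> smooth_on O
    H -> O y ->
  {for y, continuous (fun z => pairing (grad H z) w)}.
Proof.
move=> oO sH Oy; rewrite (_ : (fun _ => _) = fun z => \sum_a w 0 a * partial a H z); last first.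
  by apply/funext => z; rewrite pairingE; apply: eq_bigr => a _; rewrite mulrC; congr (_ * _);
      rewrite mxE.
have s : smooth_on O (fun z => \sum_a w 0 a * partial a H z).
  apply: smooth_sum => // a; apply: smooth_mul => //; first exact: smooth_cst.
  exact: smooth_partial.
exact: smooth_continuous s Oy.
Qed.

(** [F] has opposite signs at the ends of a short segment through [y0] in direction [e], and still
    does after moving the segment to a nearby [q]; this gives the root. The derivative of [H] along
    [e] has no zero near [y0], so by the mean value theorem [H] takes its value at [q] only for t =
    0. *)
Lemma transversal_root (O : set 'rV[R]_m) (F H : 'rV[R]_m -> R) y0 e :
  open O -> O y0 -> smooth_on O F -> smooth_on O H -> F y0 = 0 ->
  pairing (grad F y0) e != 0 -> pairing (grad H y0) e != 0 ->
  exists2 r, 0 < r & forall q, `|q - y0| <= r ->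
    exists t, [/\ O (q + t *: e), F (q + t *: e) = 0 & H (q + t *: e) = H q -> t = 0].
Proof.
move=> oO Oy sF sH Fy kF kH.
pose k := pairing (grad F y0) e; pose l := pairing (grad H y0) e.
have k0 : 0 < `|k| by rewrite normr_gt0.
have l0 : 0 < `|l| by rewrite normr_gt0.
have : \forall z \near y0, O z /\ pairing (grad H z) e != 0.
  have h := grad_pairing_continuous (w := e) oO sH Oy.
  apply: filterI; first exact: open_nbhs_nbhs.
  move/cvgrPdist_lt: h => /(_ _ l0); apply: filterS => z.
  by apply: contraTneq => ->; rewrite subr0 ltxx.
move=> /nbhs_le[rho rho0 rhoP].
have e1 : 0 < `|e| + 1 by rewrite ltr_wpDl.
have dF := smooth_diff sF Oy.
have e10 : 0 < `|k| / (2 * (`|e| + 1)) by rewrite divr_gt0// mulr_gt0.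
have [r1 r10 r1P] := near_ray (diff_eps dF e10) (normr_ge0 e).
(* At [y0] moved by [s] along [e] or [- e] the value of [F] is then at least s |k| / 2 in absolute
   value, the margin for passing from [y0] to [q]; the second bound keeps the segment in the ball of
   radius [rho]. *)
pose s := Num.min r1 (rho / (2 * (`|e| + 1))).
have s0 : 0 < s by rewrite lt_min r10 divr_gt0// mulr_gt0.
have sr1 : s <= r1 by rewrite ge_min lexx.
have srho t : `|t| <= s -> `|t *: e| <= rho / 2.
  move=> ts; rewrite normrZ; apply: (@le_trans _ _ (s * (`|e| + 1))).
    by apply: ler_pM => //; rewrite lerDl.
  have : s <= rho / (2 * (`|e| + 1)) by rewrite ge_min lexx orbT.
  move=> /(ler_wpM2r (ltW e1)) /le_trans; apply.
  by rewrite le_eqVlt; apply/orP; left; apply/eqP; field; rewrite gt_eqF.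
have Fs w : (w = e) \/ (w = - e) -> `|F (y0 + s *: w) - s * pairing (grad F y0) w| <= s * `|k| / 2.
  move=> we; have nw : `|w| = `|e| by case: we => ->; rewrite ?normrN.
  have := r1P s w; rewrite nw lexx s0 sr1 => /(_ isT isT).
  rewrite Fy subr0 derive_grad// pairingZr [_ + y0]addrC => /le_trans; apply.
  rewrite normrZ nw gtr0_norm//.
  have -> : `|k| / (2 * (`|e| + 1)) * (s * `|e|) = s * `|k| / 2 * (`|e| / (`|e| + 1)).
    by field; rewrite gt_eqF.
  rewrite ger_pMr; last by rewrite divr_gt0// mulr_gt0.
  by rewrite ler_pdivrMr// mul1r lerDl.
have h1 := Fs e (or_introl erefl); have h2 := Fs (- e) (or_intror erefl).
rewrite -scaleN1r pairingZr mulN1r -/k scaleN1r in h2; rewrite -/k in h1.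
have Oin z : `|z - y0| <= rho -> O z by move=> /rhoP[].
have Oe w : (w = e) \/ (w = - e) -> O (y0 + s *: w).
  move=> we; apply: Oin; rewrite addrC addKr.
  have -> : `|s *: w| = `|s *: e| by case: we => ->; rewrite ?scalerN ?normrN.
  by apply: le_trans (srho s _) _; [rewrite gtr0_norm|move: rho0; clear -m; lra].
have sk : 0 < s * `|k| / 2 by rewrite divr_gt0// mulr_gt0.
have near_e w : (w = e) \/ (w = - e) -> exists2 r, 0 < r & forall q, `|q - y0| <= r ->
    `|F (q + s *: w) - F (y0 + s *: w)| < s * `|k| / 2.
  move=> we; have := smooth_continuous sF (Oe w we).
  move/cvgrPdist_lt => /(_ _ sk) /nbhs_le[r r0 rP]; exists r => // q qr.
  by rewrite distrC; apply: rP; rewrite opprD addrACA subrr addr0.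
have [r2 r20 r2P] := near_e e (or_introl erefl).
have [r3 r30 r3P] := near_e (- e) (or_intror erefl).
pose r := Num.min (rho / 2) (Num.min r2 r3).
exists r; first by rewrite !lt_min divr_gt0// r20.
move=> q qr.
have qrho : `|q - y0| <= rho / 2 by apply: le_trans qr _; rewrite ge_min lexx.
have q2 : `|q - y0| <= r2 by apply: le_trans qr _; rewrite !ge_min lexx orbT.
have q3 : `|q - y0| <= r3 by apply: le_trans qr _; rewrite !ge_min lexx !orbT.
have inrho t : `|t| <= s -> `|q + t *: e - y0| <= rho.
  move=> ts; rewrite addrAC; apply: le_trans (ler_normD _ _) _.
  by have := srho t ts; move: qrho; clear -m; lra.
have dline t : `|t| <= s -> differentiable F (q + t *: e).
  by move=> ts; apply: (smooth_diff sF); apply: Oin; exact: inrho.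
have g2 := r2P q q2; have g3 := r3P q q3.
have [t] : exists2 t, t \in `[- s, s] & F (q + t *: e) = 0.
  apply: IVT.
  - by move: s0; clear -m; lra.
  - apply: continuous_in_subspaceT => t; rewrite inE/= in_itv/= -ler_norml => ts.
    exact: is_derive1_continuous (is_derive_line (dline t ts)).
  - rewrite scaleNr; rewrite scalerN in h2; rewrite scalerN in g3.
    move: h1 h2 g2 g3; rewrite !ler_norml !ltr_norml => /andP[A1 A2] /andP[B1 B2] /andP[C1 C2]
        /andP[D1 D2].
    rewrite ge_min le_max.
    have [kp|kn] := ltP 0 k.
      rewrite gtr0_norm// in sk A1 A2 B1 B2 C1 C2 D1 D2.
      move: sk A1 A2 B1 B2 C1 C2 D1 D2; clear -m => *.
      by apply/andP; split; apply/orP; [left|right]; lra.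
    rewrite ler0_norm// in sk A1 A2 B1 B2 C1 C2 D1 D2.
    move: sk A1 A2 B1 B2 C1 C2 D1 D2; clear -m => *.
    by apply/andP; split; apply/orP; [right|left]; lra.
rewrite in_itv/= -ler_norml => ts Ft; exists t; split => //.
  by apply: Oin; exact: inrho.
move=> HE.
have qq : `|q - y0| <= rho by move: qrho rho0; clear -m; lra.
have seg u : 0 <= u <= 1 -> `|q + u *: (q + t *: e - q) - y0| <= rho.
  by move=> u01; apply: segment_ball => //; exact: inrho.
have [u u01|u /andP[u0 u1] E] := @mean_value_grad H (q + t *: e) q.
  by apply: (smooth_diff sH); apply: Oin; exact: seg.
have u01 : 0 <= u <= 1 by rewrite !ltW.
have [_ nz] := rhoP _ (seg u u01).
move: E; rewrite HE subrr [X in pairing _ X]addrC addKr pairingZr => /esym/eqP.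
by rewrite mulf_eq0 (negPf nz) orbF => /eqP.
Qed.

End Pairing.

(** * Null vectors of a Lorentzian hyperplane *)

Section NullVectors.
Context {R : realType} {m : nat}.
Variables (G : 'M[R]_m) (f v : 'rV[R]_m).
Hypothesis m3 : (2 < m)%N.
Hypothesis Gs : G^T = G.

Let bil (x y : 'rV[R]_m) := (x *m G *m y^T) 0 0.

Let bilC x y : bil x y = bil y x.
Proof. by rewrite /bil tr11 !trmx_mul trmxK Gs mulmxA. Qed.

Let bilDr x y z : bil x (y + z) = bil x y + bil x z.
Proof. by rewrite /bil linearD/= mulmxDr mxE. Qed.

Let bilZr x k y : bil x (k *: y) = k * bil x y.
Proof. by rewrite /bil linearZ/= -scalemxAr mxE. Qed.

Let bilDl x y z : bil (x + y) z = bil x z + bil y z.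
Proof. by rewrite bilC bilDr !(bilC z). Qed.

Let bilZl x k y : bil (k *: x) y = k * bil x y.
Proof. by rewrite bilC bilZr bilC. Qed.

Hypotheses (fv : pairing f v = 0) (v0 : bil v v < 0).
Hypothesis pos : forall w, pairing f w = 0 -> bil v w = 0 -> w != 0 -> 0 < bil w w.

(** Two linear conditions in dimension at least 3 have a nonzero common solution. *)
Lemma spacelike_exists : exists w, [/\ pairing f w = 0, bil v w = 0 & w != 0].
Proof.
pose B : 'M[R]_(m, 1 + 1) := row_mx f^T (v *m G)^T.
have : kermx B != 0.
  rewrite -mxrank_eq0 mxrank_ker subn_eq0 -ltnNge.
  by apply: leq_ltn_trans m3; exact: rank_leq_col.
move=> /eqP/matrixP K.
have [i ri] : exists i, row i (kermx B) != 0.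
  apply/existsP; apply: contraT => /existsPn h; exfalso; apply: K => i j.
  by move: (h i); rewrite negbK => /eqP/rowP/(_ j); rewrite mxE => ->; rewrite !mxE.
have : row i (kermx B) *m B = 0 by rewrite -row_mul mulmx_ker row0.
move: (row i (kermx B)) ri => w w0; rewrite mul_mx_row => E.
exists w; split => //.
- rewrite pairingC /pairing; have := congr1 lsubmx E; rewrite row_mxKl => ->.
  by rewrite mxE mxE.
- rewrite bilC /bil; have := congr1 rsubmx E; rewrite row_mxKr trmx_mul Gs mulmxA => ->.
  by rewrite mxE mxE.
Qed.

Let null_pair w : pairing f w = 0 -> bil v w = 0 -> w != 0 ->
  exists2 a, a != 0 & forall s, s = 1 \/ s = -1 ->
    [/\ a *: v + s *: w != 0, bil (a *: v + s *: w) (a *: v + s *: w) = 0 &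
        pairing f (a *: v + s *: w) = 0].
Proof.
move=> fw vw w0; have qw := pos fw vw w0.
have q0 : 0 < bil w w / - bil v v by rewrite divr_gt0// oppr_gt0.
pose a := Num.sqrt (bil w w / - bil v v).
have a0 : a != 0 by rewrite sqrtr_eq0 -ltNge.
have a2 : a * a * bil v v = - bil w w.
  rewrite -expr2 sqr_sqrtr ?(ltW q0)//; field.
  by rewrite lt_eqF.
exists a => // s s1; have s2 : s * s = 1 by case: s1 => ->; ring.
have bvv : bil v (a *: v + s *: w) = a * bil v v by rewrite bilDr !bilZr vw mulr0 addr0.
split.
- apply/eqP => E; move: bvv; rewrite E /bil linear0 mulmx0 mxE => /esym/eqP.
  by rewrite mulf_eq0 (negPf a0) (lt_eqF v0).
- rewrite bilDl !bilZl bvv mulrA a2 bilDr !bilZr (bilC w v) vw mulr0 add0r.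
  by rewrite mulrA s2 mul1r addNr.
- by rewrite pairingDr !pairingZr fv fw !mulr0 addr0.
Qed.

Lemma null_exists : exists V, [/\ V != 0, bil V V = 0 & pairing f V = 0].
Proof.
have [w [fw vw w0]] := spacelike_exists; have [a a0 h] := null_pair fw vw w0.
by exists (a *: v + 1 *: w); apply: h; left.
Qed.

(* If w in ker f is orthogonal to v, then a v + w and a v - w are null for some a <> 0. *)
Lemma null_span l : (forall V, V != 0 -> bil V V = 0 -> pairing f V = 0 -> pairing l V = 0) ->
  forall w, pairing f w = 0 -> pairing l w = 0.
Proof.
move=> lnull; have key w : pairing f w = 0 -> bil v w = 0 -> w != 0 ->
    pairing l w = 0 /\ pairing l v = 0.
  move=> fw vw w0; have [a a0 h] := null_pair fw vw w0.
  have [h1 h2 h3] := h 1 (or_introl erefl); have := lnull _ h1 h2 h3.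
  have [h4 h5 h6] := h (-1) (or_intror erefl); have := lnull _ h4 h5 h6.
  rewrite !pairingDr !pairingZr => E1 E2.
  have E3 : a * pairing l v = 0 by lra.
  split; first by lra.
  by move/eqP: E3; rewrite mulf_eq0 (negPf a0) => /eqP.
(* One spacelike vector already yields that [l] vanishes on [v]; this also settles the multiples of
   [v], for which [w'] below is zero. *)
have [w0 [fw0 vw0 w00]] := spacelike_exists; have [_ lv] := key _ fw0 vw0 w00.
move=> w fw; pose c := bil v w / bil v v; pose w' := w - c *: v.
have wE : w = w' + c *: v by rewrite subrK.
have fw' : pairing f w' = 0 by rewrite /w' -scaleNr pairingDr pairingZr fv fw mulr0 addr0.
have vw' : bil v w' = 0.
  by rewrite /w' -scaleNr bilDr bilZr /c mulNr divfK ?subrr// lt_eqF.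
rewrite wE pairingDr pairingZr lv mulr0 addr0.
have [->|/key[]//] := eqVneq w' 0.
by rewrite /pairing linear0 mulmx0 mxE.
Qed.

End NullVectors.

(** * Equipotential photon surfaces *)

Lemma derive_along (R : realType) (T : topologicalType) (m : nat) (I : Type)
    (ch : I -> chart R T m) i (W : set T) (f : T -> R) (J : set R) (gamma : R -> T) (s : R) :
  is_chart (ch i) -> smooth_curve ch J gamma -> J s -> cdom (ch i) (gamma s) -> W (gamma s) ->
  smooth_fun ch W f ->
  is_derive s 1 (f \o gamma) (pairing (differential ch i f (gamma s)) (velocity ch i gamma s)).
Proof.
move=> cc [cg sc] Js ds Ws sf; have [oD _ K _ _] := cc.
have dF : differentiable (f \o cinv (ch i)) (cmap (ch i) (gamma s)).
  by apply: smooth_diff (sf i) _; exists (gamma s).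
have dx a : derivable (fun r => (cmap (ch i) \o gamma) r 0 a) s 1.
  by exact: sc i s Js ds a 0%N.
have h := @is_derive_curve _ _ (f \o cinv (ch i)) (cmap (ch i) \o gamma) s dF dx.
have nearD : \forall r \near s, cdom (ch i) (gamma r).
  have : {for s, continuous gamma} by apply: cg; rewrite inE.
  by apply; exact: open_nbhs_nbhs.
apply: (near_eq_is_derive (f := (f \o cinv (ch i)) \o (cmap (ch i) \o gamma))).
  by apply: filterS nearD => r dr /=; rewrite K.
apply: (is_derive_eq h); rewrite pairingE; apply: eq_bigr => a _.
by rewrite mulrC; congr (_ * _); rewrite mxE// derive1E.
Qed.

Lemma open_norm_lt (R : realType) (d : R) : open [set s : R | `|s| < d].
Proof.
rewrite (_ : [set _ | _] = ball (0 : R) d); first exact: ball_open.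
by apply/seteqP; split=> s; rewrite -ball_normE /= sub0r normrN.
Qed.

Lemma open_interval_norm_lt (R : realType) (d : R) : open_interval [set s : R | `|s| < d].
Proof.
split; first exact: open_norm_lt.
move=> x y /=; rewrite !ltr_norml => /andP[x1 x2] /andP[y1 y2] z /andP[xz zy].
by rewrite ltr_norml; apply/andP; split; lra.
Qed.

Section Surface.
Context {R : realType} {M : topologicalType} {n : nat} {I : Type}.
Variables (ch : I -> chart R M n) (g : I -> M -> 'M[R]_n) (N Psi : M -> R) (P : set (R * M)).
Hypothesis n3 : (3 <= n)%N.
Hypothesis es : electrostatic_spacetime ch g N Psi.
Hypothesis ph : st_photon_surface ch g N P.
Hypothesis eqp : equipotential ch g N Psi P.
Hypothesis nd : nondegenerate ch N P.
Local Notation st := (st_chart ch).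
Local Notation stg := (st_metric g N).
Local Notation u := (slice_lapse N P).
Local Notation t0 := (lshift n (0 : 'I_1)).

Lemma slice_lapseE p : P p -> u p.1 = N p.2.
Proof.
move=> Pp; rewrite /slice_lapse.
have : ([set N q.2 | q in time_slice P p.1]) (xget 0 [set N q.2 | q in time_slice P p.1]).
  by apply: xgetPex; exists (N p.2), p.
move=> [q qs <-]; by have [] // := eqp qs (_ : time_slice P p.1 p).
Qed.

Lemma st_chartP i : is_chart (st i). Proof. exact: st_is_chart es i. Qed.

Lemma quad_st i p (V : 'rV[R]_(1 + n)) :
  quad (stg i p) V = - N p.2 ^+ 2 * V 0 t0 ^+ 2 + quad (g i p.2) (rsubmx V).
Proof.
rewrite /quad /st_metric -{1 2}(hsubmxK V) tr_row_mx mul_row_block !mulmx0 addr0 add0r.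
rewrite mul_row_col mxE; congr (_ + _).
rewrite mxE big_ord1 mxE big_ord1 !mxE.
have -> : lshift n 0 = t0 by []. 
by rewrite expr2 expr2; ring.
Qed.

(** A null vector without time component would be null for the positive definite [g]. *)
Lemma null_time_neq0 i p (V : 'rV[R]_(1 + n)) : cdom (ch i) p.2 -> V != 0 ->
  quad (stg i p) V = 0 -> V 0 t0 != 0.
Proof.
move=> dp V0; rewrite quad_st => q; apply: contraNneq V0 => Vt.
have [_ [_ pos _ _] _ _ _] := es.
have Vr : rsubmx V = 0.
  apply/eqP; apply: contraT => Vr0; have := pos i p.2 _ dp Vr0.
  rewrite /inner -/(quad _ _); move: q; rewrite Vt expr0n/= mulr0 add0r => ->.
  by rewrite ltxx.
rewrite -(hsubmxK V) Vr; apply/eqP.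
have -> : lsubmx V = 0 by apply/rowP => a; rewrite mxE (ord1 a) mxE.
exact: row_mx0.
Qed.

Lemma N_smooth_st : smooth_fun st setT (N \o snd).
Proof.
move=> i; rewrite setIT st_imageT.
have [_ oO _ _ _] := es_chart es i.
apply: smooth_ext (smooth_rsubmx (k := 1) oO (@N_smooth _ _ _ _ _ _ _ _ es i)) => //.
by apply: open_comp => // y _; exact: continuous_rsubmx.
Qed.

Lemma differential_snd i (h : M -> R) p : smooth_fun ch setT h -> cdom (ch i) p.2 ->
  differential st i (h \o snd) p = row_mx 0 (differential ch i h p.2).
Proof.
move=> sh dp; have dh : differentiable (h \o cinv (ch i)) (rsubmx (cmap (st i) p)).
  by rewrite /= row_mxKr; apply: smooth_diff (sh i) _; exists p.2.
apply/rowP => a; rewrite mxE.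
have -> : (h \o snd) \o cinv (st i) = fun y => (h \o cinv (ch i)) (rsubmx y) by [].
case: (split_ordP a) => b ->.
  by rewrite partial_lsubmx// row_mxEl mxE.
by rewrite partial_rsubmx// row_mxEr mxE /= row_mxKr.
Qed.

(* dN - u' dt, a conormal of P since P is locally the level set N(x) = u(t). *)
Definition conormal i p : 'rV[R]_(1 + n) :=
  row_mx (const_mx (- u^`()%classic p.1)) (differential ch i N p.2).

Lemma pairing_conormal i p V : pairing (conormal i p) V =
  - u^`()%classic p.1 * V 0 t0 + pairing (differential ch i N p.2) (rsubmx V).
Proof.
rewrite -{1}(hsubmxK V) /pairing tr_row_mx mul_row_col mxE; congr (_ + _).
by rewrite mxE big_ord1 !mxE.
Qed.

Lemma pairing_dN i p V : cdom (ch i) p.2 -> pairing (differential st i (N \o snd) p) V =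
  pairing (differential ch i N p.2) (rsubmx V).
Proof.
have [_ _ sN _ _] := es.
move=> dp; rewrite differential_snd// -{1}(hsubmxK V) /pairing tr_row_mx mul_row_col mul0mx add0r.
by [].
Qed.

Lemma conormal_neq0 i p : P p -> cdom (ch i) p.2 -> conormal i p != 0.
Proof.
move=> Pp dp; apply: contraNneq (nd Pp dp) => /(congr1 rsubmx).
by rewrite row_mxKr => ->; rewrite linear0.
Qed.

Lemma time_derive i (J : set R) gamma (s : R) : smooth_curve st J gamma -> J s ->
  cdom (ch i) (gamma s).2 -> is_derive s 1 (fst \o gamma) (velocity st i gamma s 0 t0).
Proof.
move=> [_ sc] Js ds; rewrite mxE derive1E.
have -> : coord st i gamma t0 = fst \o gamma.
  by apply/funext => r; rewrite /coord /= row_mxEl mxE.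
have := sc i s Js ds t0 0%N.
rewrite derive1n0 (_ : coord st i gamma t0 = fst \o gamma); last first.
  by apply/funext => r; rewrite /coord /= row_mxEl mxE.
by move=> d; exact/derivableP.
Qed.

Lemma tangent_null_geodesic i p V : P p -> cdom (ch i) p.2 -> V != 0 ->
  quad (stg i p) V = 0 -> tangent st P i p V ->
  exists2 d, 0 < d & exists gamma : R -> R * M,
    [/\ null_geodesic st stg [set s : R | `|s| < d] gamma, gamma 0 = p,
        velocity st i gamma 0 = V, forall s, `|s| < d -> P (gamma s) &
        tangent_at st P gamma 0].
Proof.
move=> Pp dp V0 qV [W [f [Wp [oW sf fP df] fV]]].
have [d d0 [gamma [ng g0 gV gd]]] := null_geodesic_exists (st_pseudo_riemannian es) dp V0 qV.
have tg : tangent_at st P gamma 0.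
  split; first by rewrite g0.
  move=> j dj; exists W, f; split => //; first by rewrite g0.
  have [[sc _] _] := ng.
  have J0 : [set s : R | `|s| < d] 0 by rewrite /= normr0.
  have W0 : W (gamma 0) by rewrite g0.
  have di : cdom (st i) (gamma 0) by rewrite g0.
  (* [tangent_at] asks for tangency in all charts. In each of them the pairing is the derivative of
     [f] along the curve, which does not depend on the chart. *)
  have [_ h1] := derive_along (st_chartP i) sc J0 di W0 sf.
  have [_ h2] := derive_along (st_chartP j) sc J0 dj W0 sf.
  by rewrite -h2 h1 gV g0.
exists d => //; exists gamma; split => //.
move=> s sd; have [_ _ _ h] := ph.
have J0 : [set s : R | `|s| < d] 0 by rewrite /= normr0.
by have [] := h _ _ (open_interval_norm_lt d) ng 0 J0 tg s sd.
Qed.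

(* Along a null geodesic of P the time has nonzero derivative and u equals N: this
   alone yields the regularity of u. *)
Lemma null_geodesic_lapse i d gamma : 0 < d ->
  null_geodesic st stg [set s : R | `|s| < d] gamma -> (forall s, `|s| < d -> P (gamma s)) ->
  forall s, `|s| < d -> cdom (ch i) (gamma s).2 ->
  [/\ velocity st i gamma s 0 t0 != 0, derivable u (gamma s).1 1,
      pairing (conormal i (gamma s)) (velocity st i gamma s) = 0 &
      forall Q : R -> Prop, (forall r, `|r| < d -> Q (gamma r).1) ->
        \forall t \near (gamma s).1, Q t].
Proof.
move=> d0 ng Pg s sd ds; have [[sc geo] null] := ng.
pose J := [set s : R | `|s| < d].
have [v0 qv] := null i s sd ds.
have vt := null_time_neq0 ds v0 qv.
have da := time_derive sc sd ds.
have db := derive_along (st_chartP i) sc sd (ds : cdom (st i) (gamma s)) (Logic.I : setT (gamma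
    s)) N_smooth_st.
have [r r0 rJ] : exists2 r, 0 < r & forall s', `|s' - s| < r -> `|s'| < d.
  exists (d - `|s|); first by rewrite subr_gt0.
  move=> s' h; rewrite -(subrK s s'); apply: le_lt_trans (ler_normD _ _) _; lra.
have ca s' : `|s' - s| < r -> {for s', continuous (fst \o gamma)}.
  move=> h; have s'd := rJ _ h; apply: continuous_comp; last exact: cvg_fst.
  by have [cg _] := sc; apply: cg; rewrite inE.
have ub s' : `|s' - s| < r -> u ((fst \o gamma) s') = ((N \o snd) \o gamma) s'.
  by move=> h; rewrite /= slice_lapseE//; apply: Pg; exact: rJ.
have [du vu] := derive_of_comp r0 vt ca ub da db.
split => //.
- rewrite pairing_conormal derive1E vu pairing_dN// mulNr divfK// addNr//.
- move=> Q HQ; have [r' r'0 h] := inverse_control r0 vt ca da.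
  apply/nbhs_normP; exists r' => // t /= ht.
  have [|s' [s's <- _]] := h t; first by rewrite distrC.
  by apply: HQ; exact: rJ.
Qed.

(** Fixes one defining function at [p], whereas [tangent] lets each vector choose its own; the
    linear algebra of null vectors can then take place in the kernel of a single covector. *)
Lemma surface_timelike i p : P p -> cdom (ch i) p.2 ->
  exists W f v, [/\ W p, defining_function st P W f, pairing (differential st i f p) v = 0,
    inner stg i p v v < 0 & forall w, pairing (differential st i f p) w = 0 ->
      inner stg i p v w = 0 -> w != 0 -> 0 < inner stg i p w w].
Proof.
move=> Pp dp; have [_ _ tl _] := ph; have [v [[W [f [Wp dF fv]]] vv pos]] := tl i p Pp dp.
exists W, f, v; split => // w fw; apply: pos.
by exists W, f.
Qed.

Lemma stg_sym i p : cdom (ch i) p.2 -> (stg i p)^T = stg i p.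
Proof. by move=> dp; have [_ _ h _ _] := st_pseudo_riemannian es; exact: h. Qed.

(** A null geodesic that starts in a null direction tangent to P stays in P, and time moves along it
    with nonzero speed. It thus sweeps out a neighbourhood of times on which [u] is read off from
    [N]. *)
Lemma surface_point i p : P p -> cdom (ch i) p.2 ->
  derivable u p.1 1 /\ \forall t \near p.1, times P t.
Proof.
move=> Pp dp; have [W [f [v [Wp dF fv vv pos]]]] := surface_timelike Pp dp.
have [V [V0 qV fV]] := null_exists (leqW n3 : (2 < 1 + n)%N) (stg_sym dp) fv vv pos.
have tV : tangent st P i p V by exists W, f.
have [d d0 [gamma [ng g0 gV Pg _]]] := tangent_null_geodesic Pp dp V0 qV tV.
have dg : cdom (ch i) (gamma 0).2 by rewrite g0.
have z0 : `|0 : R| < d by rewrite normr0.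
have [_ du _ h] := null_geodesic_lapse d0 ng Pg z0 dg.
rewrite g0 in du h; split => //; apply: h => r rd.
by exists (gamma r); split => //; exact: Pg.
Qed.

Lemma lapse_derivable t : times P t -> derivable u t 1.
Proof.
by move=> [p [Pp <-]]; have [i dp] := es_cover es p.2; have [] := surface_point Pp dp.
Qed.

Lemma times_open : open (times P).
Proof.
move=> t [p [Pp <-]]; have [i dp] := es_cover es p.2.
by have [] := surface_point Pp dp.
Qed.

Lemma local_chart i p W f : P p -> cdom (ch i) p.2 -> W p -> defining_function st P W f ->
  let O := cmap (st i) @` (cdom (st i) `&` W) in
  [/\ open O, O (cmap (st i) p), smooth_on O (f \o cinv (st i)),
      (forall y, O y -> [/\ cdom (ch i) (cinv (st i) y).2, W (cinv (st i) y) &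
         cmap (st i) (cinv (st i) y) = y]) &
      forall y, O y -> (f (cinv (st i) y) = 0 <-> P (cinv (st i) y))].
Proof.
move=> Pp dp Wp [oW sf fP df] O; split.
- by apply: chart_image_open => //; exact: st_chartP.
- by exists p.
- exact: sf.
- by move=> y [q [dq Wq] <-]; rewrite (st_cmapK es dq).
- by move=> y [q [dq Wq] <-]; rewrite (st_cmapK es dq); split=> /(fP _ Wq).
Qed.

(** [H], which is N(x) - u(t) in coordinates, vanishes on P and is differentiable at [y] with
    gradient [conormal]; [tangent_transfer] applies since it asks for differentiability of [H] at
    [y] alone. *)
Lemma conormal_kernel i p W f V : P p -> cdom (ch i) p.2 -> W p -> defining_function st P W f ->
  pairing (differential st i f p) V = 0 -> pairing (conormal i p) V = 0.
Proof.
move=> Pp dp Wp dF fV; have [oO Oy sF OK OP] := local_chart Pp dp Wp dF.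
set O := cmap (st i) @` _ in oO Oy sF OK OP; set y := cmap (st i) p in Oy *.
pose H y := N (cinv (st i) y).2 - u (y 0 t0).
have dN : differentiable ((N \o snd) \o cinv (st i)) y.
  by apply: smooth_diff (@N_smooth_st i) _; exists p.
have yt : y 0 t0 = p.1 by rewrite /y /= row_mxEl mxE.
have du : derivable u p.1 1 by apply: lapse_derivable; exists p.
have dut : differentiable (u \o (fun z : 'rV[R]_(1 + n) => z 0 t0)) y.
  apply: differentiable_comp; first exact: differentiable_coord.
  by rewrite yt; apply/derivable1_diffP.
have dH : differentiable H y by exact: differentiableB dN dut.
have gH : pairing (grad H y) V = pairing (conormal i p) V.
  rewrite -derive_grad// (_ : H = ((N \o snd) \o cinv (st i)) - (u \o (fun z : 'rV[R]_(1 + n) =>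
      z 0 t0)))//.
  rewrite deriveB; [|exact: diff_derivable..].
  rewrite derive_grad// pairing_conormal -pairing_dN// addrC; congr (_ + _).
  have dc : differentiable (fun z : 'rV[R]_(1 + n) => z 0 t0) y by exact: differentiable_coord.
  have du' : differentiable u (y 0 t0) by rewrite yt; apply/derivable1_diffP.
  rewrite deriveE// diff_comp// /= -(deriveE _ dc) derive_partial//.
  rewrite (bigD1 t0)//= big1 => [|a at0]; last by rewrite partial_coord (negPf at0) mulr0.
  rewrite partial_coord eqxx mulr1 addr0 yt -[X in 'd _ _ X]mulr1 -[_ * 1]/(_ *: _) linearZ/=.
  rewrite -deriveE; last by apply/derivable1_diffP.
  by rewrite derive1E /GRing.scale/= mulrC mulNr.
rewrite -gH; apply: (tangent_transfer (F := f \o cinv (st i)) (O := O)) => //.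
- by move=> z Oz; exact: smooth_diff sF Oz.
- by have [_ h] := OP y Oy; apply: h; rewrite (st_cmapK es).
- have [_ _ _ df0] := dF; exact: df0 i p Wp Pp dp.
- move=> z Oz Fz; have [h _] := OP z Oz; have Pz := h Fz.
  rewrite /H -(slice_lapseE Pz) /=; have -> : lsubmx z 0 0 = z 0 t0 by rewrite mxE.
  by rewrite subrr.
Qed.

Lemma differential_conormal i p W f : P p -> cdom (ch i) p.2 -> W p -> defining_function st P W f ->
  exists2 c, c != 0 & conormal i p = c *: differential st i f p.
Proof.
move=> Pp dp Wp dF; have [_ _ _ df0] := dF.
have [c E] := pairing_colinear (df0 i p Wp Pp dp) (fun V => @conormal_kernel i p W f V Pp dp Wp dF).
exists c => //; apply: contraNneq (conormal_neq0 Pp dp) => c0.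
by rewrite E c0 scale0r.
Qed.

(** Frees tangency from the choice of a defining function: every such differential is a nonzero
    multiple of [conormal]. *)
Lemma tangentP i p V : P p -> cdom (ch i) p.2 ->
  tangent st P i p V <-> pairing (conormal i p) V = 0.
Proof.
move=> Pp dp; split=> [[W [f [Wp dF fV]]]|lV]; first exact: (conormal_kernel Pp dp Wp dF fV).
have [_ emb _ _] := ph; have [W [f [Wp dF]]] := emb p Pp.
exists W, f; split => //; have [c c0 E] := differential_conormal Pp dp Wp dF.
by move/eqP: lV; rewrite E pairingZl mulf_eq0 (negPf c0)/= => /eqP.
Qed.

Lemma null_tangent_exists i p : P p -> cdom (ch i) p.2 ->
  exists V, [/\ V != 0, quad (stg i p) V = 0 & tangent st P i p V].
Proof.
move=> Pp dp; have [W [f [v [Wp dF fv vv pos]]]] := surface_timelike Pp dp.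
have [V [V0 qV fV]] := null_exists (leqW n3 : (2 < 1 + n)%N) (stg_sym dp) fv vv pos.
by exists V; split => //; exists W, f.
Qed.

Lemma null_tangent_span i p l : P p -> cdom (ch i) p.2 ->
  (forall V, V != 0 -> quad (stg i p) V = 0 -> tangent st P i p V -> pairing l V = 0) ->
  exists c, l = c *: conormal i p.
Proof.
move=> Pp dp lV; have [W [f [v [Wp dF fv vv pos]]]] := surface_timelike Pp dp.
have [c c0 E] := differential_conormal Pp dp Wp dF.
apply: pairing_colinear; first exact: conormal_neq0.
move=> V; rewrite E pairingZl => /eqP; rewrite mulf_eq0 (negPf c0)/= => /eqP fV.
apply: (null_span (leqW n3 : (2 < 1 + n)%N) (stg_sym dp) fv vv pos) fV => V' V'0 qV' fV'.
by apply: lV => //; exists W, f.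
Qed.

(* On a line in the spatial direction grad N, the defining function of P has a zero
   near q, and N is strictly monotone, so this zero is q itself. *)
Lemma local_converse p : P p -> \forall q \near p, N q.2 = u q.1 -> P q.
Proof.
move=> Pp; have [i dp] := es_cover es p.2.
have [_ emb _ _] := ph; have [W [f [Wp dF]]] := emb p Pp.
have [oO Oy sF OK OP] := local_chart Pp dp Wp dF.
set O := cmap (st i) @` _ in oO Oy sF OK OP; set y := cmap (st i) p in Oy *.
have [c c0 E] := differential_conormal Pp dp Wp dF.
pose dN := differential ch i N p.2; have dN0 : dN != 0 by exact: nd.
pose e : 'rV[R]_(1 + n) := row_mx 0 dN.
have et : e 0 t0 = 0 by rewrite /e row_mxEl mxE.
have dNe : pairing (differential st i (N \o snd) p) e != 0.
  by rewrite pairing_dN// /e row_mxKr gt_eqF// pairing_gt0.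
have ellE : pairing (conormal i p) e != 0.
  by rewrite pairing_conormal et mulr0 add0r /e row_mxKr gt_eqF// pairing_gt0.
have fe : pairing (grad (f \o cinv (st i)) y) e != 0.
  by move: ellE; rewrite E pairingZl mulf_eq0 negb_or => /andP[].
have sN : smooth_on O ((N \o snd) \o cinv (st i)).
  by apply: smooth_sub (@N_smooth_st i) => z [q [dq Wq] <-]; exists q.
have Fy : (f \o cinv (st i)) y = 0 by have [_ h] := OP y Oy; apply: h; rewrite (st_cmapK es).
have [r r0 rP] := transversal_root oO Oy sF sN Fy fe dNe.
have oD : open (cdom (st i)) by have [] := st_chartP i.
have nearc : \forall q \near p, `|cmap (st i) q - y| <= r.
  have := chart_cmap_continuous (st_chartP i) (dp : cdom (st i) p).
  move/cvgrPdist_lt => /(_ _ r0); apply: filterS => q; rewrite distrC; exact: ltW.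
have nearD : \forall q \near p, cdom (st i) q by exact: open_nbhs_nbhs.
apply: filterS2 nearc nearD => q qr dq Nq.
have [t [Oz Fz Hz]] := rP _ qr.
set z := cmap (st i) q + t *: e in Oz Fz Hz.
have Pz : P (cinv (st i) z) by have [h _] := OP z Oz; exact: h.
have zt : (cinv (st i) z).1 = q.1.
  by rewrite /= mxE /z mxE [(t *: e) 0 _]mxE et mulr0 addr0 /= row_mxEl mxE.
have t0' : t = 0.
  apply: Hz; rewrite /= -/(cinv (st i) z).2 -[N (cinv _ _)]/(N (cinv (st i) z).2) -(slice_lapseE
      Pz) zt -Nq.
  by rewrite row_mxKr (es_cinvK es).
by move: Pz; rewrite /z t0' scale0r addr0 (st_cmapK es).
Qed.

End Surface.

(** * Propagation along null geodesics *)

Section Auxiliary.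
Context {R : realType}.

Lemma local_min_derive (f : R -> R) (x d : R) : is_derive x 1 f d ->
  (\forall s \near x, f x <= f s) -> d = 0.
Proof.
move=> fd fmin; apply/eqP; apply: contraT => d0; have nd : 0 < `|d| by rewrite normr_gt0.
have [r r0 rP] := is_derive1_near fd (divr_gt0 nd (ltr0Sn _ 1)).
have /nbhs_normP[r' /= r'0 r'P] := fmin.
pose h := Num.min r r' / 2; have h0 : 0 < h by rewrite divr_gt0// lt_min r0.
have hm : h < Num.min r r' by rewrite /h gtr_pMr ?lt_min ?r0//; lra.
have hr : h < r by apply: lt_le_trans hm _; rewrite ge_min lexx.
have hr' : h < r' by apply: lt_le_trans hm _; rewrite ge_min lexx orbT.
have key k : `|k| = h -> d * k = - (`|d| * h) -> False.
  move=> kh dk; have := rP (x + k); have := r'P (x + k).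
  rewrite /= opprD addrA subrr sub0r normrN addrAC subrr add0r kh dk => /(_ hr') h1 /(_ hr).
  rewrite ler_norml => /andP[_ h2]; have : 0 < `|d| * h by rewrite mulr_gt0.
  lra.
exfalso; have [dp|dn] := ltP 0 d.
  by apply: (key (- h)); [rewrite normrN gtr0_norm|rewrite gtr0_norm// mulrN].
by apply: (key h); [rewrite gtr0_norm|rewrite ler0_norm// mulNr opprK].
Qed.

(** Used in [propagation] to exclude that a chord between two zeros of [F] is a nonzero multiple of
    the gradient at one end. *)
Lemma grad_pairing_near m (O : set 'rV[R]_m) (F : 'rV[R]_m -> R) y :
  open O -> O y -> smooth_on O F -> grad F y != 0 ->
  exists2 r, 0 < r & (forall z, `|z - y| <= r -> O z) /\
    forall z z', `|z - y| <= r -> `|z' - y| <= r -> 0 < pairing (grad F z) (grad F z').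
Proof.
move=> oO Oy sF gF; set e := grad F y; pose k := pairing e e.
have k0 : 0 < k by exact: pairing_gt0.
pose S := \sum_a (2 * `|e 0 a| + 1).
have S0 : 0 <= S by apply: sumr_ge0 => a _; rewrite addr_ge0// mulr_ge0.
(* If all partial derivatives vary by at most [dl], at most 1, the pairing changes by at most
   [dl * S], which this choice keeps below [k]. *)
pose dl := Num.min 1 (k / (2 * (S + 1))).
have dl0 : 0 < dl by rewrite lt_min ltr01 divr_gt0// mulr_gt0// ltr_wpDl.
have dl1 : dl <= 1 by rewrite ge_min lexx.
have dlS : dl * S < k.
  have : dl <= k / (2 * (S + 1)) by rewrite ge_min lexx orbT.
  move=> /(ler_wpM2r S0) /le_lt_trans; apply.
  have -> : k / (2 * (S + 1)) * S = k * (S / (2 * (S + 1))) by ring.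
  by rewrite gtr_pMr// ltr_pdivrMr; lra.
have : \forall z \near y, O z /\ forall a, `|e 0 a - partial a F z| <= dl.
  suff h : \forall z \near y, forall a, `|e 0 a - partial a F z| <= dl.
    by apply: filterI h; exact: open_nbhs_nbhs.
  have hf := @filter_forall _ _ (fun (a : 'I_m) (z : 'rV[R]_m) => `|e 0 a - partial a F z| <=
      dl) (nbhs y) _.
  apply: hf => a; have := smooth_continuous (smooth_partial a sF) Oy.
  move/cvgrPdist_lt => /(_ _ dl0); apply: filterS => z; rewrite mxE; exact: ltW.
move=> /nbhs_le[r r0 rP]; exists r; first exact: r0.
split=> [z zr|z z' zr z'r]; first by have [] := rP z zr.
have [_ h1] := rP z zr; have [_ h2] := rP z' z'r.
apply: (@lt_le_trans _ _ (k - dl * S)); first by rewrite subr_gt0.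
rewrite /k !pairingE /S big_distrr/= -sumrB; apply: ler_sum => a _.
rewrite ![grad _ _ _ _]mxE.
move: (h1 a) (h2 a); rewrite mxE; move: (partial a F y) (partial a F z) (partial a F z') => E A B.
move=> hA hB.
have -> : A * B = E * E - E * (E - B) - (E - A) * E + (E - A) * (E - B) by ring.
have i1 : `|E * (E - B)| <= `|E| * dl by rewrite normrM ler_wpM2l.
have i2 : `|(E - A) * E| <= `|E| * dl by rewrite normrM mulrC ler_wpM2l.
have i3 : `|(E - A) * (E - B)| <= dl.
  rewrite normrM; apply: (@le_trans _ _ (dl * dl)); first exact: ler_pM.
  by rewrite ger_pMl.
move: i1 i2 i3; rewrite !ler_norml => /andP[_ i1] /andP[_ i2] /andP[i3 _].
lra.
Qed.

Lemma closed_norm_ball m (y : 'rV[R]_m) r : 0 < r -> closed [set z | `|z - y| <= r].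
Proof.
move=> r0; rewrite (_ : [set z | _] = closed_ball y r); first exact: closed_ball_closed.
by rewrite closed_ballE//; apply/seteqP; split=> z /=; rewrite distrC.
Qed.

Lemma bounded_norm_ball m (y : 'rV[R]_m) r (A : set 'rV[R]_m) :
  A `<=` [set z | `|z - y| <= r] -> bounded_set A.
Proof.
move=> Ar; exists (`|y| + r); split; first exact: num_real.
move=> x xr z /Ar /= zr; rewrite -(subrK y z); apply: le_trans (ler_normD _ _) _.
lra.
Qed.

(** The Euclidean squared distance; the norm on rows is the sup norm, which is not
    differentiable. *)
Definition sqdist m (q z : 'rV[R]_m) := \sum_a (z 0 a - q 0 a) * (z 0 a - q 0 a).

Lemma sqdist_smooth m (q : 'rV[R]_m) : smooth_on setT (sqdist q).
Proof.
have s a : smooth_on setT (fun z : 'rV[R]_m => z 0 a - q 0 a).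
  by apply: smooth_add; [exact: openT|exact: smooth_coord|exact: smooth_cst].
apply: smooth_sum; first exact: openT.
by move=> a; apply: smooth_mul; first exact: openT.
Qed.

Lemma sqdist_grad m (q z : 'rV[R]_m) v : pairing (grad (sqdist q) z) v = 2 * pairing (z - q) v.
Proof.
have h a : is_derive z v (fun y : 'rV[R]_m => y 0 a - q 0 a) (v 0 a).
  have dl : differentiable (fun y : 'rV[R]_m => y 0 a) z by exact: differentiable_coord.
  have E : 'D_v (fun y : 'rV[R]_m => y 0 a) z = v 0 a.
    rewrite derive_partial// (bigD1 a)//= big1 => [|b ab].
      by rewrite partial_coord eqxx mulr1 addr0.
    by rewrite partial_coord (negPf ab) mulr0.
  have := is_deriveB (derivableP (@diff_derivable _ _ _ _ _ v dl)) (is_derive_cst (q 0 a) z v).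
  by rewrite E subr0.
rewrite -derive_grad; last exact: smooth_diff (sqdist_smooth q) _.
rewrite (@derive_val _ _ _ _ _ _ _ (is_derive_bigsum (fun a => is_derive_mul (h a) (h a)))).
rewrite pairingE big_distrr/=; apply: eq_bigr => a _; rewrite !mxE; ring.
Qed.

Lemma sqdist_norm m (q z : 'rV[R]_m) r : 0 <= r -> sqdist q z <= m%:R * r ^+ 2 -> `|z - q| <=
    m%:R * r.
Proof.
move=> r0 h; apply: row_norm_le => [|a]; first by rewrite mulr_ge0.
have m1 : 1 <= m%:R :> R by rewrite ler1n; case: m a {q z h} => [[]|].
have mr : 0 <= m%:R * r by rewrite mulr_ge0.
rewrite -(ler_pXn2r (ltn0Sn 1))// real_normK ?num_real//.
apply: (@le_trans _ _ (sqdist q z)).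
  rewrite /sqdist (bigD1 a)//= !mxE expr2 lerDl; apply: sumr_ge0 => b _.
  by rewrite -expr2 sqr_ge0.
apply: le_trans h _; rewrite exprMn ler_wpM2r ?sqr_ge0//.
by rewrite expr2 ler_peMr// (le_trans ler01).
Qed.

Lemma sqdist_le m (q z : 'rV[R]_m) r : `|z - q| <= r -> sqdist q z <= m%:R * r ^+ 2.
Proof.
move=> zr; rewrite -[X in X%:R](card_ord m) mulr_natl -sumr_const; apply: ler_sum => a _.
have r0 : 0 <= r by exact: le_trans zr.
have h : `|z 0 a - q 0 a| <= r.
  by apply: le_trans zr; have := coord_norm_le (z - q) a; rewrite !mxE.
by rewrite -expr2 -real_normK ?num_real// ler_pXn2r ?nnegrE.
Qed.

End Auxiliary.

Section Propagation.
Context {R : realType} {M : topologicalType} {n : nat} {I : Type}.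
Variables (ch : I -> chart R M n) (g : I -> M -> 'M[R]_n) (N Psi : M -> R) (P : set (R * M)).
Hypothesis n3 : (3 <= n)%N.
Hypothesis es : electrostatic_spacetime ch g N Psi.
Hypothesis ph : st_photon_surface ch g N P.
Hypothesis eqp : equipotential ch g N Psi P.
Hypothesis nd : nondegenerate ch N P.
Local Notation st := (st_chart ch).
Local Notation stg := (st_metric g N).

(* A point z of P \ Q nearest to a point q of Q: null geodesics of P through z stay
   away from Q, so all null directions, hence all directions tangent to P at z, are
   orthogonal to z - q in the coordinates; for q close to z in P this forces z = q. *)
Lemma propagation (Q : set (R * M)) :
  Q `<=` P -> Q !=set0 ->
  (forall p, Q p -> \forall q \near p, P q -> Q q) ->
  (forall d gamma s, null_geodesic st stg [set r : R | `|r| < d] gamma ->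
    (forall r, `|r| < d -> P (gamma r)) -> `|s| < d -> Q (gamma s) -> Q (gamma 0)) ->
  Q = P.
Proof.
move=> QP Q0 Qopen Qinv; have [conn emb _ _] := ph.
(* An open set of the spacetime that cuts out Q on P; it witnesses that Q is open in P. *)
pose C := [set q | P q -> Q q]°.
have oC : open C by exact: open_interior.
have QE : Q = P `&` C.
  apply/seteqP; split=> [p Qp|p [Pp /nbhs_singleton]]; last by apply.
  by split; [exact: QP|exact: Qopen].
suff Qcl p : P p -> closure Q p -> Q p.
  apply: (conn Q Q0); first by exists C.
  exists (closure Q); first exact: closed_closure.
  by apply/seteqP; split=> [p Qp|p [Pp Cp]]; [split; [exact: QP|exact: subset_closure]|exact: Qcl].
move=> Pp clp; apply: contrapT => nQp.
have [i dp] := es_cover es p.2.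
have [W [f [Wp dF]]] := emb p Pp.
have [oO Oy sF OK OP] := local_chart es Pp dp Wp dF.
set O := cmap (st i) @` _ in oO Oy sF OK OP; set y := cmap (st i) p in Oy *.
set F := f \o cinv (st i) in sF.
have [_ _ fP df0] := dF.
have gF0 : grad F y != 0 by exact: df0 i p Wp Pp dp.
have [rho rho0 [rhoO rhoP]] := grad_pairing_near oO Oy sF gF0.
have oW : open W by case: dF.
(* Removing this open set from the ball leaves a compact set that represents P \ Q: the first part
   removes the points off P, the second those of Q. *)
pose A := (O `&` F @^-1` [set x | x != 0]) `|` (O `&` cinv (st i) @^-1` C).
have oA : open A.
  apply: openU.
    apply: (continuous_inP _ oO).1; last exact: open_neq.
    by move=> z; rewrite inE => Oz; exact: smooth_continuous sF Oz.
  apply: (continuous_inP _ oO).1 => // z; rewrite inE => -[q [dq _] <-].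
  by apply: (chart_cinv_continuous (st_chartP es i)); exists q.
pose K := [set z | `|z - y| <= rho] `&` ~` A.
have KP z : `|z - y| <= rho -> K z <-> P (cinv (st i) z) /\ ~ Q (cinv (st i) z).
  move=> zr; have Oz := rhoO z zr; have [h1 h2] := OP z Oz.
  split=> [[_ nA]|[Pz nQz]].
    have Pz : P (cinv (st i) z).
      by apply: h1; apply: contrapT => /eqP Fz; apply: nA; left.
    split=> //; rewrite QE => -[_ Cz]; apply: nA; right; by split.
  split=> // -[[_ /= /eqP]|[_ Cz]]; first by apply; exact: h2.
  by apply: nQz; rewrite QE.
have Kball : K `<=` [set z | `|z - y| <= rho] by move=> z [].
have cK : compact K.
  apply: bounded_closed_compact; first exact: bounded_norm_ball Kball.
  by apply: closedI; [exact: closed_norm_ball|exact: open_closedC].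
(* With m = 1 + n, a nearest point lies within m rho' of [qh], hence within (m + 1) rho' of [y].
   This is less than [rho], so it is interior to the ball and small motions of it stay
   admissible. *)
pose rho' := rho / ((1 + n)%:R + 2).
have m0 : 0 <= (1 + n)%:R :> R by [].
have m2 : 0 < (1 + n)%:R + 2 :> R by rewrite ltr_wpDl.
have rho'0 : 0 < rho' by rewrite divr_gt0.
have rho'E : ((1 + n)%:R + 2) * rho' = rho by rewrite /rho' mulrC divfK// gt_eqF.
have [q [Qq [dq qr]]] : exists q, Q q /\ cdom (st i) q /\ `|cmap (st i) q - y| < rho'.
  have nearD : \forall q \near p, cdom (st i) q.
    by apply: open_nbhs_nbhs; split => //; have [] := st_chartP es i.
  have nearr : \forall q \near p, `|cmap (st i) q - y| < rho'.
    have := chart_cmap_continuous (st_chartP es i) (dp : cdom (st i) p).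
    by move/cvgrPdist_lt => /(_ _ rho'0); apply: filterS => q; rewrite distrC.
  have [q [Qq [h1 h2]]] := clp _ (filterI nearD nearr).
  by exists q.
set qh := cmap (st i) q in qr.
have qrho : `|qh - y| <= rho.
  have := mulr_ge0 m0 (ltW rho'0); move: rho'E qr rho'0; clear -n3 es ph eqp nd; lra.
have cqh : cinv (st i) qh = q by rewrite (st_cmapK es dq).
have Ky : K y.
  by apply/KP; [rewrite subrr normr0 ltW|rewrite /y (st_cmapK es dp)].
have cs : {within K, continuous (sqdist qh)}.
  apply: continuous_in_subspaceT => z _.
  exact: smooth_continuous (sqdist_smooth qh) (Logic.I : setT z).
have [z] := EVT_min_rV (ex_intro _ y Ky) cK cs.
rewrite inE => Kz zmin.
have zq : `|z - qh| <= (1 + n)%:R * rho'.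
  apply: sqdist_norm; first exact: ltW.
  apply: (@le_trans _ _ (sqdist qh y)); first by apply: zmin; rewrite inE.
  by apply: sqdist_le; rewrite distrC ltW.
have zy : `|z - y| < rho.
  by have := ler_distD qh z y; move: zq rho'E qr rho'0; clear -n3 es ph eqp nd; lra.
have Oz : O z by apply: rhoO; exact: ltW.
have [Pz nQz] := (KP z (ltW zy)).1 Kz.
have [dz Wz zE] := OK z Oz.
set pz := cinv (st i) z in Pz nQz dz Wz zE.
(* By [Qinv] the geodesic in direction [V] cannot enter Q, so near 0 it runs in K and its distance
   to [qh] is minimal at 0; the derivative there vanishes. *)
have orth V : V != 0 -> quad (stg i pz) V = 0 -> tangent st P i pz V -> pairing (z - qh) V = 0.
  move=> V0 qV tV.
  have [d d0 [gamma [ng g0 gV Pg _]]] := tangent_null_geodesic es ph Pz dz V0 qV tV.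
  have [[sc _] _] := ng; have [cg sc'] := sc.
  have J0 : [set r : R | `|r| < d] 0 by rewrite /= normr0.
  have dg : cdom (st i) (gamma 0) by rewrite g0.
  have dx a : derivable (fun r => (cmap (st i) \o gamma) r 0 a) 0 1 by exact: sc' i 0 J0 dg a 0%N.
  have dS : differentiable (sqdist qh) ((cmap (st i) \o gamma) 0).
    exact: smooth_diff (sqdist_smooth qh) (Logic.I : setT _).
  have h := is_derive_curve dS dx.
  have cE : (cmap (st i) \o gamma) 0 = z by rewrite -[LHS]/(cmap (st i) (gamma 0)) g0.
  have E : \sum_a 'D_1 (fun r : R => (cmap (st i) \o gamma) r 0 a) 0 * partial a (sqdist qh)
      ((cmap (st i) \o gamma) 0)
      = 2 * pairing (z - qh) V.
    rewrite -sqdist_grad -gV pairingE; apply: eq_bigr => a _.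
    by rewrite mulrC cE; congr (_ * _); rewrite mxE// derive1E.
  have cg0 : {for 0, continuous gamma} by apply: cg; rewrite inE.
  have nd1 : \forall r \near (0 : R), cdom (st i) (gamma r).
    by apply: cg0; apply: open_nbhs_nbhs; split => //; have [] := st_chartP es i.
  have cx0 : {for 0, continuous (cmap (st i) \o gamma)}.
    by apply: continuous_comp => //; exact: chart_cmap_continuous (st_chartP es i) dg.
  have zr0 : 0 < rho - `|z - y| by rewrite subr_gt0.
  have nd2 : \forall r \near (0 : R), `|cmap (st i) (gamma r) - y| <= rho.
    move/cvgrPdist_lt: cx0 => /(_ _ zr0); apply: filterS => r.
    rewrite cE -[(cmap (st i) \o gamma) r]/(cmap (st i) (gamma r)) distrC => hr.
    have := ler_distD z (cmap (st i) (gamma r)) y; lra.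
  have nd3 : \forall r \near (0 : R), `|r| < d.
    by apply: open_nbhs_nbhs; split => //; exact: open_norm_lt.
  have /local_min_derive := h; rewrite E => /(_ _)/eqP.
  rewrite mulf_eq0 pnatr_eq0/= => hh; apply/eqP/hh.
  apply: filterS3 nd1 nd2 nd3 => r h1 h2 h3.
  have key : sqdist qh z <= sqdist qh (cmap (st i) (gamma r)).
    apply: zmin; rewrite inE; apply/KP => //.
    rewrite (st_cmapK es h1); split; first exact: Pg.
    by move=> /(Qinv d gamma r ng Pg h3); rewrite g0.
  by rewrite -cE in key; exact: key.
have [c1 E1] := null_tangent_span n3 es ph eqp nd Pz dz orth.
have [c2 _ E2] := differential_conormal n3 es ph eqp nd Pz dz Wz dF.
have E3 : z - qh = (c1 * c2) *: grad F z.
  by rewrite E1 E2 scalerA -[in RHS]zE.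
(* [F] vanishes at both [z] and [qh], so its gradient somewhere on the chord is orthogonal to
   [z - qh]. As [z - qh] is a multiple of the gradient at [z] and the two gradients have positive
   pairing, the multiple is zero, so [z] would lie in Q. *)
have [t t01|t /andP[h0 h1]] := @mean_value_grad _ _ F z qh.
  by apply: (smooth_diff sF); apply: rhoO; apply: segment_ball => //; exact: ltW.
have Fz : F z = 0 by exact: (OP z Oz).2.
have Oq : O qh by exact: rhoO.
have Fq : F qh = 0 by apply: (OP qh Oq).2; rewrite cqh; exact: QP.
rewrite Fz Fq subrr {2}E3 pairingZr => /esym/eqP; rewrite mulf_eq0 => /orP[/eqP c0|].
  have zqh : z = qh by apply/eqP; rewrite -subr_eq0 E3 c0 scale0r.
  by apply: nQz; rewrite /pz zqh cqh.
have := rhoP (qh + t *: (z - qh)) z; rewrite (ltW zy) => /(_ _ isT).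
have -> : `|qh + t *: (z - qh) - y| <= rho.
  by apply: segment_ball; [exact: ltW|exact: qrho|rewrite !ltW].
by move=> /(_ isT); rewrite lt0r => /andP[/negPf->].
Qed.

End Propagation.

(** * Time reflections and translations *)

Section Symmetry.
Context {R : realType} {M : topologicalType} {n : nat} {I : Type}.
Variables (ch : I -> chart R M n) (g : I -> M -> 'M[R]_n) (N Psi : M -> R) (P : set (R * M)).
Hypothesis n3 : (3 <= n)%N.
Hypothesis es : electrostatic_spacetime ch g N Psi.
Hypothesis ph : st_photon_surface ch g N P.
Hypothesis eqp : equipotential ch g N Psi P.
Hypothesis nd : nondegenerate ch N P.
Local Notation st := (st_chart ch).
Local Notation stg := (st_metric g N).
Local Notation u := (slice_lapse N P).
Local Notation t0 := (lshift n (0 : 'I_1)).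

Section Isometry.
Variables (e c : R).
Hypothesis e2 : e * e = 1.

Definition time_affine (p : R * M) : R * M := (e * p.1 + c, p.2).

Let phi (y : 'rV[R]_(1 + n)) : 'rV[R]_(1 + n) :=
  row_mx (const_mx (e * y 0 t0 + c)) (rsubmx y).

Let phiE i p : cmap (st i) (time_affine p) = phi (cmap (st i) p).
Proof. by rewrite /phi /= row_mxEl mxE row_mxKr. Qed.

Let phi_smooth (U : set 'rV[R]_(1 + n)) : open U -> forall b, smooth_on U (fun y => phi y 0 b).
Proof.
move=> oU b; case: (split_ordP b) => a ->.
  have s : smooth_on U (fun y : 'rV[R]_(1 + n) => e * y 0 t0 + c).
    apply: smooth_add => //; last exact: smooth_cst.
    by apply: smooth_mul => //; [exact: smooth_cst|exact: smooth_coord].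
  by apply: smooth_ext s => // y _; rewrite /phi row_mxEl mxE.
apply: smooth_ext (smooth_coord (U := U) (rshift 1 a)) => // y _.
by rewrite /phi row_mxEr mxE.
Qed.

Let S : 'M[R]_(1 + n) := block_mx e%:M 0 0 1%:M.

Let jac_phi y : jac phi y = S.
Proof.
have dc b : differentiable (fun z : 'rV[R]_(1 + n) => z 0 b) y by exact: differentiable_coord.
apply/matrixP => a b; rewrite mxE; case: (split_ordP b) => b' ->.
  rewrite (_ : (fun v => _) = fun v : 'rV[R]_(1 + n) => e * v 0 t0 + c); last first.
    by apply/funext => z; rewrite /phi row_mxEl mxE.
  have := is_deriveD (is_deriveZ e (derivableP (@diff_derivable _ _ _ _ _ (delta_mx 0 a) (dc t0))))
     (is_derive_cst c y (delta_mx 0 a : 'rV[R]_(1 + n))).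
  move=> /(@derive_val _ _ _ _ _ _ _) h.
  rewrite /partial [LHS]h addr0 -/(partial a (fun z : 'rV[R]_(1 + n) => z 0 t0) y) partial_coord.
  case: (split_ordP a) => a' ->.
    by rewrite /S block_mxEul (ord1 a') (ord1 b') eqxx mxE eqxx /GRing.scale/= mulr1.
  by rewrite /S block_mxEdl mxE eq_sym eq_lrshift /GRing.scale/= mulr0.
rewrite (_ : (fun v => _) = fun v : 'rV[R]_(1 + n) => v 0 (rshift 1 b')); last first.
  by apply/funext => z; rewrite /phi row_mxEr mxE.
rewrite partial_coord; case: (split_ordP a) => a' ->.
  by rewrite /S block_mxEur mxE eq_lrshift.
by rewrite /S block_mxEdr mxE eq_rshift.
Qed.

Let S_unit : S \in unitmx.
Proof.
rewrite /S unitmxE det_ublock det_scalar1 det1 mulr1 unitfE.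
by apply: contra_eqN e2 => /eqP->; rewrite mulr0 eq_sym oner_eq0.
Qed.

Let S_isometry i p : stg i p = S *m stg i (time_affine p) *m S^T.
Proof.
rewrite /S /st_metric tr_block_mx !trmx0 trmx1 tr_scalar_mx !mulmx_block.
rewrite !(mul0mx, mulmx0, mul1mx, mulmx1, addr0, add0r) /=.
congr block_mx; rewrite mul_scalar_mx mul_mx_scalar scalerA e2 scale1r //.
Qed.

Lemma time_affine_continuous : continuous time_affine.
Proof.
move=> p; have h1 : {for p, continuous (fun q : R * M => e * q.1 + c)}.
  have h : {for p, continuous (fun q : R * M => e * q.1)} by apply: cvgMr; exact: cvg_fst.
  by apply: (cvgD h); exact: cvg_cst.
have h2 : {for p, continuous (fun q : R * M => q.2)} by exact: cvg_snd.
exact: cvg_pair h1 h2.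
Qed.

(** In every product chart the map has the same expression [phi], with constant Jacobian [S]. Since
    the metric is static and e^2 = 1, [geodesic_transfer] applies with the same metric on both
    sides. *)
Lemma time_affine_null_geodesic J gamma : open J -> null_geodesic st stg J gamma ->
  null_geodesic st stg J (time_affine \o gamma) /\
  forall i s, J s -> cdom (ch i) (gamma s).2 ->
    velocity st i (time_affine \o gamma) s = velocity st i gamma s *m S.
Proof.
move=> oJ [[[cg sc] geo] null].
have pr := st_pseudo_riemannian es.
have key i s : J s -> cdom (ch i) (gamma s).2 ->
    [/\ forall a k, derivable (derive1n k (coord st i (time_affine \o gamma) a)) s 1,
      geodesic_at (coord_metric st stg i) (cmap (st i) (time_affine (gamma s)))
        (vel (cmap (st i) \o (time_affine \o gamma)) s) (acc (cmap (st i) \o (time_affine \o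
            gamma)) s) &
      vel (cmap (st i) \o (time_affine \o gamma)) s = vel (cmap (st i) \o gamma) s *m S].
  move=> Js ds; pose J' := J `&` gamma @^-1` cdom (st i).
  have [oD oO _ _ _] := st_is_chart es i.
  have oJ' : open J' by exact: curve_open.
  have Js' : J' s by [].
  pose x := cmap (st i) \o gamma.
  have cx : cinf_curve J' x by move=> a r k [Jr dr]; exact: sc.
  pose O := cmap (st i) @` cdom (st i).
  have J'O r : J' r -> O (x r) by move=> [_ dr]; exists (gamma r).
  have Ox y : O y -> O (phi y).
    by move=> [q dq <-]; exists (time_affine q) => //; rewrite phiE.
  have E : cmap (st i) \o (time_affine \o gamma) = phi \o x.
    by apply/funext => r; exact: phiE.
  have cov y : O y -> coord_metric st stg i y =
      jac phi y *m coord_metric st stg i (phi y) *m (jac phi y)^T.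
    move=> [q dq <-]; rewrite jac_phi -phiE !(coord_metricE pr)//; exact: S_isometry.
  have pm := coord_metric_pseudo pr i.
  have sphi := phi_smooth oO.
  split.
  - by move=> a k; have := cinf_curve_comp oJ' sphi cx J'O; rewrite -E => /(_ a s k Js').
  - have g0 := (geodesic_atE pr (ds : cdom (st i) (gamma s))).1 (geo i s Js ds).
    have := geodesic_transfer oJ' oO pm pm sphi Ox cov cx J'O Js' g0.
    by rewrite -E -phiE.
  - by rewrite E (vel_comp sphi cx Js' (J'O _ Js')) jac_phi.
split; last by move=> i s Js ds; have [_ _] := key i s Js ds.
split; first split.
- split.
    move=> s Js; apply: continuous_comp; first exact: cg.
    exact: time_affine_continuous.
  by move=> i s Js ds a k; have [h _ _] := key i s Js ds.
- move=> i s Js ds; apply/(geodesic_atE pr) => //.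
  by have [_ h _] := key i s Js ds.
- move=> i s Js ds; have [_ _ h] := key i s Js ds.
  have vE : velocity st i (time_affine \o gamma) s = velocity st i gamma s *m S by exact: h.
  have [v0 q0] := null i s Js ds; rewrite vE; split.
    apply: contraNneq v0 => /(congr1 (mulmxr (invmx S))) /=.
    by rewrite mulmxK// mul0mx => ->.
  by rewrite /inner -/(quad _ _) -(quad_jac _ (S_isometry i (gamma s))).
Qed.

Lemma pairing_conormal_affine i p V :
  e * u^`()%classic (e * p.1 + c) = u^`()%classic p.1 ->
  pairing (conormal ch N P i (time_affine p)) (V *m S) = pairing (conormal ch N P i p) V.
Proof.
move=> h; have VS : V *m S = row_mx (e *: lsubmx V) (rsubmx V).
  by rewrite -{1}(hsubmxK V) /S mul_row_block !mulmx0 addr0 add0r mulmx1 mul_mx_scalar.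
rewrite !pairing_conormal VS row_mxKr row_mxEl /= -h; congr (_ + _).
by rewrite !mxE; ring.
Qed.

(** The set to which [propagation] is applied. The equation for u' makes the conormal at the image
    pull back to the conormal at [p], so that [S] preserves tangency to P. *)
Definition invariant_point p :=
  [/\ P p, P (time_affine p) & e * u^`()%classic (e * p.1 + c) = u^`()%classic p.1].

Let lapse_invariance (t : R) : times P (e * t + c) ->
  (\forall r \near t, u (e * r + c) = u r) ->
  e * u^`()%classic (e * t + c) = u^`()%classic t.
Proof.
move=> Tt near_u.
have du := lapse_derivable n3 es ph eqp Tt.
have da : is_derive t 1 (fun r => c + r * e) e by exact: is_derive_affine.
have E : (fun r => c + r * e) t = e * t + c by rewrite addrC mulrC.
rewrite [RHS]derive1E -(near_eq_derive (f := u \o (fun r => c + r * e))).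
  have [dc vc] := da; rewrite -E in du.
  rewrite -derive1E (derive1_comp dc du) E mulrC; congr (_ * _).
  by rewrite derive1E vc.
by apply: filterS near_u => r <-; rewrite /= addrC mulrC.
Qed.

(** The image geodesic is tangent to P at [s], hence stays in P. The map preserves [N], so comparing
    [N] along both curves gives the symmetry of [u] at all times that the geodesic covers;
    differentiating it recovers the condition on u'. *)
Lemma invariant_along d gamma s : null_geodesic st stg [set r : R | `|r| < d] gamma ->
  (forall r, `|r| < d -> P (gamma r)) -> `|s| < d -> invariant_point (gamma s) ->
  forall r, `|r| < d -> invariant_point (gamma r) /\
    \forall t \near (gamma r).1, u (e * t + c) = u t.
Proof.
move=> ng Pg sd [Ps Pss us].
have d0 : 0 < d by apply: le_lt_trans sd.
have [ng' vE] := time_affine_null_geodesic (@open_norm_lt _ d) ng.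
have [_ _ _ stay] := ph.
have tg : tangent_at st P (time_affine \o gamma) s.
  split=> // i ds; apply/(tangentP n3 es ph eqp nd) => //.
  rewrite vE// pairing_conormal_affine//.
  by have [] := null_geodesic_lapse es eqp d0 ng Pg sd ds.
have Pg' r : `|r| < d -> P (time_affine (gamma r)).
  by move=> rd; have [] := stay _ _ (open_interval_norm_lt d) ng' s sd tg r rd.
move=> r rd; have [i dr] := es_cover es (gamma r).2.
have [_ _ _ h] := null_geodesic_lapse es eqp d0 ng Pg rd dr.
have near_u : \forall t \near (gamma r).1, u (e * t + c) = u t.
  apply: (h (fun t => u (e * t + c) = u t)) => r' r'd.
  by rewrite (slice_lapseE eqp (Pg r' r'd)) -(slice_lapseE eqp (Pg' r' r'd)).
split=> //; split; [exact: Pg|exact: Pg'|].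
by apply: lapse_invariance => //; exists (time_affine (gamma r)); split => //; exact: Pg'.
Qed.

Lemma invariant_near p : invariant_point p -> \forall t \near p.1, u (e * t + c) = u t.
Proof.
move=> ip; have [Pp _ _] := ip; have [i dp] := es_cover es p.2.
have [V [V0 qV tV]] := null_tangent_exists n3 es ph Pp dp.
have [d d0 [gamma [ng g0 _ Pg _]]] := tangent_null_geodesic es ph Pp dp V0 qV tV.
have z0 : `|0 : R| < d by rewrite normr0.
have ip0 : invariant_point (gamma 0) by rewrite g0.
by have [_] := invariant_along ng Pg z0 ip0 z0; rewrite g0.
Qed.

(** Openness combines [invariant_near] at [p] with [local_converse] at the image of [p]: a point of
    P near [p] has its image near that point and on the level set, so in P. Invariance along
    geodesics is [invariant_along]. *)
Lemma invariant_all : (exists p, invariant_point p) -> forall p, P p -> invariant_point p.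
Proof.
move=> [p0 ip0]; suff <- : [set p | invariant_point p] = P by [].
apply: (propagation n3 es ph eqp nd).
- by move=> p [].
- by exists p0.
- move=> p ip; have [Pp Pap _] := ip.
  have near_t : \forall q \near p, \forall t \near q.1, u (e * t + c) = u t.
    (* The equation for u' at a nearby [q] requires the symmetry of [u] in a neighbourhood of the
       time of [q], not only at that time. *)
    have : \forall r \near p.1, \forall t \near r, u (e * t + c) = u t.
      by apply: nbhs_interior; exact: invariant_near ip.
    by move=> h; exact: (@cvg_fst _ _ (nbhs p.1) (nbhs p.2) _) _ h.
  have near_P : \forall q \near p, N q.2 = u (e * q.1 + c) -> P (time_affine q).
    exact: time_affine_continuous (local_converse n3 es ph eqp nd Pap).
  apply: filterS2 near_t near_P => q hu hP Pq.
  have Paq : P (time_affine q).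
    by apply: hP; rewrite (nbhs_singleton hu) (slice_lapseE eqp Pq).
  by split=> //; apply: lapse_invariance => //; exists (time_affine q).
- move=> d gamma s ng Pg sd ip.
  have d0 : `|0 : R| < d by rewrite normr0; apply: le_lt_trans sd.
  by have [] := invariant_along ng Pg sd ip d0.
Qed.

End Isometry.
End Symmetry.

(** * Exceptional times *)

Section ExceptionalTimes.
Context {R : realType} {M : topologicalType} {n : nat} {I : Type}.
Variables (ch : I -> chart R M n) (g : I -> M -> 'M[R]_n) (N Psi : M -> R) (P : set (R * M)).
Hypothesis n3 : (3 <= n)%N.
Hypothesis es : electrostatic_spacetime ch g N Psi.
Hypothesis ph : st_photon_surface ch g N P.
Hypothesis eqp : equipotential ch g N Psi P.
Hypothesis nd : nondegenerate ch N P.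
Local Notation st := (st_chart ch).
Local Notation stg := (st_metric g N).
Local Notation u := (slice_lapse N P).
Local Notation E := (exceptional N P).

(* At the exceptional time s the reflection t |-> 2 s - t fixes the slice and its
   conormal, so the slice consists of invariant points. *)
Lemma exceptional_reflection s p : E s -> P p ->
  P (2 * s - p.1, p.2) /\ - u^`()%classic (2 * s - p.1) = u^`()%classic p.1.
Proof.
move=> [[q [Pq qs]] us] Pp; rewrite /= in qs.
have e2 : (-1 : R) * -1 = 1 by ring.
have aE (r : R) : -1 * r + 2 * s = 2 * s - r by ring.
have iq : invariant_point N P (-1) (2 * s) q.
  have E1 : -1 * q.1 + 2 * s = q.1 by rewrite qs; ring.
  split=> //; first by rewrite /time_affine E1 -surjective_pairing.
  by rewrite E1 qs us mulr0.
have [_ h1 h2] := invariant_all n3 es ph eqp nd e2 (ex_intro _ q iq) Pp.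
by move: h1 h2; rewrite /time_affine aE mulN1r.
Qed.

Lemma times_reflection s t : E s -> times P t ->
  times P (2 * s - t) /\ u (2 * s - t) = u t.
Proof.
move=> Es [p [Pp <-]]; have [Pr _] := exceptional_reflection Es Pp.
by split; [exists (2 * s - p.1, p.2)|rewrite (slice_lapseE eqp Pp) (slice_lapseE eqp Pr)].
Qed.

(** Two successive reflections compose to the translation by 2 (s' - s). As each of them preserves
    [times P], the translated time remains in it. *)
Lemma times_translation s s' t k : E s -> E s' -> times P t ->
  times P (t + (2 * (s' - s)) *+ k) /\ u (t + (2 * (s' - s)) *+ k) = u t.
Proof.
move=> Es Es' Tt; elim: k => [|k [Tk uk]]; first by rewrite mulr0n addr0.
have [T1 u1] := times_reflection Es Tk; have [T2 u2] := times_reflection Es' T1.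
have <- : 2 * s' - (2 * s - (t + (2 * (s' - s)) *+ k)) = t + (2 * (s' - s)) *+ k.+1.
  by rewrite mulrS; ring.
by split=> //; rewrite u2 u1.
Qed.

Lemma close_exceptional_lapse :
  (forall eps, 0 < eps -> exists s s', [/\ E s, E s', s < s' & s' - s <= eps]) ->
  forall t t', times P t -> times P t' -> u t = u t'.
Proof.
move=> close; suff h t t' : t <= t' -> times P t -> times P t' -> u t = u t'.
  by move=> t t' Tt Tt'; have [tt|/ltW tt] := leP t t'; [exact: h|apply/esym/h].
move=> tt Tt Tt'; apply/eqP; rewrite -subr_eq0 -normr_le0; apply/ler_addgt0Pl => eta eta0.
rewrite addr0; have cu : {for t', continuous u}.
  by apply: differentiable_continuous; apply/derivable1_diffP; exact: (lapse_derivable n3 es ph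
      eqp Tt').
move/cvgrPdist_lt: cu => /(_ _ eta0); rewrite -nbhs_nearE => /nbhs_normP[rho /= rho0 rhoP].
(* The period 2 (s' - s) is then at most rho / 2, so some multiple of it carries [t] to within [rho]
   of [t'], where [u] is [eta]-close to its value at [t']. *)
have [|s [s' [Es Es' ss' le]]] := close (rho / 4); first by rewrite divr_gt0.
pose d := 2 * (s' - s); have d0 : 0 < d by rewrite mulr_gt0// subr_gt0.
have x0 : 0 <= (t' - t) / d by rewrite divr_ge0 ?subr_ge0// ltW.
have := truncn_itv x0; set k := Num.truncn _ => /andP[k1 k2].
rewrite ler_pdivlMr// in k1; rewrite ltr_pdivrMr// in k2.
have [_ uk] := times_translation k Es Es' Tt.
rewrite -/d -mulr_natl in uk; rewrite -natr1 in k2.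
have dr : d < rho by rewrite /d; lra.
have tk : `|t' - (t + k%:R * d)| < rho by rewrite ger0_norm; lra.
by have := rhoP _ tk; rewrite /= uk distrC; exact: ltW.
Qed.

Lemma lapse_cst_derive : (forall t t', times P t -> times P t' -> u t = u t') ->
  forall t, times P t -> u^`()%classic t = 0.
Proof.
move=> uc t Tt; rewrite derive1E (near_eq_derive (g := fun=> u t)) ?derive_cst//.
have oT := times_open n3 es ph eqp.
by apply: filterS (open_nbhs_nbhs (conj oT Tt)) => r Tr; exact: uc.
Qed.

Lemma lapse_locally_cst t : (forall t, times P t -> u^`()%classic t = 0) -> times P t ->
  exists2 d, 0 < d & forall s, `|s| < d -> times P (t + s) /\ u (t + s) = u t.
Proof.
move=> u0 Tt; have oT := times_open n3 es ph eqp.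
have /nbhs_normP[d /= d0 dT] := open_nbhs_nbhs (conj oT Tt).
have Ts s : `|s| < d -> times P (t + s).
  by move=> sd; apply: dT; rewrite /= opprD addrA subrr sub0r normrN.
exists d => // s sd; split; first exact: Ts.
suff : `|u (t + s) - u (t + 0)| <= 0 * `|s|.
  by rewrite addr0 mul0r normr_le0 subr_eq0 => /eqP.
apply: (@mean_value_ineq _ (fun r => u (t + r)) (fun=> 0) d) => // [x xd|x _]; last by rewrite
    normr0.
have du := lapse_derivable n3 es ph eqp (Ts x xd).
have da : is_derive x 1 (fun r => t + r * 1) 1 by exact: is_derive_affine.
have E1 : (fun r : R => t + r) = (fun r => t + r * 1) by apply/funext => r; rewrite mulr1.
have du' : is_derive ((fun r => t + r * 1) x) 1 u 0.
  by rewrite mulr1 -(u0 _ (Ts x xd)) derive1E; exact/derivableP.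
have := @is_derive1_comp R u (fun r => t + r * 1) x 0 1 du' da; rewrite mul0r.
by rewrite (_ : u \o _ = fun r => u (t + r))//; apply/funext => r; rewrite /= mulr1.
Qed.

(** At the given point [p] short translations produce invariant points, since [u] is locally
    constant and P is locally its level set. [invariant_all] spreads each of these translations to
    all of P, so one bound [d] serves everywhere and the steps can be iterated. *)
Lemma surface_translation : (forall t, times P t -> u^`()%classic t = 0) ->
  forall p t, P p -> P (t, p.2).
Proof.
move=> u0 p t Pp; have e2 : (1 : R) * 1 = 1 by rewrite mulr1.
have Tp : times P p.1 by exists p.
have [d1 d10 d1P] := lapse_locally_cst u0 Tp.
have lc := local_converse n3 es ph eqp nd Pp.
have cs : {for p.1, continuous (fun r : R => (r, p.2))}.
  have h1 : {for p.1, continuous (fun r : R => r)} by exact: cvg_id.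
  have h2 : {for p.1, continuous (fun _ : R => p.2)} by exact: cvg_cst.
  exact: cvg_pair h1 h2.
have : \forall r \near p.1, N p.2 = u r -> P (r, p.2).
  by apply: (cs (fun q => N q.2 = u q.1 -> P q)); rewrite -surjective_pairing.
move=> /nbhs_normP[d2 /= d20 d2P].
pose d := Num.min d1 d2; have d0 : 0 < d by rewrite lt_min d10.
have step s : `|s| < d -> forall q, P q -> P (q.1 + s, q.2).
  rewrite lt_min => /andP[s1 s2] q Pq; have [Ts us] := d1P s s1.
  have aE (r : R) : 1 * r + s = r + s by rewrite mul1r.
  have Pps : P (p.1 + s, p.2).
    apply: d2P; first by rewrite /= opprD addrA subrr sub0r normrN.
    by rewrite us (slice_lapseE eqp Pp).
  have ip : invariant_point N P 1 s p.
    split=> //; first by rewrite /time_affine aE.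
    by rewrite aE !u0// mulr0.
  have [_] := invariant_all n3 es ph eqp nd e2 (ex_intro _ p ip) Pq.
  by rewrite /time_affine aE.
have iter_step s k : `|s| < d -> P (p.1 + s *+ k, p.2).
  move=> sd; elim: k => [|k IH]; first by rewrite mulr0n addr0 -surjective_pairing.
  by have := step s sd _ IH; rewrite /= mulrSr addrA.
have x0 : 0 <= `|t - p.1| / d by rewrite divr_ge0// ltW.
(* The displacement is cut into k + 1 equal steps; the strict upper bound on the truncation makes
   each shorter than [d]. *)
have := truncn_itv x0; set k := Num.truncn _ => /andP[_].
rewrite ltr_pdivrMr// => hk.
have k0 : 0 < k.+1%:R :> R by rewrite ltr0n.
have sumE : (t - p.1) / k.+1%:R *+ k.+1 = t - p.1.
  by rewrite -[LHS]mulr_natr divfK// gt_eqF.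
have := iter_step ((t - p.1) / k.+1%:R) k.+1; rewrite sumE subrKC; apply.
by rewrite normrM normfV (gtr0_norm k0) ltr_pdivrMr// mulrC.
Qed.

Lemma norm_dPsi_time i t x : cdom (ch i) x ->
  forall t', norm_dPsi ch g N Psi i (t, x) = norm_dPsi ch g N Psi i (t', x).
Proof.
move=> dx t'; have [_ _ _ _ sPsi] := es.
by rewrite /norm_dPsi !(differential_snd sPsi).
Qed.

Lemma lapse_cst_photon_sphere : (forall t, times P t -> u^`()%classic t = 0) ->
  photon_sphere ch g N Psi P.
Proof.
move=> u0; have tr := surface_translation u0; split; first exact: ph.
  exists [set x | exists t, P (t, x)]; apply/seteqP; split=> [[t x] Px|[t x] [t' Px]].
    by exists t.
  exact: tr t Px.
(* [p] is translated into the slice of [q], where [equipotential] applies; none of the three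
   quantities depends on time. *)
move=> p q Pp Pq; have Pp' : P (q.1, p.2) by exact: tr.
have [|//|h1 h2 h3] := @eqp q.1 (q.1, p.2) q; first by [].
split; [exact: h1|exact: h2|move=> i j di dj].
rewrite -(h3 i j di dj) {1}[p]surjective_pairing.
exact: (norm_dPsi_time p.1 di q.1).
Qed.

Lemma photon_sphere_lapse : photon_sphere ch g N Psi P ->
  forall t, times P t -> u^`()%classic t = 0.
Proof.
move=> [_ _ pc]; apply: lapse_cst_derive => t t' [p [Pp <-]] [q [Pq <-]].
by rewrite !(slice_lapseE eqp)//; have [] := pc p q Pp Pq.
Qed.

End ExceptionalTimes.

(** Two points of [A] with the same value of floor(t / eps) would be at distance at most [eps]. *)
Lemma separated_countable (R : realType) (A : set R) (eps : R) : 0 < eps ->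
  (forall t t', A t -> A t' -> t <> t' -> eps < `|t - t'|) -> countable A.
Proof.
move=> e0 sep; apply/countable_injP; exists (fun t => pickle (Num.floor (t / eps))).
move=> t t'; rewrite !inE => At At' /(pcan_inj pickleK) fE; apply: contrapT => tt'.
have := sep t t' At At' tt'; rewrite ltNge => /negP; apply.
have /andP[a1 a2] := floor_itv (t / eps); have /andP[b1 b2] := floor_itv (t' / eps).
rewrite -fE in b1 b2; rewrite intrD in a2 b2.
have E1 : t = t / eps * eps by rewrite divfK// gt_eqF.
have E2 : t' = t' / eps * eps by rewrite divfK// gt_eqF.
rewrite E1 E2 -mulrBl normrM (gtr0_norm e0) ger_pMl// ler_norml; apply/andP; split; lra.
Qed.

Theorem proposition5p10 (R : realType) (n : nat) (M : topologicalType)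
    (I : Type) (ch : I -> chart R M n) (g : I -> M -> 'M[R]_n)
    (N Psi : M -> R) (P : set (R * M)) :
  (3 <= n)%N ->
  electrostatic_spacetime ch g N Psi ->
  st_photon_surface ch g N P ->
  equipotential ch g N Psi P ->
  nondegenerate ch N P ->
  [/\ ~ photon_sphere ch g N Psi P <->
        (exists t, times P t /\ (slice_lapse N P)^`()%classic t <> 0),
      ~ photon_sphere ch g N Psi P ->
        countable (exceptional N P) /\
        (exists eps : R, 0 < eps /\
           forall t t', exceptional N P t -> exceptional N P t' -> t <> t' ->
             eps < `|t - t'|) &
      forall (tau : nat -> R) (t0 : R),
        (forall k, exceptional N P (tau k)) ->
        times P t0 ->
        (forall k, tau k <> t0) ->
        cluster (tau @ \oo) t0 ->
        photon_sphere ch g N Psi P /\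
        (forall t, times P t -> (slice_lapse N P)^`()%classic t = 0)].
Proof.
move=> n3 es ph eqp nd.
have close_sphere : (forall eps : R, 0 < eps -> exists s s', [/\ exceptional N P s,
    exceptional N P s', s <> s' & `|s - s'| <= eps]) ->
    forall t, times P t -> (slice_lapse N P)^`()%classic t = 0.
  move=> close; apply: (lapse_cst_derive n3 es ph eqp).
  apply: (close_exceptional_lapse n3 es ph eqp nd) => eps /close[s [s' [Es Es' /eqP ss' le]]].
  move: ss'; rewrite neq_lt => /orP[lt|lt].
    by exists s, s'; split=> //; apply: le_trans le; rewrite distrC ler_norm.
  by exists s', s; split=> //; apply: le_trans le; rewrite ler_norm.
have sphere := lapse_cst_photon_sphere n3 es ph eqp nd.
split.
- split=> [nS|[t [Tt ut]] /(photon_sphere_lapse n3 es ph eqp) h]; last exact: ut (h t Tt).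
  apply: contrapT => h; apply/nS/sphere => t Tt; apply: contrapT => ut.
  by apply: h; exists t.
- move=> nS; have [eps e0 sep] : exists2 eps : R, 0 < eps & forall t t', exceptional N P t ->
      exceptional N P t' -> t <> t' -> eps < `|t - t'|.
    apply: contrapT => h; apply/nS/sphere/close_sphere => eps e0; apply: contrapT => h'.
    apply: h; exists eps => // t t' Et Et' tt'; rewrite ltNge; apply/negP => le.
    by apply: h'; exists t, t'.
  by split; [exact: separated_countable sep|exists eps].
- move=> tau t0 Etau _ ntau cl.
  have nearby (eps : R) : 0 < eps -> exists k, `|tau k - t0| < eps.
    move=> e0; have rt : (tau @ \oo) (range tau) by exists 0%N => // k _; exists k.
    have [_ [[k _ <-] kb]] := cl _ _ rt (nbhsx_ballx t0 eps e0).
    by exists k; rewrite distrC; move: kb; rewrite -ball_normE.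
  suff h : forall t, times P t -> (slice_lapse N P)^`()%classic t = 0
    by split; [exact: sphere h|exact: h].
  apply: close_sphere => eps e0.
  (* The second member is chosen strictly closer to [t0] than the first, which forces the two
     exceptional times to differ. *)
  have [|k kt] := nearby (eps / 2); first by rewrite divr_gt0.
  have k0 : 0 < `|tau k - t0| by rewrite normr_gt0 subr_eq0; apply/eqP; exact: ntau.
  have [l lk] := nearby _ k0; exists (tau k), (tau l); split=> //.
    by move=> E; rewrite -E ltxx in lk.
  have := ler_distD t0 (tau k) (tau l); rewrite (distrC t0); lra.
Qed.
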